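(* Let $N\in\mathbb{N}$ and let $\mu,\nu\in\mathcal P(\mathbb{R}^N)$ be absolutely continuous with respect to Lebesgue measure. Then the set of biadapted Monge couplings $$\{(\mathrm{id},T)_\ast\mu \;:\; T:\mathbb{R}^N\to\mathbb{R}^N \text{ biadapted},\ T_\ast\mu=\nu\}$$ is dense in $\mathrm{Cpl}_{bc}(\mu,\nu)$ with respect to the weak topology. In particular, for every continuous bounded $c:\mathbb{R}^N\times\mathbb{R}^N\to\mathbb{R}$, $$\inf_{\pi\in\mathrm{Cpl}_{bc}(\mu,\nu)}\int c\,d\pi=\inf\Big\{\int c(x,T(x))\,d\mu(x)\;:\;T \text{ biadapted},\ T_\ast\mu=\nu\Big\}.$$
   Context: $\mathrm{Cpl}(\mu,\nu)$ denotes the set of probability measures on $\mathbb{R}^N\times\mathbb{R}^N$ with marginals $\mu$ and $\nu$; $T_\ast\mu=\mu\circ T^{-1}$ is the push-forward. All maps are Borel. A map $T=(T_1,\dots,T_N):\mathbb{R}^N\to\mathbb{R}^N$ is adapted if for each $t$, $T_t(x)$ depends only on $(x_1,\dots,x_t)$. $T$ is biadapted if it is bijective and both $T$ and $T^{-1}$ are adapted. For $t<N$ let $\mathcal F_t$ be the $\sigma$-algebra on $\mathbb{R}^N$ generated by the first $t$ coordinates. A coupling $\pi\in\mathrm{Cpl}(\mu,\nu)$ with disintegration $\pi(dx,dy)=\mu(dx)\pi^x(dy)$ is causal if for every $t<N$ and $B\in\mathcal F_t$ the map $x\mapsto\pi^x(B)$ is $\mathcal F_t$-measurable; it is bicausal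 if it is causal and its image under $(x,y)\mapsto(y,x)$ is a causal coupling of $\nu$ and $\mu$. $\mathrm{Cpl}_{bc}(\mu,\nu)$ denotes the set of bicausal couplings. *)

(* Defs.v *)
From HB Require Import structures.
From mathcomp Require Import all_boot all_order all_algebra.
From mathcomp Require Import all_classical all_reals all_analysis.
From mathcomp Require Import measurable_realfun.
Set Implicit Arguments. Unset Strict Implicit. Unset Printing Implicit Defensive.
Import Order.TTheory GRing.Theory Num.Theory.
Import numFieldNormedType.Exports.
Local Open Scope classical_set_scope.
Local Open Scope ring_scope.

Definition RN (R : realType) (N : nat) : Type :=
  g_sigma_algebraType (open : set (set 'rV[R]_N)).

Section defs.
Context (R : realType) (N : nat).
Local Notation E := (RN R N).

Definition coord (x : E) (i : 'I_N) : R := (x : 'rV[R]_N) ord0 i.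

Definition box (a b : 'rV[R]_N) : set E :=
  [set x | forall i : 'I_N, a ord0 i <= coord x i <= b ord0 i].

Definition lebesgue_null (A : set E) : Prop :=
  forall eps : R, 0 < eps ->
  exists a b : nat -> 'rV[R]_N,
    (forall k (i : 'I_N), a k ord0 i <= b k ord0 i) /\
    A `<=` \bigcup_k box (a k) (b k) /\
    (\sum_(0 <= k <oo) ((\prod_(i < N) (b k ord0 i - a k ord0 i))%:E) < eps%:E)%E.

Definition abs_cont_leb (mu : probability E R) : Prop :=
  forall A : set E, measurable A -> lebesgue_null A -> mu A = 0%E.

Definition adapted (T : E -> E) : Prop :=
  forall (i : 'I_N) (x y : E),
    (forall j : 'I_N, (j <= i)%N -> coord x j = coord y j) ->
    coord (T x) i = coord (T y) i.

Definition biadapted (T : E -> E) : Prop :=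
  exists Tinv : E -> E,
    [/\ measurable_fun setT T, measurable_fun setT Tinv,
        cancel T Tinv, cancel Tinv T & adapted T /\ adapted Tinv].

Definition pushes (T : E -> E) (mu nu : probability E R) : Prop :=
  forall B : set E, measurable B -> mu (T @^-1` B) = nu B.

Definition first_coords (t : 'I_N) (x : E) : RN R t :=
  \row_(i < t) coord x (widen_ord (ltnW (ltn_ord t)) i).

Definition Fsig (t : 'I_N) (B : set E) : Prop :=
  exists C : set (RN R t), measurable C /\ B = first_coords t @^-1` C.

Definition F_measurable_fun (t : 'I_N) (g : E -> \bar R) : Prop :=
  forall D : set (\bar R), measurable D -> Fsig t (g @^-1` D).

(* causality of a coupling given through its values on rectangles:
   m A B = pi (A `*` B), first marginal mu. *)
Definition causal (mu : probability E R) (m : set E -> set E -> \bar R) : Prop :=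
  exists k : R.-pker E ~> E,
    (forall A B, measurable A -> measurable B ->
       m A B = (\int[mu]_(x in A) k x B)%E) /\
    (forall (t : 'I_N) (B : set E), Fsig t B ->
       exists g : E -> \bar R, F_measurable_fun t g /\
         {ae mu, forall x, g x = k x B}).

Definition coupling (mu nu : probability E R) (pi : probability (E * E)%type R) : Prop :=
  forall A B : set E, measurable A -> measurable B ->
    pi (A `*` setT) = mu A /\ pi (setT `*` B) = nu B.

Definition bicausal (mu nu : probability E R) (pi : probability (E * E)%type R) : Prop :=
  [/\ coupling mu nu pi,
      causal mu (fun A B => pi (A `*` B)) &
      causal nu (fun A B => pi (B `*` A))].

Definition cont_bounded (f : E * E -> R) : Prop :=
  continuous (f : 'rV[R]_N * 'rV[R]_N -> R) /\
  exists M : R, forall z, `|f z| <= M.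

End defs.

(* Main.v *)
(* The conditional distribution functions of an absolutely continuous law, made bijective
   on every fibre by moving null sets around, give a biadapted change of variables under
   which mu and nu become laws of independent uniform innovations.  A coupling is bicausal
   only if, at each time, either innovation is independent of the joint past.  Cut
   (0,1) into k+1 cells.  Given the cells of both paths before time t, the joint law of
   the two cells at time t is then doubly stochastic up to normalization, so it is
   realized exactly by an interval exchange of (0,1).  Composing these
   exchanges coordinate by coordinate yields a biadapted T pushing mu to nu whose coupling
   gives each product of cells the same mass as the given one.  As k grows, step functions
   of the cells approximate the identity in probability, so integrals of bounded
   continuous functions converge.  Conversely (id,T)_* mu is bicausal for biadapted T,
   which gives equality of the two infima. *)

Require Import Defs.
From HB Require Import structures.
From mathcomp Require Import all_boot all_order all_algebra.
From mathcomp Require Import all_classical all_reals all_analysis.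
From mathcomp Require Import measurable_realfun.
From mathcomp Require Import ring lra zify.
Import Order.TTheory GRing.Theory Num.Theory.
Import numFieldNormedType.Exports.
Local Open Scope classical_set_scope.
Local Open Scope ring_scope.
Set Implicit Arguments. Unset Strict Implicit. Unset Printing Implicit Defensive.

(** Biadaptedness asks for a bijection of the whole space, so inverting conditional distribution
    functions almost everywhere is not enough; this forces the repair on exceptional fibres.
    Absolute continuity enters through one consequence: the graph of a Borel function of the past is
    null, so the conditional laws have no atoms. The conditional law of a coordinate given its past
    is never built: each conditional statement is an identity P(A, G <= v) = v P(A) for all events A
    of the past, and quantiles come from Hahn decompositions. The innovation of x_t is independent
    of the joint past because causality makes y_{<t} and x_t conditionally independent given x_{<t},
    while the innovation is independent of x_{<t}. Causality in one direction yields the row sums of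
    the matrix of cell masses, causality in the other its column sums. Grids of different sizes are
    not nested, so approximation is proved for all large k rather than along a refining sequence. *)

Section measurable_predicates.
Context d (T : measurableType d).
Implicit Types P Q : T -> Prop.

Lemma measurable_and P Q : measurable [set x | P x] ->
  measurable [set x | Q x] -> measurable [set x | P x /\ Q x].
Proof. exact: measurableI. Qed.

Lemma measurable_or P Q : measurable [set x | P x] ->
  measurable [set x | Q x] -> measurable [set x | P x \/ Q x].
Proof. exact: measurableU. Qed.

Lemma measurable_not P : measurable [set x | P x] ->
  measurable [set x | ~ P x].
Proof. exact: measurableC. Qed.

Lemma measurable_const (P : Prop) : measurable [set x : T | P].
Proof.
have [p|np] := pselect P.
  by rewrite (_ : mkset _ = setT)//; apply/seteqP; split.
by rewrite (_ : mkset _ = set0)//; apply/seteqP; split.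
Qed.

Lemma measurable_exists (I : countType) (P : I -> T -> Prop) :
  (forall i, measurable [set x | P i x]) -> measurable [set x | exists i, P i x].
Proof.
move=> mP; rewrite (_ : mkset _ = \bigcup_i [set x | P i x]).
  by apply: countable_bigcupT_measurable => //; exact: countableP.
by apply/seteqP; split => x /= [i]; exists i.
Qed.

Lemma measurable_forall (I : countType) (P : I -> T -> Prop) :
  (forall i, measurable [set x | P i x]) -> measurable [set x | forall i, P i x].
Proof.
move=> mP; rewrite (_ : mkset _ = ~` [set x | exists i, ~ P i x]).
  apply: measurableC; apply: measurable_exists => i.
  exact/measurable_not.
by apply/seteqP; split => x /=; [move=> h [i]; exact|move=> /forallNP h i;
  apply: contrapT; exact: h].
Qed.

Lemma measurable_preim d' (U : measurableType d') (f : T -> U) (A : set U) :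
  measurable_fun setT f -> measurable A -> measurable [set x | A (f x)].
Proof. by move=> mf mA; rewrite -[X in measurable X]setTI; exact: mf. Qed.

Lemma measurable_funI d' (U : measurableType d') (f : T -> U) :
  (forall A, measurable A -> measurable [set x | A (f x)]) ->
  measurable_fun setT f.
Proof. by move=> mf _ A mA; rewrite setTI; exact: mf. Qed.

Lemma measurable_fun_ifP d' (U : measurableType d') P (f g : T -> U) :
  measurable [set x | P x] -> measurable_fun setT f -> measurable_fun setT g ->
  measurable_fun setT (fun x => if `[< P x >] then f x else g x).
Proof.
move=> mP mf mg; apply: measurable_funI => A mA.
rewrite (_ : mkset _ =
  [set x | (P x /\ A (f x)) \/ (~ P x /\ A (g x))]).
  apply: measurable_or; apply: measurable_and => //;
    [exact: measurable_preim|exact: measurable_not|exact: measurable_preim].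
apply/seteqP; split => x /=; case: asboolP => Px; try tauto.
Qed.

Section realvalued.
Context (R : realType).
Implicit Types f g : T -> R.

Lemma measurable_ltr f g : measurable_fun setT f -> measurable_fun setT g ->
  measurable [set x | f x < g x].
Proof.
move=> mf mg; have := measurable_fun_ltr mf mg => /(_ measurableT [set true] I).
by rewrite setTI (_ : _ @^-1` _ = [set x | f x < g x]).
Qed.

Lemma measurable_ler f g : measurable_fun setT f -> measurable_fun setT g ->
  measurable [set x | f x <= g x].
Proof.
move=> mf mg; rewrite (_ : mkset _ = [set x | ~ (g x < f x)]).
  by apply/measurable_not/measurable_ltr.
by apply/seteqP; split => x /=; rewrite ltNge; [move=> -> | move/negP; rewrite negbK].
Qed.

Lemma measurable_eqr f g : measurable_fun setT f -> measurable_fun setT g ->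
  measurable [set x | f x = g x].
Proof.
move=> mf mg; rewrite (_ : mkset _ = [set x | f x <= g x /\ g x <= f x]).
  by apply: measurable_and; exact: measurable_ler.
apply/seteqP; split => x /=; first by move=> ->.
by move=> [h1 h2]; apply/eqP; rewrite eq_le h1.
Qed.

Lemma measurable_funR f : (forall a, measurable [set x | a < f x]) ->
  measurable_fun setT f.
Proof.
move=> h; apply: (@measurability _ _ _ _ _ _ _ (@RGenOInfty.measurableE R)) => //.
move=> _ [_ [a ->] <-]; rewrite setTI (_ : _ @^-1` _ = [set x | a < f x])//.
by apply/seteqP; split => x /=; rewrite in_itv/= andbT.
Qed.

Lemma measurable_funRle f : (forall a, measurable [set x | f x <= a]) ->
  measurable_fun setT f.
Proof.
move=> h; apply: measurable_funR => a.
rewrite (_ : mkset _ = [set x | ~ (f x <= a)]); first exact/measurable_not.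
by apply/seteqP; split => x /=; rewrite ltNge => /negP.
Qed.

Lemma measurable_funRlt f : (forall a, measurable [set x | f x < a]) ->
  measurable_fun setT f.
Proof.
move=> h; apply: (@measurability _ _ _ _ _ _ _ (@RGenInftyO.measurableE R)) => //.
move=> _ [_ [a ->] <-]; rewrite setTI (_ : _ @^-1` _ = [set x | f x < a])//.
Qed.

End realvalued.
End measurable_predicates.

(** * Real-valued probabilities of events *)

Section probability_reals.
Context d (T : measurableType d) (R : realType) (P : probability T R).
Implicit Types A B : set T.

(** Probabilities are taken in [R] so that the arithmetic decision procedures apply. *)
Definition pr A : R := fine (P A).

Lemma prE A : measurable A -> P A = (pr A)%:E.
Proof. by move=> mA; rewrite /pr fineK// fin_num_measure. Qed.

Lemma pr_ge0 A : 0 <= pr A.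
Proof. exact: fine_ge0. Qed.

Lemma pr_le1 A : measurable A -> pr A <= 1.
Proof. by move=> mA; rewrite -lee_fin -prE// probability_le1. Qed.

Lemma pr0 : pr set0 = 0.
Proof. by rewrite /pr measure0. Qed.

Lemma prT : pr setT = 1.
Proof. by rewrite /pr probability_setT. Qed.

Lemma le_pr A B : measurable A -> measurable B -> A `<=` B -> pr A <= pr B.
Proof.
by move=> mA mB AB; rewrite -lee_fin -!prE// le_measure// inE.
Qed.

Lemma prU A B : measurable A -> measurable B -> A `&` B = set0 ->
  pr (A `|` B) = pr A + pr B.
Proof.
move=> mA mB AB; apply: EFin_inj; rewrite EFinD -!prE//; first exact: measureU.
exact: measurableU.
Qed.

Lemma prID A B : measurable A -> measurable B ->
  pr A = pr (A `&` B) + pr (A `\` B).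
Proof.
move=> mA mB; rewrite -prU; [|exact: measurableI|exact: measurableD|].
  by rewrite setUIDK.
by rewrite setDE setIACA setICr setI0.
Qed.

Lemma prC A : measurable A -> pr (~` A) = 1 - pr A.
Proof.
move=> mA; rewrite -prT [X in _ = X - _](prID _ mA)//.
by rewrite setTI setTD addrC addKr.
Qed.

Lemma pr_leU A B : measurable A -> measurable B -> pr (A `|` B) <= pr A + pr B.
Proof.
move=> mA mB; rewrite (prID _ mA); last exact: measurableU.
rewrite lerD//; apply: le_pr => //; try solve [exact: measurableI
  |exact: measurableD|exact: measurableI (measurableU _ _ mA mB) mA].
- exact: measurableD (measurableU _ _ mA mB) mA.
- by move=> x [[]].
Qed.

Lemma pr_sum_seq (I : eqType) (s : seq I) (F : I -> set T) : uniq s ->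
  (forall i, measurable (F i)) ->
  (forall i j x, F i x -> F j x -> i = j) ->
  measurable [set x | exists2 i, i \in s & F i x] /\
  pr [set x | exists2 i, i \in s & F i x] = \sum_(i <- s) pr (F i).
Proof.
move=> us mF dF; elim: s us => [_|i s IH /= /andP[nis us]].
  rewrite big_nil (_ : mkset _ = set0) ?pr0//.
  by apply/seteqP; split => x // -[].
have [mIH {}IH] := IH us.
rewrite big_cons -IH (_ : mkset _ = F i `|` [set x | exists2 i, i \in s & F i x]).
  split; first exact: measurableU.
  rewrite prU//; apply/seteqP; split => x // -[Fi [j js Fj]].
  by move: nis; rewrite (dF _ _ _ Fi Fj) js.
apply/seteqP; split => x /= => [[j]|].
  by rewrite inE => /predU1P[->|js] Fj; [left|right; exists j].
move=> [Fi|[j js Fj]]; first by exists i; rewrite ?mem_head.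
by exists j => //; rewrite inE js orbT.
Qed.

Lemma pr_sum (I : finType) (F : I -> set T) :
  (forall i, measurable (F i)) ->
  (forall i j x, F i x -> F j x -> i = j) ->
  pr [set x | exists i, F i x] = \sum_i pr (F i).
Proof.
move=> mF dF; rewrite -big_enum/=.
have [_ <-] := pr_sum_seq (enum_uniq I) mF dF.
congr pr; apply/seteqP; split => x [i]; last by exists i.
by exists i => //; rewrite mem_enum.
Qed.

Lemma pr_le_sum (I : finType) (F : I -> set T) :
  (forall i, measurable (F i)) ->
  pr [set x | exists i, F i x] <= \sum_i pr (F i).
Proof.
move=> mF; rewrite -big_enum/=.
suff h (s : seq I) : measurable [set x | exists2 i, i \in s & F i x] /\
    pr [set x | exists2 i, i \in s & F i x] <= \sum_(i <- s) pr (F i).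
  have [_] := h (enum I); apply: le_trans.
  rewrite (_ : mkset _ = [set x | exists2 i, i \in enum I & F i x])//.
  apply/seteqP; split => x [i]; last by exists i.
  by exists i => //; rewrite mem_enum.
elim: s => [|i s [mIH IH]].
  rewrite big_nil (_ : mkset _ = set0) ?pr0//.
  by apply/seteqP; split => x // -[].
rewrite big_cons (_ : mkset _ = F i `|` [set x | exists2 i, i \in s & F i x]).
  split; first exact: measurableU.
  by apply: le_trans (pr_leU _ _) _ => //; rewrite lerD2l.
apply/seteqP; split => x /= => [[j]|].
  by rewrite inE => /predU1P[->|js] Fj; [left|right; exists j].
move=> [Fi|[j js Fj]]; first by exists i; rewrite ?mem_head.
by exists j => //; rewrite inE js orbT.
Qed.

Lemma pr_bigcup_le (F : nat -> set T) (c : R) :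
  (forall n, measurable (F n)) -> (forall n, F n `<=` F n.+1) ->
  (forall n, pr (F n) <= c) -> pr (\bigcup_n F n) <= c.
Proof.
move=> mF ndF Fc; have mU : measurable (\bigcup_n F n) by exact: bigcupT_measurable.
have := @nondecreasing_cvg_mu _ _ _ P F mF mU.
have nd : {homo F : n m / (n <= m)%N >-> (n <= m)%O}.
  by apply/nondecreasing_seqP => n; apply/subsetPset.
move=> /(_ nd) h; rewrite -lee_fin -prE//.
move/cvg_lim : (h) => <-//; apply: lime_le; first by apply/cvg_ex; exists (P (\bigcup_n F n)).
apply: nearW => n; rewrite [leLHS](_ : _ = (pr (F n))%:E) ?lee_fin//.
exact: prE.
Qed.

Lemma pr_bigcup0 (I : countType) (F : I -> set T) :
  (forall n, measurable (F n)) -> (forall n, pr (F n) = 0) ->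
  pr [set x | exists n, F n x] = 0.
Proof.
move=> mF F0.
have mU : measurable [set x | exists n, F n x] by exact: measurable_exists.
apply/eqP; rewrite eq_le pr_ge0 andbT.
pose G (n : nat) := if unpickle n is Some i then F i else set0.
have mG n : measurable (G n) by rewrite /G; case: unpickle.
rewrite -lee_fin -prE//.
rewrite (_ : mkset _ = \bigcup_n G n); last first.
  apply/seteqP; split => x /=.
    by move=> [n Fn]; exists (pickle n) => //; rewrite /G pickleK.
  by move=> [n _]; rewrite /G; case: unpickle => // i; exists i.
apply: le_trans (generalized_Boole_inequality P mG _) _.
  exact: bigcupT_measurable.
rewrite eseries0// => n _ _; rewrite /G; case: unpickle => [i|]; last by rewrite measure0.
by rewrite [LHS](prE (mF i)) F0.
Qed.

Lemma pr0_sub A B : measurable A -> measurable B -> A `<=` B -> pr B = 0 -> pr A = 0.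
Proof.
by move=> mA mB /(le_pr mA mB) AB B0; apply/eqP; rewrite eq_le pr_ge0 andbT -B0.
Qed.

Lemma pr_setDnull A B N : measurable A -> measurable B -> measurable N ->
  pr N = 0 -> (forall x, A x -> ~ N x -> B x) -> pr A <= pr B.
Proof.
move=> mA mB mN N0 AB; apply: (@le_trans _ _ (pr (B `|` N))).
  apply: le_pr => //; first exact: measurableU.
  by move=> x Ax; have [Nx|nNx] := pselect (N x); [right|left; exact: AB].
by apply: le_trans (pr_leU _ _) _ => //; rewrite N0 addr0.
Qed.

Lemma pr_eq_null A B N : measurable A -> measurable B -> measurable N ->
  pr N = 0 -> (forall x, ~ N x -> (A x <-> B x)) -> pr A = pr B.
Proof.
move=> mA mB mN N0 AB; apply/eqP; rewrite eq_le.
by rewrite !(@pr_setDnull _ _ N)// => x Ax /AB; tauto.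
Qed.

End probability_reals.

(** * Conditional quantiles and distribution functions *)

Section restricted_image.
Context d d' (T : measurableType d) (X : measurableType d') (R : realType).
Variables (P : probability T R) (f : T -> X) (D : set T).
Hypotheses (mf : measurable_fun setT f) (mD : measurable D).

(** The unnormalized law of [f] on the event [D]. The two proof arguments, absent from the body, let
    the structure of a finite measure be attached to it. *)
Definition rimage of measurable_fun setT f & measurable D :=
  fun A : set X => P ((f @^-1` A) `&` D).

Local Notation m := (rimage mf mD).

Let rimage0 : m set0 = 0%E.
Proof. by rewrite /rimage preimage_set0 set0I measure0. Qed.

Let rimage_ge0 A : (0 <= m A)%E. Proof. exact: measure_ge0. Qed.

Let rimage_sigma_additive : semi_sigma_additive m.
Proof.
move=> F mF tF mUF; rewrite /rimage preimage_bigcup setI_bigcupl.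
have mfF n : measurable (f @^-1` F n `&` D).
  by apply: measurableI => //; rewrite -[X in measurable X]setTI; exact: mf.
apply: measure_semi_sigma_additive => //; last exact: bigcupT_measurable.
apply/trivIsetP => /= i j _ _ ij; rewrite setIACA -preimage_setI.
by move/trivIsetP : tF => /(_ _ _ _ _ ij) ->//; rewrite preimage_set0 set0I.
Qed.

HB.instance Definition _ := isMeasure.Build _ _ _ m
  rimage0 rimage_ge0 rimage_sigma_additive.

Let rimage_fin : fin_num_fun m.
Proof.
move=> A mA; apply: fin_num_measure; apply: measurableI => //.
by rewrite -[X in measurable X]setTI; exact: mf.
Qed.

HB.instance Definition _ := @Measure_isFinite.Build _ _ _ m rimage_fin.

End restricted_image.

Lemma pr_rimage d d' (T : measurableType d) (X : measurableType d') (R : realType)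
    (P : probability T R) (f : T -> X) (D : set T)
    (mf : measurable_fun setT f) (mD : measurable D) (A : set X) :
  measurable A -> rimage P mf mD A = (pr P [set x | A (f x) /\ D x])%:E.
Proof.
move=> mA; rewrite -prE//; apply: measurable_and => //.
exact: measurable_preim.
Qed.

(* A measurable analogue of {x | conditional probability of E given x >= u}. *)
Lemma hahn_threshold d (X : measurableType d) d' (T : measurableType d')
    (R : realType) (M : probability T R) (f : T -> X) (E : set T) (u : R) :
  measurable_fun setT f -> measurable E ->
  exists P : set X, [/\ measurable P,
    (forall A, measurable A -> A `<=` P ->
      u * pr M [set z | A (f z)] <= pr M [set z | A (f z) /\ E z]) &
    (forall A, measurable A -> A `<=` ~` P ->
      pr M [set z | A (f z) /\ E z] <= u * pr M [set z | A (f z)])].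
Proof.
move=> mf mE.
(* The signed measure whose sign on A compares the conditional probability of [E] with [u]; its
   positive set is the required [P]. *)
pose nu := cadd (charge_of_finite_measure (rimage M mf mE))
  (cscale (- u) (charge_of_finite_measure (rimage M mf measurableT))).
have nuE A : measurable A ->
    nu A = (pr M [set z | A (f z) /\ E z] - u * pr M [set z | A (f z)])%:E.
  move=> mA; rewrite /nu /cadd /cscale /charge_of_finite_measure/=.
  rewrite !pr_rimage//= /cscale/= pr_rimage//.
  rewrite -EFinM -EFinD mulNr; congr (_ - u * pr _ _)%:E.
  by apply/seteqP; split => z //= [].
have [P [N [[mP posP] [mN negN] PN _]]] := Hahn_decomposition nu.
exists P; split => // A mA.
  by move=> AP; have := posP _ mA AP; rewrite [leRHS](nuE _ mA) lee_fin subr_ge0.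
move=> AP; have AN : A `<=` N.
  by move=> x Ax; have : setT x by []; rewrite -PN => -[/(AP _ Ax)|].
by have := negN _ mA AN; rewrite [leLHS](nuE _ mA) lee_fin subr_le0.
Qed.

Section threshold_families.
Context d (X : measurableType d) d' (T : measurableType d') (R : realType).
Variables (M : probability T R) (f : T -> X).
Hypothesis mf : measurable_fun setT f.

(** The events [E q] are nested, so above a point x the union is the [E q] of the first q, in the
    order [r], with x in [N q]. Splitting A according to this first q reduces a finite union to the
    single bounds; a countable one is an increasing limit. *)
Lemma pr_threshold_family (I : countType) (r : rel I) (E : I -> set T)
    (N : I -> set X) (c : R) :
  0 <= c -> total r -> transitive r -> (forall q, measurable (E q)) ->
  (forall q, measurable (N q)) -> (forall q q', r q q' -> E q' `<=` E q) ->
  (forall q A, measurable A -> A `<=` N q ->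
    pr M [set z | A (f z) /\ E q z] <= c * pr M [set z | A (f z)]) ->
  forall A, measurable A ->
    pr M [set z | A (f z) /\ exists q, N q (f z) /\ E q z] <=
    c * pr M [set z | A (f z)].
Proof.
move=> c0 tot_r tr_r mE mN rE bE.
have mf' A : measurable A -> measurable [set z | A (f z)].
  by move=> mA; exact: measurable_preim.
have mt (s : seq I) (B : set X) : measurable B ->
    measurable [set z | B (f z) /\ exists2 q, q \in s & N q (f z) /\ E q z].
  move=> mB; apply: measurable_and; first exact: mf'.
  rewrite (_ : mkset _ = [set z | exists q', q' \in s /\ (N q' (f z) /\ E q' z)]).
    apply: measurable_exists => q'; apply: measurable_and; first exact: measurable_const.
    by apply: measurable_and; [exact: mf'|exact: mE].
  by apply/seteqP; split => z [q'] => [? ?|[? ?]]; exists q'.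
have finite_case (s : seq I) : forall A, measurable A ->
    pr M [set z | A (f z) /\ exists2 q, q \in s & N q (f z) /\ E q z] <=
    c * pr M [set z | A (f z)].
  suff sorted_case (t : seq I) : sorted r t -> forall A, measurable A ->
      pr M [set z | A (f z) /\ exists2 q, q \in t & N q (f z) /\ E q z] <=
      c * pr M [set z | A (f z)].
    move=> A mA; have := sorted_case _ (sort_sorted tot_r s) _ mA.
    rewrite (_ : [set z | _ /\ exists2 q, q \in s & _] =
      [set z | A (f z) /\ exists2 q, q \in sort r s & N q (f z) /\ E q z])//.
    by apply/seteqP; split => z /= [Az [q qs NE]]; split => //; exists q => //;
      move: qs; rewrite mem_sort.
  elim: t => [_ A mA|q t IH rt A mA].
    rewrite (_ : [set z | _ /\ _] = set0) ?pr0 ?mulr_ge0 ?pr_ge0//.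
    by apply/seteqP; split => z //= [_ []].
  have /allP min_q := order_path_min tr_r rt.
  rewrite (_ : [set z | _ /\ _] =
    [set z | (A `&` N q) (f z) /\ E q z] `|`
    [set z | (A `\` N q) (f z) /\ exists2 q, q \in t & N q (f z) /\ E q z]); last first.
    apply/seteqP; split => z /=.
      move=> [Az [q']]; have [Nq|nNq] := pselect (N q (f z)).
        rewrite inE => /predU1P[->|/min_q/rE rE'] [_ Eq]; left; split => //.
        exact: rE'.
      rewrite inE => /predU1P[->|q't] [Nq' Eq] //.
      by right; split => //; exists q'.
    move=> [[[Az Nq] Eq]|[[Az _] [q' q't NE]]]; split => //.
      by exists q => //; exact: mem_head.
    by exists q' => //; rewrite inE q't orbT.
  rewrite prU; [|by apply: measurable_and; [exact: mf' (measurableI _ _ mA (mN q))|exact: mE]|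
    by apply: mt; exact: measurableD|]; last first.
    by apply/seteqP; split => z // [[[_ Nq] _] [[_ nNq] _]].
  rewrite (_ : [set z | A (f z)] = [set z | (A `&` N q) (f z)] `|` [set z | (A `\` N q) (f z)]).
    rewrite prU; [|exact: mf' (measurableI _ _ mA (mN q))|exact: mf' (measurableD mA (mN q))|].
      rewrite mulrDr lerD//; first by apply: bE => [|x []//]; exact: measurableI.
      by apply: IH; [exact: path_sorted rt|exact: measurableD].
    by apply/seteqP; split => z // [[_ Nq] [_ nNq]].
  by apply/seteqP; split => z /= => [Az|[[]|[]]//];
    have [Nq|nNq] := pselect (N q (f z)); [left|right].
move=> A mA.
pose F n := [set z | A (f z) /\
  exists2 q, q \in pmap unpickle (iota 0 n) & N q (f z) /\ E q z].
have -> : [set z | A (f z) /\ exists q, N q (f z) /\ E q z] = \bigcup_n F n.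
  apply/seteqP; split => z /=.
    move=> [Az [q NE]]; exists (pickle q).+1 => //; split => //; exists q => //.
    rewrite mem_pmap; apply/mapP; exists (pickle q); last by rewrite pickleK.
    by rewrite mem_iota /= add0n.
  by move=> [n _ [Az [q _ NE]]]; split => //; exists q.
apply: pr_bigcup_le => [n|n z [Az [q qn NE]]|n].
- exact: mt.
- split => //; exists q => //; move: qn; rewrite !mem_pmap => /mapP[k].
  rewrite mem_iota => kn qk; apply/mapP; exists k => //; rewrite mem_iota.
  by move: kn => /=; lia.
- exact: finite_case.
Qed.

End threshold_families.

Section conditional_quantile.
Context d (X : measurableType d) (R : realType).
Variable M : probability (X * R)%type R.
Hypothesis graph0 : forall phi : X -> R, measurable_fun setT phi ->
  pr M [set z | z.2 = phi z.1] = 0.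

Let mA1 (A : set X) : measurable A -> measurable [set z : X * R | A z.1].
Proof. by move=> mA; exact: measurable_preim. Qed.

Let mle (q : R) : measurable [set z : X * R | z.2 <= q].
Proof. by apply: measurable_ler => //; exact: measurable_cst. Qed.

Let mgt (q : R) : measurable [set z : X * R | q < z.2].
Proof. by apply: measurable_ltr => //; exact: measurable_cst. Qed.

(** [P q] plays the set of fibres where the conditional probability of z.2 <= q is at least [u], and
    [phi x] is the infimum of the rationals q with x in [P q]. Each [P q] is determined only up to
    null sets and need not be monotone in q; [low] and [high] control all q at once. *)
Lemma cond_quantile (u : R) : 0 < u < 1 ->
  exists2 phi : X -> R, measurable_fun setT phi & forall A, measurable A ->
    pr M [set z | A z.1 /\ z.2 <= phi z.1] = u * pr M [set z | A z.1].
Proof.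
move=> /andP[u0 u1].
have /choice[P HP] (q : rat) :=
  hahn_threshold M u (@measurable_fst _ _ X R) (mle (ratr q)).
have mP q : measurable (P q) by have [] := HP q.
have low A : measurable A ->
    pr M [set z | A z.1 /\ exists q, ~ P q z.1 /\ z.2 <= ratr q] <=
    u * pr M [set z | A z.1].
  apply: (@pr_threshold_family _ X _ _ R M fst measurable_fst rat >=%R
    (fun q => [set z : X * R | z.2 <= ratr q]) (fun q => ~` P q) u) => //.
  - exact: ltW.
  - by move=> x y; exact: le_total.
  - by move=> x y z /= yx xz; exact: le_trans xz yx.
  - by move=> q; exact: measurableC.
  - by move=> q q' /= q'q z /= /le_trans; apply; rewrite ler_rat.
  - by move=> q A' mA' A'P; have [_ _] := HP q; exact.
have high A : measurable A ->
    pr M [set z | A z.1 /\ exists q, P q z.1 /\ ratr q < z.2] <=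
    (1 - u) * pr M [set z | A z.1].
  apply: (@pr_threshold_family _ X _ _ R M fst measurable_fst rat <=%R
    (fun q => [set z : X * R | ratr q < z.2]) P (1 - u)) => //.
  - lra.
  - by move=> x y; exact: le_total.
  - exact: le_trans.
  - move=> q q' /= q'q z /=; apply: le_lt_trans; by rewrite ler_rat.
  - move=> q A' mA' A'P; have [_ + _] := HP q => /(_ _ mA' A'P).
    rewrite (prID M (mA1 mA') (mle (ratr q))).
    rewrite (_ : _ `&` _ = [set z | A' z.1 /\ z.2 <= ratr q])//.
    rewrite (_ : _ `\` _ = [set z | A' z.1 /\ ratr q < z.2]); first lra.
    by apply/seteqP; split => z /= [? h]; split => //; move: h; rewrite ltNge => /negP.
(* The fibres on which the infimum is finite; on the others, shown to be null, [phi] is set to 0. *)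
pose isfin x := (exists q, P q x) /\ exists r : rat, forall q, P q x -> r <= q.
pose phi x : R := if `[< isfin x >] then inf [set ratr q | q in [set q | P q x]] else 0.
have phi_lt x a : isfin x -> phi x < a <-> exists q, P q x /\ ratr q < a.
  move=> fx; rewrite /phi asboolT//; case: fx => [[q0 Pq0] [r Hr]].
  have hlb : has_lbound [set (ratr q : R) | q in [set q | P q x]].
    by exists (ratr r) => _ [q Pq <-]; rewrite ler_rat; exact: Hr.
  split; last first.
    move=> [q [Pq qa]]; apply: le_lt_trans qa; apply: ge_inf => //; by exists q.
  move=> h; have [|_ [q Pq <-] qa] := @inf_lt _ _ a _ h; last by exists q.
  by exists (ratr q0); exists q0.
have mfin : measurable [set x | isfin x].
  apply: measurable_and; first by apply: measurable_exists => q; exact: mP.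
  apply: measurable_exists => r; apply: measurable_forall => q.
  rewrite (_ : mkset _ = [set x | ~ P q x \/ r <= q]).
    by apply: measurable_or; [exact: measurable_not (mP q)|exact: measurable_const].
  apply/seteqP; split => x /= h; last by case: h.
  by have [Pq|nPq] := pselect (P q x); [right; exact: h|left].
have mphi : measurable_fun setT phi.
  apply: measurable_funRlt => a.
  rewrite (_ : mkset _ = [set x |
      (isfin x /\ exists q, P q x /\ ratr q < a) \/ (~ isfin x /\ (0 : R) < a)]).
    apply: measurable_or; apply: measurable_and => //; last 2 first.
    - exact: measurable_not.
    - exact: measurable_const.
    apply: measurable_exists => q; apply: measurable_and; first exact: mP.
    exact: measurable_const.
  apply/seteqP; split => x /=; have [fx|fx] := pselect (isfin x).
  - by move=> /(phi_lt _ _ fx); left.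
  - by rewrite /phi asboolF// => ?; right.
  - by move=> [[_]|[]//] /(phi_lt _ _ fx).
  - by move=> [[]//|[_]]; rewrite /phi asboolF.
pose low_event := [set z : X * R | exists q, ~ P q z.1 /\ z.2 <= ratr q].
pose high_event := [set z : X * R | exists q, P q z.1 /\ ratr q < z.2].
have mlow : measurable low_event.
  apply: measurable_exists => q; apply: measurable_and => //.
  by apply: measurable_not; exact: mA1.
have mhigh : measurable high_event.
  by apply: measurable_exists => q; apply: measurable_and => //; exact: mA1.
have null_fin : pr M [set z | ~ isfin z.1] = 0.
  pose B1 x := forall q, ~ P q x.
  pose B2 x := forall r : rat, exists q, P q x /\ q < r.
  have mB1 : measurable [set x | B1 x].
    by apply: measurable_forall => q; exact: measurable_not (mP q).
  have mB2 : measurable [set x | B2 x].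
    apply: measurable_forall => r; apply: measurable_exists => q.
    by apply: measurable_and; [exact: mP|exact: measurable_const].
  (* Over [B1] the event in [low] is everything, so its mass is at most [u] times itself, and u < 1.
     For [B2] the same works with [high] and 1 - u < 1. *)
  have B10 : pr M [set z | B1 z.1] = 0.
    have := low _ mB1; rewrite (_ : [set z | _ /\ _] = [set z | B1 z.1]).
      by have := pr_ge0 M [set z | B1 z.1]; nra.
    apply/seteqP; split => z /=; first by case.
    move=> Bz; split => //; have [q Hq] : exists q : rat, z.2 < ratr q.
      have : z.2 < z.2 + 1 by lra.
      by move=> /rat_in_itvoo[q]; rewrite in_itv/= => /andP[zq _]; exists q.
    by exists q; split; [exact: Bz|exact: ltW].
  have B20 : pr M [set z | B2 z.1] = 0.
    have := high _ mB2; rewrite (_ : [set z | _ /\ _] = [set z | B2 z.1]).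
      by have := pr_ge0 M [set z | B2 z.1]; nra.
    apply/seteqP; split => z /=; first by case.
    move=> Bz; split => //; have [r Hr] : exists r : rat, ratr r < z.2.
      have : z.2 - 1 < z.2 by lra.
      by move=> /rat_in_itvoo[q]; rewrite in_itv/= => /andP[_ qz]; exists q.
    have [q [Pq qr]] := Bz r; exists q; split => //.
    by apply: le_lt_trans Hr; rewrite ler_rat ltW.
  apply: (@pr0_sub _ _ _ _ _ ([set z : X * R | B1 z.1] `|` [set z | B2 z.1])).
  - by apply: measurable_not; exact: mA1 mfin.
  - by apply: measurableU; [exact: mA1 mB1|exact: mA1 mB2].
  - move=> z /= nf; have [[q Pq]|nP] := pselect (exists q, P q z.1); last first.
      by left => q Pq; apply: nP; exists q.
    right => r; apply: contrapT => h; apply: nf; split; first by exists q.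
    exists r => q' Pq'; rewrite leNgt; apply/negP => q'r; apply: h; by exists q'.
  - apply/eqP; rewrite eq_le pr_ge0 andbT.
    by apply: le_trans (pr_leU M (mA1 mB1) (mA1 mB2)) _; rewrite B10 B20 addr0.
have mN : measurable [set z : X * R | ~ isfin z.1 \/ z.2 = phi z.1].
  apply: measurable_or; first by apply: measurable_not; exact: mA1 mfin.
  by apply: measurable_eqr => //; exact: measurableT_comp.
have null_N : pr M [set z | ~ isfin z.1 \/ z.2 = phi z.1] = 0.
  apply/eqP; rewrite eq_le pr_ge0 andbT.
  apply: le_trans (pr_leU M _ _) _; last by rewrite null_fin graph0// addr0.
    by apply: measurable_not; exact: mA1 mfin.
  by apply: measurable_eqr => //; exact: measurableT_comp.
exists phi => // A mA.
have mAl : measurable [set z : X * R | A z.1 /\ z.2 <= phi z.1].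
  apply: measurable_and; first exact: mA1.
  by apply: measurable_ler => //; exact: measurableT_comp.
have mAg : measurable [set z : X * R | A z.1 /\ phi z.1 < z.2].
  apply: measurable_and; first exact: mA1.
  by apply: measurable_ltr => //; exact: measurableT_comp.
have le1 : pr M [set z | A z.1 /\ z.2 <= phi z.1] <= u * pr M [set z | A z.1].
  apply: le_trans (low _ mA); apply: pr_setDnull null_N _ => //.
    by apply: measurable_and => //; exact: mA1.
  move=> z /= [Az zphi] /not_orP[/contrapT fz /eqP zne]; split => //.
  have : z.2 < phi z.1 by rewrite lt_neqAle zne.
  move=> /rat_in_itvoo[q]; rewrite in_itv/= => /andP[zq qphi].
  exists q; split; last exact: ltW.
  move=> Pq; suff : phi z.1 < phi z.1 by rewrite ltxx.
  by apply/phi_lt => //; exists q.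
have le2 : pr M [set z | A z.1 /\ phi z.1 < z.2] <= (1 - u) * pr M [set z | A z.1].
  apply: le_trans (high _ mA); apply: pr_setDnull null_fin _ => //.
  - by apply: measurable_and => //; exact: mA1.
  - by apply: measurable_not; exact: mA1 mfin.
  - move=> z /= [Az phiz] /contrapT fz; split => //.
    exact/phi_lt.
(* The bounds [le1] and [le2] add up to the whole mass over A, so both are equalities. *)
have := prID M (mA1 mA) (measurable_ler (@measurable_snd _ _ X R) (measurableT_comp mphi measurable_fst)).
rewrite (_ : _ `&` _ = [set z | A z.1 /\ z.2 <= phi z.1])//.
rewrite (_ : _ `\` _ = [set z | A z.1 /\ phi z.1 < z.2]); first lra.
by apply/seteqP; split => z /= [? h]; split => //; move: h; rewrite ltNge => /negP.
Qed.
End conditional_quantile.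

Lemma ltrq1 (R : realType) (u : rat) : (ratr u < 1 :> R) = (u < 1).
Proof. by rewrite -(rmorph1 (@ratr R)) ltr_rat. Qed.

Section uniform_on.
Context d (T : measurableType d) (R : realType) (P : probability T R).

(** Given [E], the variable [G] is uniform on (0,1). Required for all [E] in a family of events, it
    also expresses independence of [G] from that family, without division by [pr P E]. *)
Definition uniform_on (E : set T) (G : T -> R) := forall v : R, 0 <= v <= 1 ->
  pr P [set z | E z /\ G z <= v] = v * pr P E.

Variables (E : set T) (G : T -> R).
Hypotheses (mE : measurable E) (mG : measurable_fun setT G) (GU : uniform_on E G).

Lemma uniform_on_itv (a b : R) : 0 <= a -> a <= b -> b <= 1 ->
  pr P [set z | E z /\ a < G z <= b] = (b - a) * pr P E.
Proof.
move=> a0 ab b1.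
have mGl (v : R) : measurable [set z | G z <= v].
  by apply: measurable_ler => //; exact: measurable_cst.
have := prID P (measurable_and mE (mGl b)) (mGl a).
rewrite (_ : _ `&` [set z | G z <= a] = [set z | E z /\ G z <= a]).
  rewrite (_ : _ `\` [set z | G z <= a] = [set z | E z /\ a < G z <= b]).
    by rewrite !GU; [lra|apply/andP; split; lra..].
  apply/seteqP; split => z /=.
    by move=> [[? ->]] /negP; rewrite -ltNge => ->.
  by move=> [? /andP[az ->]]; split => //; apply/negP; rewrite -ltNge.
apply/seteqP; split => z /=; first by move=> [[]].
by move=> [? za]; do !split => //; exact: le_trans za ab.
Qed.

End uniform_on.

Section uniform_graph.
Context d (T : measurableType d) d' (X : measurableType d') (R : realType).
Variables (M : probability T R) (f : T -> X) (G : T -> R).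
Hypotheses (mf : measurable_fun setT f) (mG : measurable_fun setT G).
Hypothesis GU : forall A (v : R), measurable A -> 0 <= v <= 1 ->
  pr M [set z | A (f z) /\ G z <= v] = v * pr M [set z | A (f z)].

Lemma uniform_in_itv (A : set X) (a b : R) : measurable A -> 0 <= a -> a <= b -> b <= 1 ->
  pr M [set z | A (f z) /\ a < G z <= b] = (b - a) * pr M [set z | A (f z)].
Proof.
move=> mA a0 ab b1.
by apply: uniform_on_itv => // [|v v01]; [exact: (measurable_preim mf mA)|exact: GU].
Qed.

(** Cut (0,1] into n+1 equal intervals: wherever g (f z) falls, the conditional probability that [G]
    falls into the same interval is 1/(n+1), so the event has at most this probability for every
    n. *)
Lemma uniform_graph0 (g : X -> R) : measurable_fun setT g ->
  pr M [set z | 0 < G z <= 1 /\ G z = g (f z)] = 0.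
Proof.
move=> mg.
have mgf : measurable_fun setT (g \o f) by exact: measurableT_comp.
have mlow : measurable [set z | 0 < G z <= 1 /\ G z = g (f z)].
  apply: measurable_and; last exact: measurable_eqr.
  rewrite (_ : mkset _ = [set z | 0 < G z /\ G z <= 1]).
    by apply: measurable_and; [apply: measurable_ltr|apply: measurable_ler] => //;
      exact: measurable_cst.
  by apply/seteqP; split => z /= /andP.
suff bnd (n : nat) : pr M [set z | 0 < G z <= 1 /\ G z = g (f z)] <= n.+1%:R^-1.
  apply/eqP; rewrite eq_le pr_ge0 andbT; apply/ler_addgt0Pr => e e0; rewrite add0r.
  have [n ne] : exists n : nat, n.+1%:R^-1 < e.
    by exists (Num.truncn e^-1); rewrite invf_plt ?posrE//; exact: truncnS_gt.
  exact: le_trans (bnd n) (ltW ne).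
pose c (k : nat) : R := k%:R / n.+1%:R.
have c0 k : 0 <= c k by rewrite divr_ge0.
have cS k : c k.+1 = c k + n.+1%:R^-1 by rewrite /c -natr1 mulrDl mul1r.
have cle k : c k <= c k.+1 by rewrite cS lerDl invr_ge0.
have chomo i j : (i <= j)%N -> c i <= c j by move=> ij; rewrite ler_pM2r ?ler_nat// invr_gt0.
have cn : c n.+1 = 1 by rewrite /c divff// pnatr_eq0.
pose A (k : 'I_n.+1) := [set x | c k < g x <= c k.+1].
have mA k : measurable (A k).
  rewrite /A (_ : mkset _ = [set x | c k < g x /\ g x <= c k.+1]).
    by apply: measurable_and; [apply: measurable_ltr|apply: measurable_ler] => //;
      exact: measurable_cst.
  by apply/seteqP; split => x /= /andP.
have Adisj (i j : 'I_n.+1) x : A i x -> A j x -> i = j.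
  rewrite /A /= => /andP[i1 i2] /andP[j1 j2]; apply: ord_inj.
  case: (ltngtP i j) => // /chomo h.
  - by have := lt_le_trans j1 (le_trans i2 h); rewrite ltxx.
  - by have := lt_le_trans i1 (le_trans j2 h); rewrite ltxx.
pose F (k : 'I_n.+1) := [set z | A k (f z) /\ c k < G z <= c k.+1].
have mF k : measurable (F k).
  rewrite /F; apply: measurable_and; first exact: measurable_preim.
  rewrite (_ : mkset _ = [set z | c k < G z /\ G z <= c k.+1]).
    by apply: measurable_and; [apply: measurable_ltr|apply: measurable_ler] => //;
      exact: measurable_cst.
  by apply/seteqP; split => x /= /andP.
have sub : [set z | 0 < G z <= 1 /\ G z = g (f z)] `<=` [set z | exists k, F k z].
  move=> z /= [/andP[G0 G1] Gg].
  suff [k [kn hk]] : exists k, (k < n.+1)%N /\ c k < G z <= c k.+1.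
    by exists (Ordinal kn); rewrite /F /A /= -Gg.
  have : G z <= c n.+1 by rewrite cn.
  elim: n.+1 => [|m IH Gm]; first by rewrite /c mul0r => /(lt_le_trans G0); rewrite ltxx.
  have [/IH[k [km hk]]|cG] := leP (G z) (c m).
    by exists k; split => //; exact: ltnW.
  by exists m; rewrite ltnSn cG Gm.
apply: le_trans (le_pr M mlow _ sub) _.
  by apply: measurable_exists => k; exact: mF.
rewrite (pr_sum M mF); last by move=> i j x [Ai _] [Aj _]; exact: Adisj Ai Aj.
under eq_bigr => k _.
  rewrite uniform_in_itv//; last by rewrite -cn chomo.
  rewrite cS addrAC subrr add0r; over.
rewrite -mulr_sumr -[leRHS]mulr1 ler_wpM2l ?invr_ge0//.
rewrite -(pr_sum M (fun k => measurable_preim mf (mA k))).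
  by apply: pr_le1; apply: measurable_exists => k; exact: measurable_preim mf (mA k).
by move=> i j x; exact: Adisj.
Qed.
End uniform_graph.

Section conditional_cdf.
Context d (X : measurableType d) (R : realType).
Variable M : probability (X * R)%type R.
Hypothesis graph0 : forall phi : X -> R, measurable_fun setT phi ->
  pr M [set z | z.2 = phi z.1] = 0.

Let mA1 (A : set X) : measurable A -> measurable [set z : X * R | A z.1].
Proof. by move=> mA; exact: measurable_preim. Qed.

(** For u < v let N be the set of fibres where the v-quantile is at most the u-quantile. Comparing
    the masses below the two quantiles gives v P(N) <= u P(N), so N is null, and there are countably
    many pairs. *)
Let strict_quantiles : exists Q : rat -> X -> R, [/\
  (forall u, measurable_fun setT (Q u)),
  (forall u v x, u < v -> 0 < u -> v < 1 -> Q u x < Q v x) &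
  (forall u A, 0 < u < 1 -> measurable A ->
    pr M [set z | A z.1 /\ z.2 <= Q u z.1] = ratr u * pr M [set z | A z.1])].
Proof.
have /choice[phi Hphi] (u : rat) : exists phi : X -> R, measurable_fun setT phi /\
    (0 < u < 1 -> forall A, measurable A ->
    pr M [set z | A z.1 /\ z.2 <= phi z.1] = ratr u * pr M [set z | A z.1]).
  have [u01|nu] := boolP (0 < u < 1); last by exists (fun=> 0); split => //; exact: measurable_cst.
  have [|phi mphi hphi] := @cond_quantile _ X R M graph0 (ratr u).
    by rewrite ltr0q ltrq1.
  by exists phi.
have mphi u : measurable_fun setT (phi u) by case: (Hphi u).
pose S x := forall uv : rat * rat, uv.1 < uv.2 -> 0 < uv.1 -> uv.2 < 1 ->
  phi uv.1 x < phi uv.2 x.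
have mS : measurable [set x | S x].
  apply: measurable_forall => -[u v] /=.
  have [h|h] := pselect (u < v /\ 0 < u /\ v < 1).
    rewrite (_ : mkset _ = [set x | phi u x < phi v x]); first exact: measurable_ltr.
    by apply/seteqP; split => x /=; [apply; case: h => [? []]|].
  rewrite (_ : mkset _ = setT)//; apply/seteqP; split => // x _ /= h1 h2 h3.
  by exfalso; apply: h.
have S0 : pr M [set z | ~ S z.1] = 0.
  pose N (uv : rat * rat) := [set x | (uv.1 < uv.2 /\ 0 < uv.1 /\ uv.2 < 1) /\
     phi uv.2 x <= phi uv.1 x].
  have mN uv : measurable (N uv).
    by apply: measurable_and; [exact: measurable_const|exact: measurable_ler].
  apply: (@pr0_sub _ _ _ _ _ [set z | exists uv, N uv z.1]).
  - by apply: measurable_not; exact: mA1 mS.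
  - by apply: measurable_exists => uv; exact: mA1 (mN uv).
  - move=> z /= /existsNP[[u v]] /not_implyP[uv] /not_implyP[u0] /not_implyP[v1] /negP.
    by rewrite -leNgt => h; exists (u, v).
  - apply: pr_bigcup0 => -[u v]; first exact: mA1 (mN _).
    have [[uv [u0 v1]]|h] := pselect (u < v /\ 0 < u /\ v < 1); last first.
      by rewrite (_ : (fun _ => _) = set0) ?pr0//; apply/seteqP; split => // x [].
    have Hv := (Hphi v).2 _ _ (mN (u, v)); have Hu := (Hphi u).2 _ _ (mN (u, v)).
    have {}Hu := Hu ltac:(by rewrite u0 (lt_trans uv)).
    have {}Hv := Hv ltac:(by rewrite v1 (lt_trans u0)).
    have : pr M [set z | N (u, v) z.1 /\ z.2 <= phi v z.1] <=
           pr M [set z | N (u, v) z.1 /\ z.2 <= phi u z.1].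
      apply: le_pr.
      - apply: measurable_and; first exact: mA1 (mN _).
        by apply: measurable_ler => //; exact: measurableT_comp.
      - apply: measurable_and; first exact: mA1 (mN _).
        by apply: measurable_ler => //; exact: measurableT_comp.
      - by move=> z /= [Nz zv]; split => //; apply: le_trans zv _; case: Nz.
    rewrite Hu Hv; move: uv; rewrite -(ltr_rat R) => uv vuN.
    have := pr_ge0 M [set z | N (u, v) z.1] => N0.
    by apply/eqP; rewrite eq_le N0 andbT; move: uv vuN N0 => /=; nra.
(* On exceptional fibres the quantile of level u is replaced by u itself, which keeps strict
   monotonicity valid on every fibre. *)
exists (fun u x => if `[< S x >] then phi u x else ratr u); split.
- by move=> u; apply: measurable_fun_ifP => //; exact: measurable_cst.
- move=> u v x uv u0 v1; case: asboolP => [Sx|_]; first exact: (Sx (u, v)).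
  by rewrite ltr_rat.
- move=> u A u01 mA; rewrite -(Hphi u).2//; apply: pr_eq_null S0 _ => //.
  + apply: measurable_and; first exact: mA1.
    apply: measurable_ler => //; apply: (@measurableT_comp _ _ _ _ _ _ (fun x => if `[< S x >] then phi u x else ratr u)) => //.
    by apply: measurable_fun_ifP => //; exact: measurable_cst.
  + apply: measurable_and; first exact: mA1.
    by apply: measurable_ler => //; exact: measurableT_comp.
  + by apply: measurable_not; exact: mA1 mS.
  + by move=> z /= /contrapT Sz; rewrite asboolT.
Qed.

(** [G] is the supremum of the levels whose quantile lies at or below z.2, [Qt] the supremum of the
    quantiles of lower level. Strict monotonicity of the rational quantiles gives
    [G (x, Qt (x, v)) = v] on every fibre; the other composition can fail, on the null set of the
    last clause. *)
Lemma cond_cdf : exists G Qt : X * R -> R, [/\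
  measurable_fun setT G, measurable_fun setT Qt,
  (forall x v, 0 < v < 1 -> G (x, Qt (x, v)) = v),
  (forall A (v : R), measurable A -> 0 <= v <= 1 ->
    pr M [set z | A z.1 /\ G z <= v] = v * pr M [set z | A z.1]) &
  pr M [set z | ~ (0 < G z < 1 /\ z.2 = Qt (z.1, G z))] = 0].
Proof.
have [Q [mQ Qlt QM]] := strict_quantiles.
have Qle u v x : u <= v -> 0 < u -> v < 1 -> Q u x <= Q v x.
  by rewrite le_eqVlt => /predU1P[->//|uv] u0 v1; exact/ltW/Qlt.
pose LG (z : X * R) := [set t : R | t = 0 \/ exists u : rat, [/\ 0 < u < 1, Q u z.1 <= z.2 & t = ratr u]].
pose G z := sup (LG z).
have LGub z : ubound (LG z) 1.
  by move=> t [->//|[u [/andP[_ u1] _ ->]]]; rewrite -(rmorph1 (@ratr R)) ler_rat ltW.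
have LG0 z : LG z 0 by left.
have LGsup z : has_sup (LG z) by split; [exists 0|exists 1].
have G0 z : 0 <= G z by apply: ub_le_sup => //; exists 1.
have G1 z : G z <= 1 by apply: ge_sup => //; exists 0.
have Ggt z u : 0 < u < 1 -> Q u z.1 <= z.2 -> ratr u <= G z.
  move=> u01 Qu; apply: ub_le_sup; first by exists 1.
  by right; exists u.
have ltG z a : a < G z -> a < 0 \/ exists u : rat, [/\ 0 < u < 1, Q u z.1 <= z.2 & a < ratr u].
  move=> /sup_gt[|t]; first by exists 0.
  by move=> [->|[u [u01 Qu ->]]] at_; [left|right; exists u].
have mG : measurable_fun setT G.
  apply: measurable_funR => a.
  rewrite (_ : mkset _ = [set z | a < 0 \/ exists u : rat, (0 < u < 1 /\ a < ratr u) /\ Q u z.1 <= z.2]).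
    apply: measurable_or; first exact: measurable_const.
    apply: measurable_exists => u; apply: measurable_and; first exact: measurable_const.
    by apply: measurable_ler => //; exact: measurableT_comp.
  apply/seteqP; split => z /=.
    by move=> /ltG[|[u []]]; [left|right; exists u].
  move=> [/lt_le_trans|[u [[u01 au] Qu]]]; first exact.
  by apply: lt_le_trans au _; exact: Ggt.
pose LQ (z : X * R) := [set t : R | exists u : rat, [/\ 0 < u < 1, ratr u < z.2 & t = Q u z.1]].
pose Qt z := if `[< 0 < z.2 < 1 >] then sup (LQ z) else 0.
have LQ_ub z v : 0 < v < 1 -> z.2 < ratr v -> ubound (LQ z) (Q v z.1).
  move=> /andP[v0 v1] zv t [u [/andP[u0 u1] uz ->]]; apply: Qle => //.
  by rewrite -(ler_rat R) (le_trans (ltW uz))// ltW.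
have ratin (a b : R) : 0 <= a -> a < b -> b <= 1 -> exists2 u : rat, 0 < u < 1 & a < ratr u < b.
  move=> a0 ab b1; have [q] := rat_in_itvoo ab; rewrite in_itv/= => /andP[aq qb].
  by exists q; rewrite ?aq// -(ltr0q R) -(ltrq1 R) (le_lt_trans a0 aq) (lt_le_trans qb b1).
have LQ_sup z : 0 < z.2 < 1 -> has_sup (LQ z).
  move=> /andP[z0 z1]; split.
    have [//|//|//|u u01 /andP[_ uz]] := ratin 0 z.2; first exact: ltW.
    by exists (Q u z.1); exists u.
  have [||//|v v01 /andP[zv _]] := ratin z.2 1; [exact: ltW|by []|].
  by exists (Q v z.1); exact: LQ_ub.
have mQt : measurable_fun setT Qt.
  have m01 : measurable [set z : X * R | 0 < z.2 < 1].
    rewrite (_ : mkset _ = [set z | 0 < z.2 /\ z.2 < 1]).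
      by apply: measurable_and; apply: measurable_ltr => //; exact: measurable_cst.
    by apply/seteqP; split => z /= /andP.
  apply: measurable_funR => a.
  rewrite (_ : mkset _ = [set z | (0 < z.2 < 1 /\ exists u : rat, (0 < u < 1) /\
      (ratr u < z.2 /\ a < Q u z.1)) \/ (~ (0 < z.2 < 1) /\ a < 0)]).
    apply: measurable_or; apply: measurable_and => //; last 2 first.
    - exact: measurable_not.
    - exact: measurable_const.
    apply: measurable_exists => u; apply: measurable_and; first exact: measurable_const.
    apply: measurable_and; apply: measurable_ltr => //; try exact: measurable_cst.
    exact: measurableT_comp.
  apply/seteqP; split => z /=; rewrite /Qt; case: asboolP => z01.
  - move=> /sup_gt[|t]; first by case: (LQ_sup z z01).
    by move=> [u [u01 uz ->]] aQ; left; split => //; exists u.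
  - by right.
  - move=> [[_ [u [u01 [uz aQ]]]]|[]//]; apply: lt_le_trans aQ _.
    by apply: ub_le_sup; [case: (LQ_sup z z01)|exists u].
  - by move=> [[]//|[]].
have GQt x v : 0 < v < 1 -> G (x, Qt (x, v)) = v.
  move=> v01; have /andP[v0 v1] := v01; rewrite /Qt asboolT//=.
  apply/eqP; rewrite eq_le; apply/andP; split; rewrite leNgt; apply/negP.
  - move=> /ltG[/(lt_trans v0)|[u [/andP[u0 u1]]]]; first by rewrite ltxx.
    move=> + vu; rewrite leNgt => /negP; apply => /=.
    have [||//|w w01 /andP[vw wu]] := ratin v (ratr u); [exact: ltW|by []| |].
      by rewrite ltW// ltrq1.
    apply: (@le_lt_trans _ _ (Q w x)).
      apply: ge_sup; first by case: (LQ_sup (x, v) v01).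
      exact: (LQ_ub (x, v)).
    by apply: Qlt; rewrite ?(ltr_rat R) in wu *; move: w01 => /andP[].
  - move=> h; have [|u u01 /andP[Gu uv]] := ratin _ _ (G0 _) h; first exact: ltW.
    suff : ratr u <= G (x, sup (LQ (x, v))) by rewrite leNgt Gu.
    apply: Ggt => //=; apply: ub_le_sup; first by case: (LQ_sup (x, v) v01).
    by exists u.
have mGle (v : R) : measurable [set z | G z <= v].
  by apply: measurable_ler => //; exact: measurable_cst.
have mQle u : measurable [set z : X * R | z.2 <= Q u z.1].
  by apply: measurable_ler => //; exact: measurableT_comp.
have GUlt A (v : R) : measurable A -> 0 <= v < 1 ->
    pr M [set z | A z.1 /\ G z <= v] <= v * pr M [set z | A z.1].
  move=> mA /andP[v0 v1]; apply/ler_addgt0Pr => e e0.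
  have [||u u01 /andP[vu uv]] := ratin v (Num.min (v + e) 1) v0.
  - by rewrite lt_min v1 andbT; lra.
  - by rewrite ge_min lexx orbT.
  have pA1 := pr_le1 M (mA1 mA); have pA0 := pr_ge0 M [set z | A z.1].
  apply: (@le_trans _ _ (ratr u * pr M [set z | A z.1])).
    rewrite -QM//; apply: le_pr; try by apply: measurable_and => //; exact: mA1.
    move=> z /= [Az Gz]; split => //; rewrite leNgt; apply/negP => /ltW /(Ggt _ _ u01).
    by move=> /le_trans/(_ Gz); rewrite leNgt vu.
  move: uv; rewrite lt_min => /andP[uve _]; nra.
have GU A (v : R) : measurable A -> 0 <= v <= 1 ->
    pr M [set z | A z.1 /\ G z <= v] = v * pr M [set z | A z.1].
  move=> mA /andP[v0]; rewrite le_eqVlt => /predU1P[->|v1].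
    rewrite mul1r; congr pr; apply/seteqP; split => z /=; first by case.
    by split.
  apply/eqP; rewrite eq_le GUlt//= ?v0//.
  move: v0; rewrite [X in is_true X -> _]le_eqVlt => /predU1P[<-|v0]; first by rewrite mul0r pr_ge0.
  apply/ler_addgt0Pr => e e0.
  have [|||u u01 /andP[vu uv]] := ratin (Num.max (v - e) 0) v.
  - by rewrite le_max lexx orbT.
  - by rewrite gt_max v0 andbT; lra.
  - exact: ltW.
  have pA1 := pr_le1 M (mA1 mA); have pA0 := pr_ge0 M [set z | A z.1].
  apply: (@le_trans _ _ (ratr u * pr M [set z | A z.1] + e)).
    by move: vu; rewrite gt_max => /andP[vu _]; nra.
  rewrite lerD2r -QM//; apply: le_pr; try by apply: measurable_and => //; exact: mA1.
  move=> z /= [Az zQ]; split => //; rewrite leNgt; apply/negP.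
  move=> /ltG[/(lt_trans v0)|[w [/andP[w0 w1] Qw vw]]]; first by rewrite ltxx.
  have : Q u z.1 < Q w z.1 by apply: Qlt => //; [rewrite -(ltr_rat R) (lt_trans uv)|case/andP: u01].
  by rewrite ltNge (le_trans Qw).
exists G, Qt; split => //.
have mGx : measurable_fun setT (fun z : X * R => Qt (z.1, G z)).
  by apply: measurableT_comp mQt _; exact: measurable_fun_pair.
pose N0 := [set z | G z <= 0].
pose N1 := [set z | 1 <= G z].
pose N2 (q : rat) := [set z | 0 < G z <= 1 /\ G z = G (z.1, ratr q)].
have mN0 : measurable N0 by exact: mGle.
have mN1 : measurable N1 by apply: measurable_ler => //; exact: measurable_cst.
have mGq q : measurable_fun setT (fun x => G (x, ratr q)).
  by apply: measurableT_comp mG _; apply: measurable_fun_pair => //; exact: measurable_cst.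
have mN2 q : measurable (N2 q).
  apply: measurable_and; last first.
    by apply: measurable_eqr => //; apply: (measurableT_comp (mGq q)).
  rewrite (_ : mkset _ = [set z | 0 < G z /\ G z <= 1]).
    by apply: measurable_and => //; apply: measurable_ltr => //; exact: measurable_cst.
  by apply/seteqP; split => z /= /andP.
have N00 : pr M N0 = 0.
  have := GU setT 0 measurableT; rewrite lexx ler01 mul0r => <-//.
  by congr pr; apply/seteqP; split => z //= [].
have N10 : pr M N1 = 0.
  apply/eqP; rewrite eq_le pr_ge0 andbT; apply/ler_addgt0Pr => e e0; rewrite add0r.
  pose v : R := Num.max (1 - e) 0.
  have v01 : 0 <= v <= 1 by rewrite /v le_max lexx orbT ge_max ler01; lra.
  have := GU setT v measurableT v01; rewrite (_ : [set z | setT z.1] = setT)// prT mulr1.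
  rewrite (_ : mkset _ = [set z | G z <= v]); last by apply/seteqP; split => z //= [].
  move=> hv; have := prC M (mGle v); rewrite hv => hC.
  have [v1|v1] := ltP v 1.
    apply: (@le_trans _ _ (pr M (~` [set z | G z <= v]))).
      apply: le_pr => //; first exact: measurableC.
      by move=> z /= /(lt_le_trans v1); rewrite ltNge => /negP.
    by rewrite hC /v lerBlDr -lerBlDl le_max lexx.
  have : v < 1 by rewrite /v gt_max ltr01 andbT; lra.
  by rewrite ltNge v1.
have N20 q : pr M (N2 q) = 0 by exact: (uniform_graph0 measurable_fst mG GU (mGq q)).
apply: (@pr0_sub _ _ _ _ _ ((N0 `|` N1) `|` [set z | exists q, N2 q z])).
- apply: measurable_not; apply: measurable_and; last exact: measurable_eqr.
  rewrite (_ : mkset _ = [set z | 0 < G z /\ G z < 1]).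
    by apply: measurable_and => //; apply: measurable_ltr => //; exact: measurable_cst.
  by apply/seteqP; split => z /= /andP.
- by apply: measurableU; [exact: measurableU|exact: measurable_exists].
- move=> z /= /not_andP[/negP|nz].
    by rewrite negb_and -!leNgt => /orP[?|?]; left; [left|right].
  have [?|z0] := leP (G z) 0; first by left; left.
  have [?|z1] := leP 1 (G z); first by left; right.
  right; have z01 : 0 < G z < 1 by rewrite z0.
  have Qz : Qt (z.1, G z) <= z.2.
    rewrite /Qt asboolT//=; apply: ge_sup; first by case: (LQ_sup (z.1, G z) z01).
    move=> _ [u /= [u01 uG ->]].
    have [ult0|[w [/andP[w0 w1] Qw uw]]] := ltG _ _ uG.
      by move/andP: u01 => [u0 _]; move: ult0; rewrite ltNge ler0q (ltW u0).
    by apply: le_trans Qw; apply: Qle => //; [move: uw; rewrite ltr_rat => /ltW|case/andP: u01].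
  have {}Qz : Qt (z.1, G z) < z.2 by rewrite lt_neqAle Qz andbT; apply/eqP => h; exact: nz.
  (* [G] is monotone along the fibre and equal at [Qt (z.1, G z)] and at z.2, hence constant in
     between. So [G z] is the value at a rational point, a function of z.1 alone, and
     [uniform_graph0] applies for each q. *)
  have [q] := rat_in_itvoo Qz; rewrite in_itv/= => /andP[Qq qz].
  have Gmono x (r s : R) : r <= s -> G (x, r) <= G (x, s).
    move=> rs; rewrite leNgt; apply/negP => /ltG[/(le_lt_trans (G0 _))|]; first by rewrite ltxx.
    by move=> [u [u01 /= Qu]]; rewrite ltNge Ggt//=; exact: le_trans Qu rs.
  exists q; split; first by rewrite z0 ltW.
  apply/eqP; rewrite eq_le; apply/andP; split; last first.
    by rewrite [leRHS](_ : _ = G (z.1, z.2)); [exact/Gmono/ltW|case: (z)].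
  by rewrite -[leLHS](GQt z.1 _ z01); exact/Gmono/ltW.
- apply/eqP; rewrite eq_le pr_ge0 andbT.
  apply: le_trans (pr_leU M _ _) _; [exact: measurableU|exact: measurable_exists|].
  rewrite (pr_bigcup0 mN2 N20) addr0.
  by apply: le_trans (pr_leU M _ _) _ => //; rewrite N00 N10 addr0.
Qed.

End conditional_cdf.

(** * Bijective uniformization of fibres *)

Section null_embedding.
Context (R : realType).

(** The ratio 1/3 is below 1/2, so that 2^n patterns of jumps times a tail of order 3^-n tends to
    0. *)
Let w (k : nat) : R := 3^-1 ^+ k.+1.

Let jump (k : nat) (x : R) : R :=
  if unpickle k is Some q then (if `[< (ratr q : R) < x >] then w k else 0) else 0.

Let S n x := \sum_(k < n) jump k x.

Let w_gt0 k : 0 < w k. Proof. by rewrite exprn_gt0. Qed.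

Let jump_ge0 k x : 0 <= jump k x.
Proof. by rewrite /jump; case: unpickle => // q; case: ifP => // _; exact: ltW. Qed.

Let jump_le k x y : x <= y -> jump k x <= jump k y.
Proof.
move=> xy; rewrite /jump; case: unpickle => // q.
case: asboolP => qx; case: asboolP => qy //; last exact: ltW.
by exfalso; apply: qy; exact: lt_le_trans qx xy.
Qed.

Let sum_w n : \sum_(k < n) w k = (1 - 3^-1 ^+ n) / 2.
Proof.
elim: n => [|n IH]; first by rewrite big_ord0 expr0 subrr mul0r.
by rewrite big_ord_recr /= IH /w exprS; field.
Qed.

Let jump_lew k x : jump k x <= w k.
Proof.
rewrite /jump; case: unpickle => [q|]; last exact: ltW.
by case: asboolP => // _; exact: ltW.
Qed.

(** A bound for all partial sums: 3^-n / 2 is the total weight of the terms from n on. *)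
Let U n x := S n x + 3^-1 ^+ n / 2.

Let S_nd n m x : (n <= m)%N -> S n x <= S m x.
Proof.
move=> /subnK <-; elim: (m - n)%N => // j IH.
by rewrite addSn /S big_ord_recr/= (le_trans IH)// lerDl.
Qed.

Let U_ni n m x : (n <= m)%N -> U m x <= U n x.
Proof.
move=> /subnK <-; elim: (m - n)%N => // j IH; apply: le_trans IH.
rewrite addSn /U /S big_ord_recr/= -addrA lerD2l.
have := jump_lew (j + n) x; rewrite /w exprS; lra.
Qed.

Let S_U n m x : S n x <= U m x.
Proof.
have SU k : S k x <= U k x by rewrite /U lerDl divr_ge0// exprn_ge0.
have [nm|/ltnW mn] := leqP n m; first exact: le_trans (S_nd _ nm) (SU m).
exact: le_trans (SU n) (U_ni _ mn).
Qed.

Let s x := sup [set S n x | n in setT].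

Let s_has_sup x : has_sup [set S n x | n in setT].
Proof.
by split; [exists (S 0 x); exists 0%N|exists (U 0 x) => _ [n _ <-]].
Qed.

Let S_s n x : S n x <= s x.
Proof. by apply: ub_le_sup; [case: (s_has_sup x)|exists n]. Qed.

Let s_U n x : s x <= U n x.
Proof. by apply: ge_sup; [case: (s_has_sup x)|move=> _ [m _ <-]]. Qed.

Let s_lt x y : x < y -> s x < s y.
Proof.
move=> xy; have [q] := rat_in_itvoo xy; rewrite in_itv/= => /andP[xq qy].
apply: (@lt_le_trans _ _ (s x + w (pickle q))); first by rewrite ltrDl.
rewrite -lerBrDr; apply: ge_sup; first by case: (s_has_sup x).
move=> _ [n _ <-]; rewrite lerBrDr.
apply: le_trans (S_s (maxn n (pickle q).+1) y).
apply: (@le_trans _ _ (S (maxn n (pickle q).+1) x + w (pickle q))).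
  by rewrite lerD2r; apply: S_nd; rewrite leq_maxl.
rewrite /S; have pq : (pickle q < maxn n (pickle q).+1)%N by rewrite leq_maxr.
rewrite (bigD1 (Ordinal pq))//= [leRHS](bigD1 (Ordinal pq))//=.
have -> : jump (pickle q) x = 0.
  by rewrite /jump pickleK asboolF//; apply/negP; rewrite -leNgt ltW.
have -> : jump (pickle q) y = w (pickle q) by rewrite /jump pickleK asboolT.
rewrite add0r [leLHS]addrC lerD2l; apply: ler_sum => i _.
exact/jump_le/ltW.
Qed.

(* Strictly increasing, with a jump at every rational: its range is a null set. *)
Let kappa x := 5 / 8 + s x / 2.

Let kappa_lt x y : x < y -> kappa x < kappa y.
Proof. by move=> /s_lt; rewrite /kappa; lra. Qed.

Let kappa_mono : {mono kappa : x y / x < y}.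
Proof.
move=> x y; have [/kappa_lt//|] := ltP x y.
by rewrite le_eqVlt => /predU1P[->|/kappa_lt/ltW]; rewrite ?ltxx// leNgt => /negbTE.
Qed.

Let kappa_bounds x : 1 / 2 < kappa x < 1.
Proof.
have := s_U 0 x; have := S_s 0 x; rewrite /U /S big_ord0 expr0 /kappa => ? ?.
by apply/andP; split; lra.
Qed.

Let measurable_kappa : measurable_fun setT kappa.
Proof.
apply: measurable_funR => a.
rewrite (_ : mkset _ = [set x | exists n : nat, (a - 5 / 8) * 2 < S n x]).
  apply: measurable_exists => n; apply: measurable_ltr; first exact: measurable_cst.
  rewrite /S; apply: measurable_sum => k; rewrite /jump.
  case: unpickle => [q|]; last exact: measurable_cst.
  apply: measurable_fun_ifP; [|exact: measurable_cst|exact: measurable_cst].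
  by apply: measurable_ltr => //; exact: measurable_cst.
apply/seteqP; split => x /=; rewrite /kappa.
  move=> h; have : (a - 5 / 8) * 2 < s x by lra.
  by move=> /sup_gt[|_ [n _ <-]]; [exists (S 0 x); exists 0%N|exists n].
by move=> [n]; have := S_s n x; lra.
Qed.

Let ok v := (exists q : rat, kappa (ratr q) < v) /\ (exists q : rat, v <= kappa (ratr q)).

Let kinv v := if `[< ok v >] then sup [set (ratr q : R) | q in [set q | kappa (ratr q) < v]] else 0.

Let kinv_has_sup v : ok v -> has_sup [set (ratr q : R) | q in [set q | kappa (ratr q) < v]].
Proof.
move=> [[q qv] [p vp]]; split; first by exists (ratr q); exists q.
exists (ratr p) => _ [r rv <-]; rewrite ltW// -kappa_mono.
exact: lt_le_trans rv vp.
Qed.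

Let kinvK x : kinv (kappa x) = x.
Proof.
have okx : ok (kappa x).
  split.
    have : x - 1 < x by lra.
    by move=> /rat_in_itvoo[q]; rewrite in_itv/= => /andP[_ qx]; exists q; rewrite kappa_mono.
  have : x < x + 1 by lra.
  by move=> /rat_in_itvoo[q]; rewrite in_itv/= => /andP[xq _]; exists q; rewrite ltW// kappa_mono.
rewrite /kinv asboolT//; apply/eqP; rewrite eq_le; apply/andP; split.
  apply: ge_sup; first by case: (kinv_has_sup okx).
  by move=> _ [q /= qx <-]; rewrite ltW// -kappa_mono.
rewrite leNgt; apply/negP => /rat_in_itvoo[q]; rewrite in_itv/= => /andP[hq qx].
suff : (ratr q : R) <= ratr q - (ratr q - sup [set ratr q | q in [set q | (kappa (ratr q) < kappa x)%R]]) by lra.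
rewrite opprB addrCA subrr addr0; apply: ub_le_sup; first by case: (kinv_has_sup okx).
by exists q => //=; rewrite kappa_mono.
Qed.

Let measurable_kinv : measurable_fun setT kinv.
Proof.
have mok : measurable [set v | ok v].
  by apply: measurable_and; apply: measurable_exists => q;
    [apply: measurable_ltr|apply: measurable_ler] => //; exact: measurable_cst.
apply: measurable_funR => a.
rewrite (_ : mkset _ = [set v | (ok v /\ exists q : rat, kappa (ratr q) < v /\ a < ratr q)
   \/ (~ ok v /\ a < 0)]).
  apply: measurable_or; apply: measurable_and => //; last 2 first.
  - exact: measurable_not.
  - exact: measurable_const.
  apply: measurable_exists => q; apply: measurable_and; last exact: measurable_const.
  by apply: measurable_ltr => //; exact: measurable_cst.
apply/seteqP; split => v /=; rewrite /kinv; case: asboolP => okv.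
- move=> /sup_gt[|_ [q qv <-] aq]; first by case: (kinv_has_sup okv).
  by left; split => //; exists q.
- by right.
- move=> [[_ [q [qv aq]]]|[]//]; apply: lt_le_trans aq _.
  by apply: ub_le_sup; [case: (kinv_has_sup okv)|exists q].
- by move=> [[]//|[]].
Qed.

(** The first n+1 jumps leave at most 2^(n+1) values for the partial sum, one for each set of
    rationals below x, and the remaining weights add at most 3^-(n+1) / 2. *)
Let kappa_null (e : R) : 0 < e -> exists (I : finType) (a : I -> R) (l : R),
  [/\ 0 < l, #|I|%:R * l <= e, (forall i, 0 <= a i /\ a i + l <= 1) &
     forall x, exists i, a i < kappa x <= a i + l].
Proof.
move=> e0.
have [n ne] : exists n : nat, (2 / 3) ^+ n.+1 < e.
  have : (fun n : nat => (2 / 3 : R) ^+ n) @ \oo --> (0 : R).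
    by apply: cvg_expr; rewrite ger0_norm//; lra.
  move=> /cvgr0Pnorm_lt/(_ _ e0)[n _ Hn]; exists n.
  by have := Hn n.+1 (leqnSn n); rewrite ger0_norm// exprn_ge0//; lra.
pose l : R := 3^-1 ^+ n.+1.
have l_gt0 : 0 < l by rewrite exprn_gt0.
have l_le : l <= 3^-1 by rewrite /l exprS ler_piMr// exprn_ile1//; lra.
pose c (b : {ffun 'I_n.+1 -> bool}) : R := \sum_(k < n.+1) (if b k then w k else 0).
have c0 b : 0 <= c b by apply: sumr_ge0 => k _; case: ifP => // _; exact: ltW.
have c1 b : c b <= 1 / 2.
  apply: (@le_trans _ _ (\sum_(k < n.+1) w k)).
    by apply: ler_sum => k _; case: ifP => // _; exact: ltW.
  by rewrite sum_w; move: l_gt0; rewrite /l; lra.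
(* For a given pattern [kappa] varies over an interval of length l / 4; the left end is moved down
   by another l / 4 because the covering intervals are open on the left. The offset 5 / 8 keeps them
   inside [0,1]. *)
exists {ffun 'I_n.+1 -> bool}, (fun b => 5 / 8 + c b / 2 - l / 4), (l / 2).
split => [||b|x].
- lra.
- rewrite card_ffun card_bool card_ord natrX.
  move: ne; rewrite expr_div_n -exprVn -/l.
  have : 0 < (2 : R) ^+ n.+1 by rewrite exprn_gt0.
  rewrite /l exprVn; nra.
- by have := c0 b; have := c1 b; split; lra.
- exists [ffun k : 'I_n.+1 => if unpickle k is Some q then `[< (ratr q : R) < x >] else false].
  have -> : c [ffun k : 'I_n.+1 => if unpickle k is Some q then `[< (ratr q : R) < x >] else false] = S n.+1 x.
    by apply: eq_bigr => k _; rewrite ffunE /jump; case: unpickle.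
  have := S_s n.+1 x; have := s_U n.+1 x; rewrite /U -/l /kappa => ? ?.
  by apply/andP; split; lra.
Qed.

(** A place to store a whole exceptional fibre at no cost in measure. Values above 1/2 keep the
    range disjoint from its successive halves. Nullness is phrased by finite covers with intervals
    because these are the sets whose probability under a uniform variable is at hand. *)
Lemma null_embedding : exists kappa kinv : R -> R, [/\
  measurable_fun setT kappa /\ measurable_fun setT kinv,
  (forall x, kinv (kappa x) = x),
  (forall x, 1 / 2 < kappa x < 1) &
  forall e : R, 0 < e -> exists (I : finType) (a : I -> R) (l : R),
  [/\ 0 < l, #|I|%:R * l <= e, (forall i, 0 <= a i /\ a i + l <= 1) &
     forall x, exists i, a i < kappa x <= a i + l]].
Proof. by exists kappa, kinv. Qed.

End null_embedding.

Section fibre_uniformization.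
Context d (X : measurableType d) (R : realType).
Variable M : probability (X * R)%type R.
Hypothesis graph0 : forall phi : X -> R, measurable_fun setT phi ->
  pr M [set z | z.2 = phi z.1] = 0.

(* Where the conditional cdf fails to be invertible, a null set, the fibre is embedded by
   [kappa] into a null set of values; these values are freed by halving, as in Hilbert's
   hotel: u, u/2, u/4, ... *)
Lemma fibre_uniformization : exists H H' : X * R -> R, [/\
  measurable_fun setT H /\ measurable_fun setT H',
  (forall x r, 0 < H (x, r) < 1),
  (forall x r, H' (x, H (x, r)) = r),
  (forall x v, 0 < v < 1 -> H (x, H' (x, v)) = v) &
  (forall A (v : R), measurable A -> 0 <= v <= 1 ->
    pr M [set z | A z.1 /\ H z <= v] = v * pr M [set z | A z.1])].
Proof.
have [G [Qt [mG mQt GQt GU bad0]]] := cond_cdf graph0.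
have [kappa [kinv [[mkappa mkinv] kinvK kappa_itv kappa_null]]] := null_embedding R.
pose bad (z : X * R) := ~ (0 < G z < 1 /\ z.2 = Qt (z.1, G z)).
(* On each fibre [K0] is the image under [kappa] of the bad points, and [W] is the union of [K0] and
   its halves, quarters and so on, inside (0,1). *)
pose K0 (z : X * R) := kappa (kinv z.2) = z.2 /\ bad (z.1, kinv z.2).
pose W (z : X * R) := exists n : nat, K0 (z.1, 2 ^+ n * z.2).
have m12 (f : X * R -> R) (g : X * R -> R) : measurable_fun setT f -> measurable_fun setT g ->
    measurable_fun setT (fun z => f (z.1, g z)).
  by move=> mf mg; apply: (measurableT_comp mf); exact: measurable_fun_pair.
have mbad : measurable [set z | bad z].
  apply: measurable_not; apply: measurable_and.
    rewrite (_ : mkset _ = [set z | 0 < G z /\ G z < 1]).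
      by apply: measurable_and; apply: measurable_ltr => //; exact: measurable_cst.
    by apply/seteqP; split => z /= /andP.
  by apply: measurable_eqr => //; exact: m12.
have mK0 : measurable [set z | K0 z].
  apply: measurable_and.
    apply: measurable_eqr => //; apply: (measurableT_comp mkappa).
    exact: (measurableT_comp mkinv).
  apply: (@measurable_preim _ _ _ _ (fun z : X * R => (z.1, kinv z.2)) [set z | bad z]) => //.
  by apply: measurable_fun_pair => //; exact: (measurableT_comp mkinv).
have mW : measurable [set z | W z].
  apply: measurable_exists => n.
  apply: (@measurable_preim _ _ _ _ (fun z : X * R => (z.1, 2 ^+ n * z.2)) [set z | K0 z]) => //.
  by apply: measurable_fun_pair => //; exact: measurable_funM.
have K0_itv x u : K0 (x, u) -> 1 / 2 < u < 1 by move=> [/= <- _].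
have K0W x u : K0 (x, u) -> W (x, u) by exists 0%N; rewrite expr0 mul1r.
have W_itv x u : W (x, u) -> 0 < u < 1.
  move=> [n /= /K0_itv]; have : 1 <= (2 : R) ^+ n by rewrite exprn_ege1//; lra.
  by move=> ? /andP[? ?]; apply/andP; split; nra.
have WS x u : W (x, 2 * u) -> W (x, u).
  by move=> [n /= h]; exists n.+1; rewrite /= exprSr -mulrA.
have WP x u : W (x, u) -> K0 (x, u) \/ W (x, 2 * u).
  move=> [[|n]] /=; first by rewrite expr0 mul1r; left.
  by rewrite exprSr -mulrA => h; right; exists n.
have K0k x r : bad (x, r) -> K0 (x, kappa r) by rewrite /K0/= kinvK.
(* Halving maps [W] onto [W] minus [K0], as [K0] lies above 1/2; the values in [K0] become free for
   the bad points. *)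
pose H z := if `[< bad z >] then kappa z.2 else if `[< W (z.1, G z) >] then G z / 2 else G z.
pose H' z := if `[< K0 z >] then kinv z.2 else
  if `[< W (z.1, 2 * z.2) >] then Qt (z.1, 2 * z.2) else Qt z.
have mWG : measurable [set z | W (z.1, G z)].
  apply: (@measurable_preim _ _ _ _ (fun z : X * R => (z.1, G z)) [set z | W z]) => //.
  exact: measurable_fun_pair.
have mH : measurable_fun setT H.
  apply: measurable_fun_ifP => //; first exact: (measurableT_comp mkappa).
  apply: measurable_fun_ifP => //; apply: measurable_funM => //; exact: measurable_cst.
have m2 : measurable_fun setT (fun z : X * R => 2 * z.2).
  by apply: measurable_funM => //; exact: measurable_cst.
have mH' : measurable_fun setT H'.
  apply: measurable_fun_ifP => //; first exact: (measurableT_comp mkinv).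
  apply: measurable_fun_ifP => //; last exact: m12.
  apply: (@measurable_preim _ _ _ _ (fun z : X * R => (z.1, 2 * z.2)) [set z | W z]) => //.
  exact: measurable_fun_pair.
have good_itv z : ~ bad z -> 0 < G z < 1 by move=> /contrapT[].
have good_Qt z : ~ bad z -> Qt (z.1, G z) = z.2 by move=> /contrapT[_ <-].
exists H, H'; split => //.
- move=> x r; rewrite /H; case: asboolP => [_|/good_itv /andP[? ?]] /=.
    by have /andP[? ->] := kappa_itv r; rewrite andbT; lra.
  by case: ifP => _; apply/andP; split; lra.
- move=> x r; rewrite /H; case: asboolP => [bz|gz].
    by rewrite /H' asboolT /= ?kinvK//; exact: K0k.
  have /= xr := good_Qt _ gz; have /andP[G0 G1] := good_itv _ gz.
  case: asboolP => /= [WG|nWG]; rewrite /H' asboolF/=.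
  + by rewrite mulrC divfK ?pnatr_eq0// asboolT.
  + by move=> /K0_itv /andP[]; lra.
  + by rewrite asboolF//; apply: contra_not nWG; exact: WS.
  + by apply: contra_not nWG; exact: K0W.
- move=> x v v01; rewrite /H'; case: asboolP => [K0v|nK0] /=.
    by case: (K0v) => /= kk bz; rewrite /H asboolT.
  case: asboolP => [W2|nW2].
    have v2 := W_itv _ _ W2; have G2 := GQt x _ v2.
    rewrite /H asboolF; last by move=> bz; case: bz => /=; rewrite G2.
    rewrite /=.
    by rewrite G2 asboolT// mulrC mulKf// pnatr_eq0.
  have G2 := GQt x _ v01.
  rewrite /H asboolF; last by move=> bz; case: bz => /=; rewrite G2.
  rewrite /=.
  by rewrite G2 asboolF// => /WP[].
(* [H] differs from [G] only where z is bad or [G z] is in [W]. In the latter case some 2^n * G z is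
   in the range of [kappa], so [G z] is in finitely many intervals of arbitrarily small total
   length. *)
have W0 : pr M [set z | W (z.1, G z)] = 0.
  pose N n := [set z : X * R | exists r, kappa r = 2 ^+ n * G z].
  pose N' n := [set z : X * R | kappa (kinv (2 ^+ n * G z)) = 2 ^+ n * G z].
  have m2G n : measurable_fun setT (fun z => 2 ^+ n * G z) by exact: measurable_funM.
  have mN' n : measurable (N' n).
    apply: measurable_eqr => //; apply: (measurableT_comp mkappa).
    exact: (measurableT_comp mkinv).
  apply: (@pr0_sub _ _ _ _ _ [set z | exists n, N' n z]) => //.
  - exact: measurable_exists.
  - by move=> z [n [/= h _]]; exists n.
  apply: pr_bigcup0 => // n; apply/eqP; rewrite eq_le pr_ge0 andbT.
  apply/ler_addgt0Pr => e e0; rewrite add0r.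
  have [I [a [l [l0 Il a01 acov]]]] := kappa_null e e0.
  have p0 : 0 < (2 : R) ^+ n by rewrite exprn_gt0.
  have p1 : 1 <= (2 : R) ^+ n by rewrite exprn_ege1//; lra.
  pose F i := [set z | setT z.1 /\ a i / 2 ^+ n < G z <= (a i + l) / 2 ^+ n].
  have mF i : measurable (F i).
    apply: measurable_and; first exact: (measurable_preim measurable_fst measurableT).
    rewrite (_ : mkset _ = [set z | a i / 2 ^+ n < G z /\ G z <= (a i + l) / 2 ^+ n]).
      by apply: measurable_and; [apply: measurable_ltr|apply: measurable_ler] => //;
        exact: measurable_cst.
    by apply/seteqP; split => z /= /andP.
  apply: (@le_trans _ _ (\sum_i pr M (F i))).
    apply: (@le_trans _ _ (pr M [set z | exists i, F i z])).
      apply: le_pr => //; first exact: measurable_exists.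
      move=> z /= hz; have [i] := acov (kinv (2 ^+ n * G z)).
      rewrite hz => /andP[i1 i2]; exists i; split => //.
      by rewrite ltr_pdivrMr// mulrC i1 ler_pdivlMr// mulrC.
    exact: pr_le_sum.
  apply: (@le_trans _ _ (\sum_(i : I) l)); last by rewrite sumr_const -mulr_natl.
  apply: ler_sum => i _; have [ai0 ai1] := a01 i.
  rewrite (uniform_in_itv _ _ GU)//.
  - rewrite (_ : mkset _ = setT) ?prT ?mulr1; last by apply/seteqP; split.
    by rewrite -mulrBl addrAC subrr add0r ler_pdivrMr// ler_peMr// ltW.
  - by rewrite divr_ge0// ltW.
  - by rewrite ler_pM2r ?invr_gt0//; lra.
  - by rewrite ler_pdivrMr// mul1r; lra.
move=> A v mA v01; rewrite -GU//.
have mAf : measurable [set z : X * R | A z.1] by exact: measurable_preim.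
apply: (@pr_eq_null _ _ _ _ _ _ ([set z | bad z] `|` [set z | W (z.1, G z)])).
- by apply: measurable_and => //; apply: measurable_ler => //; exact: measurable_cst.
- by apply: measurable_and => //; apply: measurable_ler => //; exact: measurable_cst.
- exact: measurableU.
- apply/eqP; rewrite eq_le pr_ge0 andbT.
  by apply: le_trans (pr_leU M mbad mWG) _; rewrite W0 bad0 addr0.
- by move=> z /= /not_orP[gz nWz]; rewrite /H asboolF// asboolF.
Qed.

End fibre_uniformization.

(** * Row vectors and adapted maps *)

Section borel_row_vectors.
Context (R : realType) (N : nat).
Local Notation E := (RN R N).
Local Notation coord := Defs.coord.

Lemma measurable_coord (i : 'I_N) : measurable_fun setT (fun x : E => coord x i).
Proof.
apply: measurable_funR => a; apply: sub_sigma_algebra => /=.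
rewrite (_ : mkset _ = (fun M : 'rV[R]_N => M ord0 i) @^-1` [set t | a < t])//.
by apply: open_comp; [move=> x _; exact: coord_continuous|exact: open_gt].
Qed.

Context d (T : measurableType d).

(** An open set is the union of the countably many rational cubes it contains, and lying in a cube
    is a condition on coordinates. Pairs are treated because [E * E] carries the product
    sigma-algebra, while continuity refers to open sets of the product space. *)
Lemma measurable_open_pair (f g : T -> E) (U : set ('rV[R]_N * 'rV[R]_N)) :
  (forall i, measurable_fun setT (fun t => coord (f t) i)) ->
  (forall i, measurable_fun setT (fun t => coord (g t) i)) ->
  open U -> measurable [set t | U (f t, g t)].
Proof.
move=> mf mg oU.
pose close (x : 'rV[R]_N) (q : 'rV[rat]_N) (n : nat) :=
  forall i, `|x ord0 i - ratr (q ord0 i)| < n.+1%:R^-1.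
have mclose (h : T -> E) q n : (forall i, measurable_fun setT (fun t => coord (h t) i)) ->
    measurable [set t | close (h t) q n].
  move=> mh; apply: measurable_forall => i; apply: measurable_ltr; last exact: measurable_cst.
  apply: (measurableT_comp (@normr_measurable R setT)).
  by apply: measurable_funB; [exact: mh|exact: measurable_cst].
rewrite (_ : mkset _ = [set t | exists b : ('rV[rat]_N * 'rV[rat]_N) * nat,
    (forall x y, close x b.1.1 b.2 -> close y b.1.2 b.2 -> U (x, y)) /\
    (close (f t) b.1.1 b.2 /\ close (g t) b.1.2 b.2)]).
  apply: measurable_exists => b; apply: measurable_and; first exact: measurable_const.
  by apply: measurable_and; exact: mclose.
apply/seteqP; split => t /=; last by move=> [b [bU [fb gb]]]; exact: bU.
move=> Ut; have /nbhs_ballP[e /= e0 eU] : nbhs (f t : 'rV[R]_N, g t : 'rV[R]_N) U.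
  by move: oU; rewrite openE; exact.
pose n := Num.truncn (2 / e).
have ne : n.+1%:R^-1 + n.+1%:R^-1 < e.
  have := truncnS_gt (2 / e); rewrite -/n => h.
  have n0 : (0 : R) < n.+1%:R by [].
  rewrite (_ : _ + _ = 2 / n.+1%:R); last by rewrite mulr_natl mulr2n.
  by rewrite ltr_pdivrMr// mulrC -ltr_pdivrMr.
have /choice[qq Hqq] (x : R) : exists q : rat, `|x - ratr q| < n.+1%:R^-1.
  have : x < x + n.+1%:R^-1 by rewrite ltrDl invr_gt0.
  move=> /rat_in_itvoo[q]; rewrite in_itv/= => /andP[xq qx]; exists q.
  by rewrite distrC gtr0_norm ?subr_gt0// ltrBlDl.
exists ((\row_i qq ((f t : 'rV[R]_N) ord0 i), \row_i qq ((g t : 'rV[R]_N) ord0 i)), n) => /=.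
have closeq (x : 'rV[R]_N) : close x (\row_i qq (x ord0 i)) n by move=> i; rewrite mxE; exact: Hqq.
split; last by split; exact: closeq.
have close_ball (x y : 'rV[R]_N) q : close x q n -> close y q n -> ball x e y.
  move=> cx cy; split => // i j; rewrite (ord1 i) /ball/= /ball_/=.
  have := cx j; have := cy j; rewrite distrC => h1 h2.
  apply: le_lt_trans ne; rewrite -(subrK (ratr (q ord0 j)) (x ord0 j)) -addrA.
  by apply: le_trans (ler_normD _ _) _; rewrite lerD// ltW.
by move=> x y cx cy; apply: eU; split => /=; [exact: (close_ball _ _ _ (closeq _) cx)
  |exact: (close_ball _ _ _ (closeq _) cy)].
Qed.

Lemma measurable_RN (f : T -> E) :
  (forall i, measurable_fun setT (fun t => coord (f t) i)) -> measurable_fun setT f.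
Proof.
move=> mf; apply: (@measurability _ _ T E setT f (open : set (set 'rV[R]_N)) erefl) => //.
move=> _ [U oU <-]; rewrite setTI.
apply: (@measurable_open_pair f f ((@fst _ _) @^-1` U)) => //.
by apply: open_comp => // z _; exact: cvg_fst.
Qed.

End borel_row_vectors.

Section borel_row_vectors_pairs.
Context (R : realType) (N : nat).
Local Notation E := (RN R N).
Local Notation coord := Defs.coord.

Lemma measurable_continuous_pair (c : E * E -> R) :
  continuous (c : 'rV[R]_N * 'rV[R]_N -> R) -> measurable_fun setT c.
Proof.
move=> cc; apply: measurable_funR => a.
pose U : set ('rV[R]_N * 'rV[R]_N) := [set z | a < c z].
have oU : open U.
  rewrite (_ : U = (c : 'rV[R]_N * 'rV[R]_N -> R) @^-1` [set t | a < t])//.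
  by apply: open_comp; [move=> x _; exact: cc|exact: open_gt].
rewrite (_ : mkset _ = [set z | U (z.1, z.2)]).
  apply: (@measurable_open_pair R N _ (E * E)%type fst snd U) => [i|i|//].
  - by apply: (measurableT_comp (measurable_coord i)); exact: measurable_fst.
  - by apply: (measurableT_comp (measurable_coord i)); exact: measurable_snd.
by apply/seteqP; split => -[].
Qed.

End borel_row_vectors_pairs.

Section orthants.
Context (R : realType) (N : nat).
Local Notation E := (RN R N).
Local Notation coord := Defs.coord.

Definition orthant (a : 'I_N -> R) : set E := [set x | forall i, coord x i <= a i].

Lemma measurable_orthant a : measurable (orthant a).
Proof.
apply: measurable_forall => i; apply: measurable_ler; last exact: measurable_cst.
exact: measurable_coord.
Qed.

Lemma coord_le_nat (x : E) : exists n : nat, forall j, coord x j <= n%:R.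
Proof.
exists (\max_(j < N) Num.truncn (Num.max 0 (coord x j))%R)%N.+1 => j.
apply: (@le_trans _ _ (Num.max 0 (coord x j))); first by rewrite le_max lexx orbT.
apply: le_trans (ltW (truncnS_gt _)) _; rewrite ler_nat ltnS.
exact: (@leq_bigmax _ (fun j : 'I_N => Num.truncn (Num.max 0 (coord x j)))).
Qed.

(** A half-space x_i <= b is the countable union of the orthants with bound b at i and n elsewhere.
    Orthants, unlike half-spaces, are stable under intersection, as uniqueness of measures
    requires. *)
Lemma measurable_orthantE :
  @measurable _ E = <<s [set A | exists a, A = orthant a] >>.
Proof.
apply/seteqP; split; last first.
  apply: smallest_sub; first exact: sigma_algebra_measurable.
  by move=> _ [a ->]; exact: measurable_orthant.
pose G := [set A | exists a, A = orthant a].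
have mid : measurable_fun setT (fun x : g_sigma_algebraType G => (x : E)).
  apply: measurable_RN => i; apply: measurable_funRle => b.
  rewrite (_ : mkset _ = [set x | exists n : nat,
      orthant (fun j => if j == i then b else n%:R) x]).
    apply: measurable_exists => n; apply: sub_sigma_algebra => /=.
    by exists (fun j => if j == i then b else n%:R).
  apply/seteqP; split => x /=; last by move=> [n /(_ i)]; rewrite eqxx.
  by move=> xb; have [n xn] := coord_le_nat x; exists n => j; case: eqP => [->//|_].
by move=> A mA; have := mid measurableT A mA; rewrite setTI.
Qed.

Lemma pr_orthant_ext d1 d2 (T1 : measurableType d1) (T2 : measurableType d2)
    (P1 : probability T1 R) (P2 : probability T2 R) (f1 : T1 -> E) (f2 : T2 -> E) :
  measurable_fun setT f1 -> measurable_fun setT f2 ->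
  (forall a, pr P1 [set t | orthant a (f1 t)] = pr P2 [set t | orthant a (f2 t)]) ->
  forall B, measurable B -> pr P1 [set t | B (f1 t)] = pr P2 [set t | B (f2 t)].
Proof.
move=> mf1 mf2 H B mB.
have rimT d (T : measurableType d) (P : probability T R) (f : T -> E)
    (mf : measurable_fun setT f) C : measurable C ->
    rimage P mf measurableT C = (pr P [set t | C (f t)])%:E.
  move=> mC; rewrite pr_rimage//; congr (pr P _)%:E.
  by apply/seteqP; split => t //= [].
apply: EFin_inj; rewrite -(rimT _ _ _ _ mf1)// -(rimT _ _ _ _ mf2)//.
apply: (@measure_unique _ _ E _ (fun n : nat => orthant (fun=> n%:R)) measurable_orthantE) => //.
- move=> _ _ [a ->] [b ->]; exists (fun i => Num.min (a i) (b i)).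
  apply/seteqP; split => x /=.
    by move=> [xa xb] i; rewrite le_min xa xb.
  by move=> h; split => i; have := h i; rewrite le_min => /andP[].
- by move=> n; exists (fun=> n%:R).
- by apply/seteqP; split => // x _; have [n xn] := coord_le_nat x; exists n.
- move=> _ [a ->]; rewrite [LHS](rimT _ _ _ _ mf1); last exact: measurable_orthant.
  by rewrite H [RHS](rimT _ _ _ _ mf2)//; exact: measurable_orthant.
- move=> n; rewrite [X in (X < _)%E](rimT _ _ _ _ mf1) ?ltry//.
  exact: measurable_orthant.
Qed.

End orthants.

Section truncation.
Context (R : realType) (N : nat).
Local Notation E := (RN R N).
Local Notation coord := Defs.coord.

(** The past x_{<t}, padded with zeros to full length so that the pasts at all times share one
    type. *)
Definition trunc (t : nat) (x : E) : E :=
  \row_(i < N) (if (i < t)%N then coord x i else 0).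

Lemma coord_trunc t x i : coord (trunc t x) i = if (i < t)%N then coord x i else 0.
Proof. by rewrite /coord mxE. Qed.

Lemma coordP (x y : E) : (forall i, coord x i = coord y i) -> x = y.
Proof. by move=> xy; apply/rowP => i; exact: xy. Qed.

Lemma trunc_eqP t x y : trunc t x = trunc t y <->
  forall i : 'I_N, (i < t)%N -> coord x i = coord y i.
Proof.
split=> [h i it|h].
  by have := congr1 (fun z => coord z i) h; rewrite /= !coord_trunc it.
by apply: coordP => i; rewrite !coord_trunc; case: ifP => // /h.
Qed.

Lemma trunc_trunc s t x : (s <= t)%N -> trunc s (trunc t x) = trunc s x.
Proof.
by move=> st; apply/trunc_eqP => i si; rewrite coord_trunc (leq_trans si st).
Qed.

Lemma trunc_size x : trunc N x = x.
Proof. by apply: coordP => i; rewrite coord_trunc ltn_ord. Qed.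

Lemma measurable_trunc t : measurable_fun setT (trunc t).
Proof.
apply: measurable_RN => i.
rewrite (_ : (fun _ => _) = fun x => if (i < t)%N then coord x i else 0).
  by case: (i < t)%N; [exact: measurable_coord|exact: measurable_cst].
by apply/funext => x; rewrite coord_trunc.
Qed.

Lemma adaptedP (T : E -> E) : adapted T <->
  forall t x y, trunc t x = trunc t y -> trunc t (T x) = trunc t (T y).
Proof.
split=> [aT t x y /trunc_eqP xy|aT i x y xy].
  apply/trunc_eqP => i it; apply: aT => j ji; apply: xy.
  exact: leq_ltn_trans it.
have h : trunc i.+1 x = trunc i.+1 y.
  by apply/trunc_eqP => j; rewrite ltnS; exact: xy.
exact: ((trunc_eqP _ _ _).1 (aT _ _ _ h)).
Qed.

End truncation.

Section filtration.
Context (R : realType) (N : nat).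
Local Notation E := (RN R N).
Local Notation coord := Defs.coord.

Lemma measurable_first_coords (t : 'I_N) : measurable_fun setT (@first_coords R N t).
Proof.
apply: measurable_RN => i.
rewrite (_ : (fun _ => _) = fun x => coord x (widen_ord (ltnW (ltn_ord t)) i)).
  exact: measurable_coord.
by apply/funext => x; rewrite /first_coords /coord mxE.
Qed.

Let pad (t : 'I_N) (y : RN R t) : E :=
  \row_(i < N) (if insub (i : nat) is Some j then coord y j else 0).

Let measurable_pad t : measurable_fun setT (@pad t).
Proof.
apply: measurable_RN => i.
rewrite (_ : (fun _ => _) = fun y => if insub (i : nat) is Some j then coord y j else 0).
  by case: insub => [j|]; [exact: measurable_coord|exact: measurable_cst].
by apply/funext => y; rewrite /pad /coord mxE.
Qed.

Let pad_first t x : pad (first_coords t x) = trunc t x.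
Proof.
apply: coordP => i; rewrite coord_trunc {1}/coord mxE; case: insubP => [j it ji|].
  rewrite it /first_coords /coord mxE; congr (x _ _).
  by apply: ord_inj => /=.
by rewrite -leqNgt ltnNge => ->.
Qed.

Lemma first_coords_trunc (t : 'I_N) (x : E) : first_coords t (trunc t x) = first_coords t x.
Proof. by apply/rowP => i; rewrite !mxE coord_trunc /= ltn_ord. Qed.

(** Replaces the spaces of t coordinates by [E]: padding a shorter vector with zeros after
    [first_coords] is exactly [trunc]. *)
Lemma FsigP (t : 'I_N) (B : set E) : Fsig t B <->
  measurable B /\ forall x, B x <-> B (trunc t x).
Proof.
split=> [[C [mC ->]]|[mB hB]].
  split; first exact: (measurable_preim (@measurable_first_coords t) mC).
  by move=> x /=; rewrite first_coords_trunc.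
exists [set y | B (pad y)]; split; first exact: (measurable_preim (@measurable_pad t) mB).
by apply/seteqP; split => x /=; rewrite pad_first; have [] := hB x.
Qed.

End filtration.

Section adapted_recursion.
Context (R : realType) (N : nat).
Local Notation E := (RN R N).
Local Notation coord := Defs.coord.
Implicit Types phi psi : 'I_N -> (E * E) * R -> R.

Let stage phi (x : E) : nat -> E := fix rec t := if t is s.+1 then
  \row_(i < N) (if i == s :> nat then phi i (trunc s x, rec s, coord x i) else coord (rec s) i)
  else 0.

(* The map defined by [T(x)_i = phi_i (x_{<i}, T(x)_{<i}, x_i)]. *)
Definition build phi (x : E) : E := stage phi x N.

Let coord_stageS phi x s (i : 'I_N) : coord (stage phi x s.+1) i =
  if i == s :> nat then phi i (trunc s x, stage phi x s, coord x i) else coord (stage phi x s) i.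
Proof. by rewrite {1}/coord/= mxE. Qed.

Let stage0 phi x s (i : 'I_N) : (s <= i)%N -> coord (stage phi x s) i = 0.
Proof.
elim: s => [_|s IH si]; first by rewrite /coord mxE.
by rewrite coord_stageS gtn_eqF// IH// ltnW.
Qed.

Let stage_stable phi x s t (i : 'I_N) : (i < s)%N -> (s <= t)%N ->
  coord (stage phi x t) i = coord (stage phi x s) i.
Proof.
move=> si; elim: t => [|t IH]; first by rewrite leqn0 => /eqP s0; move: si; rewrite s0.
rewrite leq_eqVlt => /predU1P[->//|]; rewrite ltnS => st.
by rewrite coord_stageS ltn_eqF ?IH// (leq_trans si).
Qed.

Let trunc_build phi x t : (t <= N)%N -> trunc t (build phi x) = stage phi x t.
Proof.
move=> tN; apply: coordP => i; rewrite coord_trunc; case: ltnP => it.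
  exact: stage_stable.
by rewrite stage0.
Qed.

Lemma coord_build phi x i : coord (build phi x) i =
  phi i (trunc i x, trunc i (build phi x), coord x i).
Proof.
rewrite trunc_build; last exact: ltnW.
by rewrite /build (@stage_stable _ _ i.+1)// coord_stageS eqxx.
Qed.

Lemma adapted_build phi : adapted (build phi).
Proof.
apply/adaptedP; elim=> [x y _|t IH x y xy].
  by apply/trunc_eqP => i.
apply/trunc_eqP => i; rewrite ltnS => it; rewrite !coord_build.
have xyi : trunc i x = trunc i y.
  by rewrite -(trunc_trunc _ (leqW it)) xy trunc_trunc// leqW.
have -> : trunc i (build phi x) = trunc i (build phi y).
  rewrite -(trunc_trunc _ it) -[RHS](trunc_trunc _ it) (IH x y)//.
  by rewrite -(trunc_trunc _ (leqnSn t)) xy trunc_trunc.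
by move/trunc_eqP : xy => -> //; rewrite xyi.
Qed.

Lemma measurable_build phi : (forall i, measurable_fun setT (phi i)) ->
  measurable_fun setT (build phi).
Proof.
move=> mphi; suff h t : measurable_fun setT (fun x => stage phi x t) by exact: h.
elim: t => [|s IH]; first exact: measurable_cst.
apply: measurable_RN => i.
rewrite (_ : (fun _ => _) = fun x => if i == s :> nat then
  phi i (trunc s x, stage phi x s, coord x i) else coord (stage phi x s) i); last first.
  by apply/funext => x; rewrite coord_stageS.
case: eqP => _; last exact: (measurableT_comp (measurable_coord i)).
apply: (measurableT_comp (mphi i)); apply: measurable_fun_pair; last exact: measurable_coord.
by apply: measurable_fun_pair => //; exact: measurable_trunc.
Qed.

(** Both pasts are arguments of [phi] and [psi], so once the past has been recovered it suffices to
    invert a function of one real variable. The pasts trade places between [phi] and [psi]. *)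
Lemma build_cancel phi psi (x : E) :
  (forall i, psi i (trunc i (build phi x), trunc i x,
     phi i (trunc i x, trunc i (build phi x), coord x i)) = coord x i) ->
  build psi (build phi x) = x.
Proof.
move=> phiK; apply: coordP.
suff h t : (t <= N)%N -> trunc t (build psi (build phi x)) = trunc t x.
  by have := h N (leqnn N); rewrite !trunc_size => ->.
elim: t => [_|t IH tN]; first by apply/trunc_eqP => i.
apply/trunc_eqP => i; rewrite ltnS leq_eqVlt => /predU1P[it|it]; last first.
  by move/trunc_eqP : (IH (ltnW tN)) => ->.
by rewrite coord_build it (IH (ltnW tN)) -it coord_build phiK.
Qed.

End adapted_recursion.

(** * Lebesgue-null graphs *)

Section box_outer_measure.
Context (R : realType) (N : nat) (t : 'I_N).
Local Notation E := (RN R N).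
Local Notation coord := Defs.coord.
Local Notation V := 'rV[R]_N.

Let vol (c : V * V) : R := \prod_(i < N) (c.2 ord0 i - c.1 ord0 i).

Let valid (c : V * V) := forall i, c.1 ord0 i <= c.2 ord0 i.

Let vol_ge0 c : valid c -> 0 <= vol c.
Proof. by move=> vc; apply: prodr_ge0 => i _; rewrite subr_ge0. Qed.

(** The outer measure generated by this gauge is Lebesgue outer measure, built from the same boxes
    that define [lebesgue_null]; unbounded sets get +oo. *)
Definition box_gauge (B : set E) : \bar R :=
  ereal_inf [set (vol c)%:E | c in [set c | valid c /\ B `<=` box c.1 c.2]].

Let gauge_ge0 B : (0 <= box_gauge B)%E.
Proof. by apply: le_ereal_inf_tmp => _ [c [vc _] <-]; rewrite lee_fin vol_ge0. Qed.

Let gauge_le B c : valid c -> B `<=` box c.1 c.2 -> (box_gauge B <= (vol c)%:E)%E.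
Proof. by move=> vc Bc; apply: ereal_inf_lbound; exists c. Qed.

(** The coordinate [t] provides a degenerate box of volume 0; in dimension 0 the empty product would
    be 1. *)
Let gauge0 : box_gauge set0 = 0%E.
Proof.
apply/eqP; rewrite eq_le gauge_ge0 andbT.
have v0 : valid (0, 0) by move=> i.
have := @gauge_le set0 (0, 0) v0 (@sub0set _ _).
by rewrite /vol (bigD1 t)//= subrr mul0r.
Qed.

Definition box_outer : set E -> \bar R := mu_ext box_gauge.

HB.instance Definition _ := isOuterMeasure.Build R E box_outer
  (mu_ext0 gauge0 gauge_ge0) (mu_ext_ge0 gauge_ge0)
  (le_mu_ext box_gauge) (mu_ext_sigma_subadditive gauge_ge0).

Lemma box_outer_null (A : set E) : box_outer A = 0%E -> lebesgue_null A.
Proof.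
move=> A0 e e0.
have e2 : 0 < e / 2 by lra.
have : (box_outer A < (e / 2)%:E)%E by rewrite A0 lte_fin.
move=> /ereal_inf_lt[_ [B [mB AB] <-] Be].
have Bfin k : (box_gauge (B k) < +oo)%E.
  apply: le_lt_trans (lt_trans Be (ltry _)).
  rewrite [leRHS](@nneseriesD1 _ _ k)//.
  by rewrite leeDl// nneseries_ge0.
have /choice[c Hc] k : exists c, [/\ valid c, B k `<=` box c.1 c.2 &
    ((vol c)%:E <= box_gauge (B k) + (e / 4 / (2 ^ k.+1)%:R)%:E)%E].
  have ek : 0 < e / 4 / (2 ^ k.+1)%:R by rewrite !divr_gt0// ltr0n expn_gt0.
  have gf : box_gauge (B k) \is a fin_num by rewrite ge0_fin_numE.
  have [_ [c [vc Bc] <-] h] := lb_ereal_inf_adherent ek gf.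
  by exists c; split => //; exact: ltW.
exists (fun k => (c k).1), (fun k => (c k).2); split; [|split].
- by move=> k; have [] := Hc k.
- move=> x /AB[k _ Bx]; exists k => //; have [_ + _] := Hc k; exact.
- apply: (@le_lt_trans _ _ (\sum_(0 <= k <oo) (box_gauge (B k) + (e / 4 / (2 ^ k.+1)%:R)%:E))%E).
    apply: lee_nneseries => [k _ _|k _]; first by rewrite lee_fin; apply: vol_ge0; have [] := Hc k.
    by have [] := Hc k.
  apply: le_lt_trans (epsilon_trick _ _ _) _; [by move=> *; exact: gauge_ge0|lra|].
  apply: (@lt_trans _ _ ((e / 2)%:E + (e / 4)%:E)%E); first by rewrite lte_leD.
  by rewrite -EFinD lte_fin; lra.
Qed.

Lemma box_outer_box c : valid c -> (box_outer (box c.1 c.2) <= (vol c)%:E)%E.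
Proof.
move=> vc; apply: le_trans (gauge_le vc (@subset_refl _ _)).
have mbox : measurable (box c.1 c.2).
  apply: measurable_forall => i.
  rewrite (_ : mkset _ = [set x | c.1 ord0 i <= coord x i /\ coord x i <= c.2 ord0 i]).
    by apply: measurable_and; apply: measurable_ler; try exact: measurable_cst; exact: measurable_coord.
  by apply/seteqP; split => x /= /andP.
apply: ereal_inf_lbound; exists (fun k => if k is 0%N then box c.1 c.2 else set0).
  split=> [[|k]//|x Bx]; by exists 0%N.
rewrite (@nneseriesD1 _ _ 0%N)//.
rewrite eseries0 ?adde0// => -[//|k] _ _; exact: gauge0.
Qed.

(** A hyperplane orthogonal to an axis cuts a box into two boxes whose volumes add up, so splitting
    the members of a cover costs nothing. *)
Lemma caratheodory_halfspace (i : 'I_N) (a : R) :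
  box_outer.-caratheodory [set x : E | coord x i <= a].
Proof.
apply: le_caratheodory_measurable => X.
set H := [set x : E | _].
have mH : measurable H by apply: measurable_ler; [exact: measurable_coord|exact: measurable_cst].
apply: le_ereal_inf_tmp => _ [B [mB XB] <-].
apply: (@le_trans _ _ (\sum_(0 <= k <oo) (box_gauge (B k `&` H) + box_gauge (B k `&` ~` H)))%E).
  rewrite nneseriesD; [|by move=> *; exact: gauge_ge0|by move=> *; exact: gauge_ge0].
  apply: leeD; apply: ereal_inf_lbound.
    exists (fun k => B k `&` H) => //; split => [k|x [/XB[k _ Bx] Hx]]; first exact: measurableI.
    by exists k.
  exists (fun k => B k `&` ~` H) => //; split => [k|x [/XB[k _ Bx] Hx]].
    by apply: measurableI => //; exact: measurableC.
  by exists k.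
apply: lee_nneseries => [k _ _|k _]; first by rewrite adde_ge0.
apply: le_ereal_inf_tmp => _ [c [vc Bc] <-].
have [ac|ca] := ltP a (c.1 ord0 i).
  rewrite (_ : B k `&` H = set0); last first.
    by apply/seteqP; split => // x [/Bc /(_ i) /andP[+ _] Hx]; rewrite leNgt (le_lt_trans Hx).
  by rewrite gauge0 add0e; apply: gauge_le => //; apply: subset_trans Bc; exact: subIsetl.
have [cb|bc] := leP (c.2 ord0 i) a.
  rewrite (_ : B k `&` ~` H = set0); last first.
    by apply/seteqP; split => // x [/Bc /(_ i) /andP[_ xc] Hx]; apply: Hx; exact: le_trans xc cb.
  by rewrite gauge0 adde0; apply: gauge_le => //; apply: subset_trans Bc; exact: subIsetl.
pose c1 : V * V := (c.1, \row_j (if j == i then a else c.2 ord0 j)).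
pose c2 : V * V := (\row_j (if j == i then a else c.1 ord0 j), c.2).
have v1 : valid c1 by move=> j; rewrite /= mxE; case: eqP => [->|].
have v2 : valid c2 by move=> j; rewrite /= mxE; case: eqP => [->|//]; rewrite ltW.
have -> : vol c = vol c1 + vol c2.
  pose P := \prod_(j < N | j != i) (c.2 ord0 j - c.1 ord0 j).
  have -> : vol c1 = (a - c.1 ord0 i) * P.
    rewrite /vol (bigD1 i)//= mxE eqxx; congr (_ * _).
    by apply: eq_bigr => j /negbTE ji; rewrite mxE ji.
  have -> : vol c2 = (c.2 ord0 i - a) * P.
    rewrite /vol (bigD1 i)//= mxE eqxx; congr (_ * _).
    by apply: eq_bigr => j /negbTE ji; rewrite mxE ji.
  by rewrite /vol (bigD1 i)//= -mulrDl; congr (_ * _); lra.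
rewrite EFinD; apply: leeD; apply: gauge_le => //.
- move=> x [/Bc Bx Hx] j /=; rewrite mxE; have /andP[-> ?] := Bx j.
  by case: eqP => [->|].
- move=> x [/Bc Bx Hx] j /=; rewrite mxE; have /andP[? ->] := Bx j; rewrite andbT.
  by case: eqP => [->|//]; rewrite leNgt; apply/negP => /ltW.
Qed.

(** The identity out of the Caratheodory sigma-algebra is Borel as soon as its coordinates are, so
    the half-spaces suffice. *)
Lemma caratheodory_borel (A : set E) : measurable A -> box_outer.-caratheodory A.
Proof.
move=> mA.
have mid : measurable_fun setT (fun x : caratheodory_type box_outer => (x : E)).
  apply: measurable_RN => i; apply: measurable_funRle => a.
  exact: caratheodory_halfspace.
by have := mid measurableT A mA; rewrite setTI.
Qed.

Let sh (s : R) (x : E) : E := \row_i (if i == t then coord x i + s else coord x i).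

Let coord_sh s x i : coord (sh s x) i = if i == t then coord x i + s else coord x i.
Proof. by rewrite {1}/coord mxE. Qed.

Let measurable_sh s : measurable_fun setT (sh s).
Proof.
apply: measurable_RN => i.
rewrite (_ : (fun _ => _) = fun x => if i == t then coord x i + s else coord x i); last first.
  by apply/funext => x; rewrite coord_sh.
case: eqP => _; last exact: measurable_coord.
by apply: measurable_funD; [exact: measurable_coord|exact: measurable_cst].
Qed.

Let box_outer_sh s (B : set E) : (box_outer [set x | B (sh s x)] <= box_outer B)%E.
Proof.
apply: le_ereal_inf_tmp => _ [C [mC BC] <-].
apply: (@le_trans _ _ (\sum_(0 <= k <oo) box_gauge [set x | C k (sh s x)])%E).
  apply: ereal_inf_lbound; exists (fun k => [set x | C k (sh s x)]) => //; split.
    by move=> k; exact: (measurable_preim (@measurable_sh s) (mC k)).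
  by move=> x /= /BC[k _ Cx]; exists k.
apply: lee_nneseries => [k _ _|k _]; first exact: gauge_ge0.
apply: le_ereal_inf_tmp => _ [c [vc Cc] <-].
pose tr (a : V) : V := \row_i (if i == t then a ord0 i - s else a ord0 i).
have -> : vol c = vol (tr c.1, tr c.2).
  by apply: eq_bigr => i _; rewrite !mxE; case: eqP => // _; lra.
apply: gauge_le => [i|x /= /Cc h i] /=; first by rewrite !mxE; have := vc i; case: eqP => // _; lra.
by have := h i; rewrite coord_sh !mxE; case: eqP => // _; rewrite lerBlDr lerBrDr.
Qed.

(* The translates of the graph in direction [t] are disjoint, have the same outer
   measure and, for small translations, lie in a common box. *)
Lemma graph_lebesgue_null (f : E -> R) : measurable_fun setT f ->
  lebesgue_null [set x | coord x t = f (trunc t x)].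
Proof.
move=> mf; apply: box_outer_null.
pose G (M : nat) := [set x : E | coord x t = f (trunc t x) /\ forall i, `|coord x i| <= M%:R].
have mG M : measurable (G M).
  apply: measurable_and.
    apply: measurable_eqr; first exact: measurable_coord.
    exact: (measurableT_comp mf (@measurable_trunc _ _ _)).
  apply: measurable_forall => i; apply: measurable_ler; last exact: measurable_cst.
  by apply: (measurableT_comp (@normr_measurable R setT)); exact: measurable_coord.
suff G0 M : box_outer (G M) = 0%E.
  apply/eqP; rewrite eq_le outer_measure_ge0 andbT.
  apply: (@le_trans _ _ (box_outer (\bigcup_M G M))).
    apply: le_outer_measure => x /= xf.
    have [n1 h1] := coord_le_nat x; have [n2 h2] := coord_le_nat (- (x : V) : V).
    exists (maxn n1 n2) => //; split => // i; rewrite ler_norml.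
    have := h1 i; have := h2 i; rewrite {1}/coord mxE -/(coord x i) => a2 a1.
    have m1 : (n1%:R <= (maxn n1 n2)%:R :> R) by rewrite ler_nat leq_maxl.
    have m2 : (n2%:R <= (maxn n1 n2)%:R :> R) by rewrite ler_nat leq_maxr.
    by apply/andP; split; lra.
  apply: le_trans (outer_measure_sigma_subadditive _ _) _.
  by rewrite eseries0.
(* Distinct shifts, for disjointness, and at most 1, so that every translate of [G M] stays in the
   cube of half-side M + 1. *)
pose s (k : nat) : R := k.+1%:R^-1.
pose Gs k := [set x | G M (sh (s k) x)].
have G_le k : (box_outer (G M) <= box_outer (Gs k))%E.
  apply: le_trans (box_outer_sh (- s k) (Gs k)); apply: le_outer_measure => x Gx.
  rewrite /Gs /=; suff -> : sh (s k) (sh (- s k) x) = x by [].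
  by apply: coordP => i; rewrite !coord_sh; case: eqP => // _; rewrite subrK.
have trunc_sh r x : trunc t (sh r x) = trunc t x.
  by apply/trunc_eqP => i it; rewrite coord_sh; case: eqP => // itt; rewrite itt ltnn in it.
have dis : trivIset setT Gs.
  move=> i j _ _ [x [[/= hi _] [/= hj _]]]; move: hi hj.
  rewrite !coord_sh eqxx !trunc_sh => <- /addrI /invr_inj /eqP.
  by rewrite eqr_nat eqSS => /eqP.
have cGs k : box_outer.-caratheodory (Gs k).
  by apply: caratheodory_borel; exact: (measurable_preim (@measurable_sh _) (mG M)).
pose c : V * V := (const_mx (- M.+1%:R), const_mx M.+1%:R).
have vc : valid c by move=> i; rewrite !mxE; have : (0 : R) <= M.+1%:R by []; lra.
have bnd n : (n%:R%:E * box_outer (G M) <= (vol c)%:E)%E.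
  apply: le_trans (box_outer_box vc).
  have := caratheodory_additive cGs dis n (box c.1 c.2).
  have GsE k : box c.1 c.2 `&` Gs k = Gs k.
    apply/setIidPr => x [_ hx] i; have := hx i; rewrite coord_sh !mxE ler_norml.
    have s1 : 0 <= s k <= 1 by rewrite /s invr_ge0 ler0n invf_le1// ler1n.
    rewrite -natr1; case: eqP => _; move: s1 => /andP[? ?] /andP[? ?]; apply/andP; split; lra.
  move=> h; apply: le_trans (le_outer_measure _ _ _ (@subIsetl _ _ (\big[setU/set0]_(i < n) Gs i))).
  rewrite h; apply: (@le_trans _ _ (\sum_(i < n) box_outer (G M))%E).
    clear h; elim: n => [|n IH]; first by rewrite big_ord0 mul0e.
    rewrite big_ord_recr/= -natr1 EFinD ge0_muleDl//.
    by rewrite mul1e leeD2r.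
  by apply: lee_sum => i _; rewrite GsE.
apply/eqP; rewrite eq_le outer_measure_ge0 andbT leNgt; apply/negP => Gpos.
have Gfin : box_outer (G M) \is a fin_num.
  by rewrite ge0_fin_numE ?outer_measure_ge0//; apply: le_lt_trans (ltry (vol c)); have := bnd 1%N; rewrite mul1e.
move: Gpos bnd; rewrite -(fineK Gfin) lte_fin => Gpos bnd.
pose n := (Num.truncn (vol c / fine (box_outer (G M)))).+1.
have := bnd n; rewrite -EFinM lee_fin leNgt => /negP; apply.
by rewrite -ltr_pdivrMr//; exact: truncnS_gt.
Qed.

End box_outer_measure.

(** * Interval exchanges *)

Section interval_index.
Context (R : realType).
Implicit Types (D : nat -> R) (m : nat) (u : R).

(* For nondecreasing [D], the [n] such that [D n < u <= D n.+1]. *)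
Definition itv_index D m u : nat := (\sum_(k < m) (D k.+1 < u)%R)%N.

Lemma itv_indexE D m u n : {homo D : i j / (i <= j)%N >-> i <= j} ->
  (n < m)%N -> D n < u <= D n.+1 -> itv_index D m u = n.
Proof.
move=> nD nm /andP[Dn uD]; rewrite /itv_index.
rewrite (eq_bigr (fun k : 'I_m => (k < n)%N : nat)) => [|k _].
  suff h j : (\sum_(k < j) (k < n)%N)%N = minn n j by rewrite h; apply/minn_idPl/ltnW.
  elim: j => [|j IH]; first by rewrite big_ord0 minn0.
  by rewrite big_ord_recr/= IH; case: ltnP; lia.
congr (nat_of_bool _); apply/idP/idP => [Dk|kn].
  rewrite ltnNge; apply/negP => nk; have := lt_le_trans Dk uD.
  by rewrite ltNge nD.
by apply: le_lt_trans Dn; exact: nD.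
Qed.

Lemma itv_index_bounds D m u : {homo D : i j / (i <= j)%N >-> i <= j} ->
  D 0 = 0 -> 0 < u -> u <= D m ->
  (itv_index D m u < m)%N /\ D (itv_index D m u) < u <= D (itv_index D m u).+1.
Proof.
move=> nD D0 u0 um.
suff [n [nm h]] : exists n, (n < m)%N /\ D n < u <= D n.+1 by rewrite (itv_indexE nD nm h).
elim: m um => [|m IH um]; first by rewrite D0 leNgt u0.
have [/IH[n [nm h]]|Dm] := leP u (D m); first by exists n; split => //; exact: ltnW.
by exists m; rewrite ltnSn Dm um.
Qed.

Lemma measurable_itv_index D m n : measurable [set u | itv_index D m u = n].
Proof.
rewrite (_ : mkset _ = [set u | \sum_(k < m) (if `[< D k.+1 < u >] then 1 else 0) = n%:R :> R]).
  apply: measurable_eqr; last exact: measurable_cst.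
  apply: measurable_sum => k; apply: measurable_fun_ifP; try exact: measurable_cst.
  by apply: measurable_ltr; [exact: measurable_cst|].
have e u : \sum_(k < m) (if `[< D k.+1 < u >] then 1 else 0) = (itv_index D m u)%:R :> R.
  rewrite natr_sum; apply: eq_bigr => k _.
  by case: asboolP => [->//|/negP/negbTE ->].
by apply/seteqP; split => u /=; rewrite e; [move=> ->|move=> /eqP; rewrite eqr_nat => /eqP].
Qed.

End interval_index.

Section exchange.
Context (R : realType) (m : nat).
Implicit Types (D : nat -> R) (s : nat -> nat).

Definition exchange D D' s u := let n := itv_index D m u in u - D n + D' (s n).

Definition partition_points D :=
  [/\ {homo D : i j / (i <= j)%N >-> i <= j}, D 0 = 0 & D m = 1].

Variables (D D' : nat -> R) (s : nat -> nat).
Hypotheses (pD : partition_points D) (pD' : partition_points D').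
Hypothesis s_lt : forall n, (n < m)%N -> (s n < m)%N.
Hypothesis sD : forall n, (n < m)%N -> D' (s n).+1 - D' (s n) = D n.+1 - D n.

Lemma exchange_index u : 0 < u <= 1 ->
  itv_index D' m (exchange D D' s u) = s (itv_index D m u).
Proof.
move: pD => [nD D0 D1] /andP[u0 u1]; rewrite -D1 in u1.
have [nm /andP[h1 h2]] := itv_index_bounds nD D0 u0 u1.
apply: itv_indexE; [by case: pD'|exact: s_lt|].
by rewrite /exchange; have := sD nm; move=> h; apply/andP; split; lra.
Qed.

Lemma exchange_itv u : 0 < u <= 1 -> 0 < exchange D D' s u <= 1.
Proof.
move: pD pD' => [nD D0 D1] [nD' D'0 D'1] /andP[u0 u1]; rewrite -D1 in u1.
have [nm /andP[h1 h2]] := itv_index_bounds nD D0 u0 u1.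
have := nD' 0%N (s (itv_index D m u)) (leq0n _); have := nD' _ _ (s_lt nm).
by rewrite D'0 D'1 /exchange => ? ?; have := sD nm; move=> h; apply/andP; split; lra.
Qed.

Lemma measurable_exchange : measurable_fun setT (exchange D D' s).
Proof.
apply: measurable_funI => A mA.
rewrite (_ : mkset _ = [set u | exists n, itv_index D m u = n /\ A (u - D n + D' (s n))]).
  apply: measurable_exists => n; apply: measurable_and; first exact: measurable_itv_index.
  have mf : measurable_fun setT (fun u : R => u - D n + D' (s n)).
    by apply: measurable_funD; [apply: measurable_funB|]; try exact: measurable_cst.
  exact: (measurable_preim mf mA).
by apply/seteqP; split => u /=; [eexists|move=> [n [<-]]].
Qed.

End exchange.

Lemma exchangeK (R : realType) m (D D' : nat -> R) s s' u :
  partition_points m D -> partition_points m D' ->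
  (forall n, (n < m)%N -> (s n < m)%N) ->
  (forall n, (n < m)%N -> D' (s n).+1 - D' (s n) = D n.+1 - D n) ->
  (forall n, (n < m)%N -> s' (s n) = n) ->
  0 < u <= 1 -> exchange m D' D s' (exchange m D D' s u) = u.
Proof.
move=> pD pD' s_lt sD sK u01; rewrite {1}/exchange exchange_index//.
case: pD => nD D0 D1; have /andP[u0 u1] := u01; rewrite -D1 in u1.
have [nm _] := itv_index_bounds nD D0 u0 u1.
by rewrite sK// /exchange; lra.
Qed.

Section puncture.
Context (R : realType).
Implicit Types f g : R -> R.

(* First return to (0,1) of a bijection of (0,1]. *)
Definition puncture f u := if `[< f u = 1 >] then f 1 else f u.

Lemma puncture_itv f g u : (forall v, 0 < v <= 1 -> 0 < f v <= 1) ->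
  (forall v, 0 < v <= 1 -> g (f v) = v) -> 0 < u < 1 -> 0 < puncture f u < 1.
Proof.
move=> f01 gf /andP[u0 u1]; have u01 : 0 < u <= 1 by rewrite u0 ltW.
have o01 : 0 < (1 : R) <= 1 by rewrite ltr01 lexx.
rewrite /puncture; case: asboolP => fu.
  have /andP[-> f1] := f01 _ o01; rewrite lt_neqAle f1 andbT; apply/eqP => f11.
  by have := gf _ u01; rewrite fu -{1}f11 gf// => h; rewrite -h ltxx in u1.
by have /andP[-> f1] := f01 _ u01; rewrite lt_neqAle f1 andbT; apply/eqP.
Qed.

Lemma punctureK f g u : (forall v, 0 < v <= 1 -> 0 < f v <= 1) ->
  (forall v, 0 < v <= 1 -> g (f v) = v) ->
  0 < u < 1 -> puncture g (puncture f u) = u.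
Proof.
move=> f01 gf /andP[u0 u1]; have u01 : 0 < u <= 1 by rewrite u0 ltW.
have o01 : 0 < (1 : R) <= 1 by rewrite ltr01 lexx.
rewrite {2}/puncture; case: asboolP => fu.
  by rewrite /puncture gf// asboolT// -fu gf.
by rewrite /puncture gf// asboolF//; apply/eqP; rewrite lt_eqF.
Qed.

Lemma measurable_puncture f : measurable_fun setT f -> measurable_fun setT (puncture f).
Proof.
move=> mf; apply: measurable_fun_ifP => //.
by apply: measurable_eqr => //; exact: measurable_cst.
Qed.

End puncture.

Section uniform_on_exchange.
Context d (T : measurableType d) (R : realType) (P : probability T R).
Variables (E : set T) (G : T -> R).
Hypotheses (mE : measurable E) (mG : measurable_fun setT G).
Hypothesis G01 : forall z, 0 < G z < 1.

Hypothesis GU : uniform_on P E G.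

Let mGitv (a b : R) : measurable [set z | a < G z <= b].
Proof.
rewrite (_ : mkset _ = [set z | a < G z /\ G z <= b]).
  by apply: measurable_and; [apply: measurable_ltr|apply: measurable_ler] => //;
    exact: measurable_cst.
by apply/seteqP; split => z /= /andP.
Qed.

Lemma uniform_on_point (c : R) : pr P [set z | E z /\ G z = c] = 0.
Proof.
have mc : measurable [set z | E z /\ G z = c].
  by apply: measurable_and => //; apply: measurable_eqr => //; exact: measurable_cst.
have [c01|nc] := boolP (0 < c < 1); last first.
  rewrite (_ : mkset _ = set0) ?pr0//; apply/seteqP; split => // z [_ zc].
  by have := G01 z; rewrite zc (negbTE nc).
have /andP[c0 c1] := c01.
apply/eqP; rewrite eq_le pr_ge0 andbT; apply/ler_addgt0Pr => e e0; rewrite add0r.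
pose a := Num.max 0 (c - e).
have a0 : 0 <= a by rewrite le_max lexx.
have ac : a < c by rewrite gt_max c0/=; lra.
apply: (@le_trans _ _ (pr P [set z | E z /\ a < G z <= c])).
  apply: le_pr => //; first exact: measurable_and.
  by move=> z /= [Ez ->]; rewrite ac lexx.
rewrite (uniform_on_itv mE mG GU)//; [|exact: ltW|exact: ltW].
have ea : c - e <= a by rewrite le_max lexx orbT.
apply: (@le_trans _ _ (c - a)); last by lra.
by rewrite ler_piMr ?pr_le1// subr_ge0 ltW.
Qed.

Variables (m : nat) (D D' : nat -> R) (s s' : nat -> nat).
Hypotheses (pD : partition_points m D) (pD' : partition_points m D').
Hypothesis s_lt : forall n, (n < m)%N -> (s n < m)%N.
Hypothesis s'_lt : forall n, (n < m)%N -> (s' n < m)%N.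
Hypothesis sK : forall n, (n < m)%N -> s' (s n) = n.
Hypothesis s'K : forall n, (n < m)%N -> s (s' n) = n.
Hypothesis sD : forall n, (n < m)%N -> D' (s n).+1 - D' (s n) = D n.+1 - D n.

Let ex := exchange m D D' s.
Let ex' := exchange m D' D s'.

Let exK v : 0 < v <= 1 -> ex' (ex v) = v.
Proof. exact: exchangeK. Qed.

Let mex : measurable_fun setT ex. Proof. exact: measurable_exchange. Qed.

Let G01' z : 0 < G z <= 1.
Proof. by have /andP[-> /ltW ->] := G01 z. Qed.

Lemma pr_exchange_piece n : (n < m)%N ->
  pr P [set z | E z /\ itv_index D m (G z) = n] = (D n.+1 - D n) * pr P E.
Proof.
move=> nm; case: pD => nD D0 D1.
rewrite -(uniform_on_itv mE mG GU); [| by rewrite -D0 nD|by rewrite nD|by rewrite -D1 nD].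
congr pr; apply/seteqP; split => z /= [Ez h]; split => //; last exact: itv_indexE.
have /andP[z0 z1] := G01' z; rewrite -D1 in z1.
by have [_] := itv_index_bounds nD D0 z0 z1; rewrite h.
Qed.

Let pr_punctured (A : set R) : measurable A ->
  pr P [set z | E z /\ A (puncture ex (G z))] = pr P [set z | E z /\ A (ex (G z))].
Proof.
move=> mA; apply: (@pr_eq_null _ _ _ _ _ _ [set z | E z /\ G z = ex' 1]).
- apply: measurable_and => //; apply: (@measurable_preim _ _ _ _ (fun z => puncture ex (G z))) => //.
  by apply: measurableT_comp mG; exact: measurable_puncture.
- apply: measurable_and => //; apply: (@measurable_preim _ _ _ _ (fun z => ex (G z))) => //.
  exact: measurableT_comp mG.
- by apply: measurable_and => //; apply: measurable_eqr => //; exact: measurable_cst.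
- exact: uniform_on_point.
- move=> z /= nz; rewrite /puncture; case: asboolP => // e1.
  have nE : ~ E z by move=> Ez; apply: nz; split => //; rewrite -e1 exK.
  by split => -[].
Qed.

(** The part of piece n that is sent into (0,v] is as long as the intersection of the target piece
    [s n] with (0,v]; as [s] permutes the pieces, these lengths telescope to v. Puncturing changes
    the value at a single point. *)
Lemma uniform_on_puncture_exchange : uniform_on P E (fun z => puncture ex (G z)).
Proof.
move=> v v01; rewrite (@pr_punctured [set y | y <= v]) /=; last first.
  by apply: measurable_ler => //; exact: measurable_cst.
case: pD => nD D0 D1; case: pD' => nD' D'0 D'1.
pose mn k := Num.min (D' k) v.
have mnD k : 0 <= mn k.+1 - mn k <= D' k.+1 - D' k.
  by have := nD' _ _ (leqnSn k); rewrite /mn; do 2!case: (leP (D' _) v) => ?; lra.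
pose F (n : 'I_m) := [set z | E z /\ D n < G z <= D n + (mn (s n).+1 - mn (s n))].
have mF n : measurable (F n) by exact: measurable_and.
rewrite (_ : mkset _ = [set z | exists n, F n z]); last first.
  apply/seteqP; split => z /=.
    move=> [Ez]; have /andP[z0 z1] := G01' z; rewrite -D1 in z1.
    have [nm /andP[h1 h2]] := itv_index_bounds nD D0 z0 z1.
    rewrite /ex /exchange => h; exists (Ordinal nm); split => //=; rewrite h1/=.
    have := sD nm; move: h h1 h2; rewrite /mn.
    by do 2!case: (leP (D' _) v) => ?; lra.
  move=> [n [Ez /andP[h1 h2]]]; split => //.
  have h3 := sD (ltn_ord n).
  have i : itv_index D m (G z) = n.
    apply: itv_indexE => //; rewrite h1/=; have := mnD (s n); lra.
  rewrite /ex /exchange i; move: h1 h2; rewrite /mn.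
  by do 2!case: (leP (D' _) v) => ?; lra.
rewrite pr_sum//; last first.
  move=> i j z [_ /andP[i1 i2]] [_ /andP[j1 j2]]; apply: ord_inj.
  have bnd (n : 'I_m) : D n + (mn (s n).+1 - mn (s n)) <= D n.+1.
    by have := mnD (s n); have := sD (ltn_ord n); lra.
  rewrite -(itv_indexE nD (ltn_ord i) (u := G z)) ?i1 ?(le_trans i2)//.
  by rewrite (itv_indexE nD (ltn_ord j) (u := G z)) ?j1 ?(le_trans j2).
rewrite (eq_bigr (fun n : 'I_m => (mn (s n).+1 - mn (s n)) * pr P E)) => [|n _]; last first.
  have h := mnD (s n); have h3 := sD (ltn_ord n).
  rewrite /F (uniform_on_itv mE mG GU).
  - by congr (_ * _); lra.
  - by rewrite -D0 nD.
  - lra.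
  - by apply: (@le_trans _ _ (D n.+1)); [lra|rewrite -D1 nD].
rewrite -mulr_suml; congr (_ * _).
pose so (n : 'I_m) : 'I_m := Ordinal (s_lt (ltn_ord n)).
pose so' (n : 'I_m) : 'I_m := Ordinal (s'_lt (ltn_ord n)).
transitivity (\sum_(n < m) (mn n.+1 - mn n)).
  rewrite [RHS](reindex so)//; exists so' => n _; apply: ord_inj => /=.
    exact: sK.
  exact: s'K.
rewrite -(big_mkord xpredT (fun n => mn n.+1 - mn n)) telescope_sumr//.
move: v01 => /andP[v0 v1]; rewrite /mn D'0 D'1.
by rewrite (min_idPr v1) (min_idPl v0) subr0.
Qed.

End uniform_on_exchange.

(** * Uniform innovations *)

Section image_probability.
Context d d' (T : measurableType d) (X : measurableType d') (R : realType).
Variables (P : probability T R) (f : T -> X).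

Definition image_prob (mf : measurable_fun setT f) : set X -> \bar R :=
  rimage P mf measurableT.

Variable mf : measurable_fun setT f.

HB.instance Definition _ := Measure.on (image_prob mf).

Let image_probT : image_prob mf setT = 1%E.
Proof. by rewrite /image_prob /rimage setIT preimage_setT probability_setT. Qed.

HB.instance Definition _ := Measure_isProbability.Build _ _ _ (image_prob mf) image_probT.

Lemma image_probE A : image_prob mf A = P (f @^-1` A).
Proof. by rewrite /image_prob /rimage setIT. Qed.

Lemma pr_image_prob A : pr (image_prob mf) A = pr P [set t | A (f t)].
Proof. by rewrite /pr; congr fine; exact: image_probE. Qed.

End image_probability.

Section uniformizers.
Context (R : realType) (N : nat).
Local Notation E := (RN R N).
Local Notation coord := Defs.coord.

(* [H t (x_{<t}, x_t)] is the innovation of the [t]-th coordinate; [H' t] inverts it on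
   every fibre, not only almost everywhere. *)
Definition uniformizes (mu : probability E R) (H H' : 'I_N -> E * R -> R) := [/\
  (forall t, measurable_fun setT (H t)) /\ (forall t, measurable_fun setT (H' t)),
  (forall t z, 0 < H t z < 1),
  (forall t x r, H' t (x, H t (x, r)) = r),
  (forall t x v, 0 < v < 1 -> H t (x, H' t (x, v)) = v) &
  (forall (t : 'I_N) A, measurable A -> uniform_on mu [set x | A (trunc t x)]
      (fun x => H t (trunc t x, coord x t)))].

(** The joint law of x_{<t} and x_t charges no graph, by [graph_lebesgue_null]; this is the
    hypothesis under which fibres are uniformized. *)
Lemma uniformizers_exist (mu : probability E R) : abs_cont_leb mu ->
  exists H H', uniformizes mu H H'.
Proof.
move=> ac.
have mc (t : 'I_N) : measurable_fun setT (fun x : E => (trunc t x, coord x t)).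
  by apply: measurable_fun_pair; [exact: measurable_trunc|exact: measurable_coord].
pose M t := image_prob mu (mc t).
have graph0 t (phi : E -> R) : measurable_fun setT phi ->
    pr (M t) [set z | z.2 = phi z.1] = 0.
  move=> mphi; rewrite pr_image_prob /=; rewrite /pr ac//.
    apply: measurable_eqr; first exact: measurable_coord.
    exact: (measurableT_comp mphi (@measurable_trunc _ _ _)).
  exact: graph_lebesgue_null.
have /choice[H Hall] t := fibre_uniformization (graph0 t).
have /choice[H' HH'] := Hall.
exists H, H'; split.
- by split=> t; have [[]] := HH' t.
- by move=> t [x r]; have [_ + _ _ _] := HH' t; exact.
- by move=> t x r; have [_ _ + _ _] := HH' t; exact.
- by move=> t x v; have [_ _ _ + _] := HH' t; exact.
- move=> t A mA v v01; have [_ _ _ _ h] := HH' t.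
  by have := h A v mA v01; rewrite !pr_image_prob.
Qed.

Let clamp (a : R) : R := Num.max 0 (Num.min a 1).

(** Innovations that are uniform given their past are jointly independent: the constraints before
    time t form an event of the past, and the t-th one multiplies its probability by [clamp (a t)],
    the uniform distribution function. *)
Lemma pr_uniform_orthant d (T : measurableType d) (P : probability T R) (f : T -> E)
    (H : 'I_N -> E * R -> R) (a : 'I_N -> R) :
  (forall t, measurable_fun setT (H t)) ->
  (forall t z, 0 < H t z < 1) ->
  (forall (t : 'I_N) A, measurable A -> uniform_on P [set x | A (trunc t (f x))]
      (fun x => H t (trunc t (f x), coord (f x) t))) ->
  pr P [set x | forall t, H t (trunc t (f x), coord (f x) t) <= a t] = \prod_t clamp (a t).
Proof.
move=> mH H01 HU.
pose D (k : nat) := [set y : E | forall t : 'I_N, (t < k)%N -> H t (trunc t y, coord y t) <= a t].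
have mD k : measurable (D k).
  apply: measurable_forall => t.
  case: (ltnP t k) => tk; last first.
    by rewrite (_ : mkset _ = setT)//; apply/seteqP; split => // y _.
  rewrite (_ : mkset _ = [set y | H t (trunc t y, coord y t) <= a t]); last first.
    by apply/seteqP; split => y /=; [exact|].
  apply: measurable_ler; last exact: measurable_cst.
  apply: (measurableT_comp (mH t)).
  by apply: measurable_fun_pair; [exact: measurable_trunc|exact: measurable_coord].
suff h k : (k <= N)%N -> pr P [set x | D k (f x)] = \prod_(t < N | (t < k)%N) clamp (a t).
  rewrite (_ : mkset _ = [set x | D N (f x)]); last first.
    by apply/seteqP; split => x /= hx t; [move=> _; exact: hx|exact/hx/ltn_ord].
  by rewrite h//; apply: eq_bigl => t; rewrite ltn_ord.
elim: k => [_|k IH kN].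
  rewrite big_pred0// (_ : mkset _ = setT) ?prT//.
  by apply/seteqP; split.
pose t := Ordinal kN.
have Dtr y : D k y <-> D k (trunc t y).
  split=> h s sk; have := h s sk; rewrite trunc_trunc ?(ltnW sk)// coord_trunc; by rewrite [(s < t)%N]sk.
rewrite (bigD1 t)//= -[X in _ = _ * X](_ : pr P [set x | D k (f x)] = _); last first.
  rewrite (IH (ltnW kN)); apply: eq_bigl => s.
  by rewrite ltnS -val_eqE /= ltn_neqAle andbC.
have c01 : 0 <= clamp (a t) <= 1.
  by rewrite le_max lexx ge_max ler01 ge_min lexx orbT.
rewrite [X in _ = _ * X](_ : _ = pr P [set x | D k (trunc t (f x))]); last first.
  by congr pr; apply/seteqP; split => x /=; [exact: (Dtr _).1|exact: (Dtr _).2].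
rewrite -(HU t (D k) (mD k) _ c01); congr pr; apply/seteqP; split => x /=.
  move=> h; split; first by apply: (Dtr _).1 => s sk; apply: h; exact: ltnW.
  have /andP[h0 h1] := H01 t (trunc t (f x), coord (f x) t).
  by rewrite le_max le_min h ?(ltW h1) ?orbT//= ltnSn.
move=> [/(Dtr _).2 hk ht] s; rewrite ltnS leq_eqVlt => /predU1P[sk|sk]; last exact: hk.
have -> : s = t by exact: ord_inj.
have /andP[h0 h1] := H01 t (trunc t (f x), coord (f x) t).
by move: ht; rewrite le_max leNgt h0 /= le_min => /andP[].
Qed.

(** [U] turns a path into its innovations and [V] is a left inverse, so a law is determined by the
    law of its innovations. Those of [T] under [mu] and of the identity under [nu] are both
    independent uniform. *)
Lemma uniform_pushes (mu nu : probability E R) (H H' : 'I_N -> E * R -> R) (T : E -> E) :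
  uniformizes nu H H' -> measurable_fun setT T ->
  (forall (t : 'I_N) A, measurable A -> uniform_on mu [set x | A (trunc t (T x))]
      (fun x => H t (trunc t (T x), coord (T x) t))) ->
  pushes T mu nu.
Proof.
move=> [[mH mH'] H01 HK _ HU] mT TU B mB.
pose U := build (fun t z => H t (z.1.1, z.2)).
pose V := build (fun t z => H' t (z.1.2, z.2)).
have mU : measurable_fun setT U.
  apply: measurable_build => i; apply: (measurableT_comp (mH i)).
  apply: measurable_fun_pair => //.
  by apply: (measurableT_comp measurable_fst); exact: measurable_fst.
have mV : measurable_fun setT V.
  apply: measurable_build => i; apply: (measurableT_comp (mH' i)).
  apply: measurable_fun_pair => //.
  by apply: (measurableT_comp measurable_snd); exact: measurable_fst.
have VU x : V (U x) = x by apply: build_cancel => i /=; rewrite HK.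
have h := @pr_orthant_ext R N _ _ _ _ mu nu (U \o T) U (measurableT_comp mU mT) mU.
have mVB : measurable [set u | B (V u)] := measurable_preim mV mB.
have {}h := h _ _ mVB.
have mTB : measurable (T @^-1` B) by exact: (measurable_preim mT mB).
rewrite (prE mu mTB) (prE nu mB); congr EFin.
have -> : T @^-1` B = [set t | [set u | B (V u)] ((U \o T) t)].
  by apply/seteqP; split => x /=; rewrite VU.
rewrite h; first by congr pr; apply/seteqP; split => x /=; rewrite VU.
move=> a.
have -> : [set t | orthant a ((U \o T) t)] =
    [set x | forall t, H t (trunc t (T x), coord (T x) t) <= a t].
  by apply/seteqP; split => x /= hx t; have := hx t; rewrite /U coord_build.
have -> : [set t | orthant a (U t)] =
    [set x | forall t, H t (trunc t x, coord x t) <= a t].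
  by apply/seteqP; split => x /= hx t; have := hx t; rewrite /U coord_build.
by rewrite (pr_uniform_orthant _ mH H01 TU) (pr_uniform_orthant (f := id) _ mH H01 HU).
Qed.

End uniformizers.

(** * A Monge map with prescribed cell masses *)

Section grid.
Context (R : realType) (k : nat).
Local Notation K := k.+1.

Definition grid (n : nat) : R := n%:R / K%:R.

(** For u in (0,1] the index is below [K] and [inord] is a mere conversion; for u > 1 the index is
    [K] and the result is 0. *)
Definition cell (u : R) : 'I_K := inord (itv_index grid K u).

Lemma grid_le : {homo grid : i j / (i <= j)%N >-> i <= j}.
Proof. by move=> i j ij; rewrite /grid ler_pM2r ?invr_gt0 ?ler_nat. Qed.

Lemma cellE u (i : 'I_K) : grid i < u <= grid i.+1 -> cell u = i.
Proof.
by move=> h; apply: ord_inj; rewrite /cell (itv_indexE grid_le (ltn_ord i) h) inord_val.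
Qed.

Lemma cell_bounds u : 0 < u <= 1 -> grid (cell u) < u <= grid (cell u).+1.
Proof.
move=> /andP[u0 u1]; have g0 : grid 0 = 0 by rewrite /grid mul0r.
have u1' : u <= grid K by rewrite /grid divff.
by have [h] := itv_index_bounds grid_le g0 u0 u1'; rewrite /cell inordK.
Qed.

Lemma measurable_cell i : measurable [set u | cell u = i].
Proof.
rewrite (_ : mkset _ = [set u | exists n : nat, itv_index grid K u = n /\ (inord n : 'I_K) = i]).
  apply: measurable_exists => n; apply: measurable_and; first exact: measurable_itv_index.
  exact: measurable_const.
by apply/seteqP; split => u /=; [eexists|move=> [n [<-]]].
Qed.

End grid.
Arguments cell {R} k u.

Section lex_points.
Context (R : realType) (k : nat).
Local Notation K := k.+1.

(* Partition points of (0,1] into intervals of lengths [p i j], in lexicographic order. *)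
Definition lex_points (p : 'I_K -> 'I_K -> R) (n : nat) : R :=
  \sum_(m < n) p (inord (m %/ K)) (inord (m %% K)).

Lemma lex_points_le (q : 'I_K -> 'I_K -> R) : (forall i j, 0 <= q i j) ->
  {homo lex_points q : i j / (i <= j)%N >-> i <= j}.
Proof.
move=> q0 i j /subnK <-; elim: (j - i)%N => // n IH.
by rewrite addSn /lex_points big_ord_recr/= (le_trans IH)// lerDl.
Qed.

Lemma lex_points_row (q : 'I_K -> 'I_K -> R) i : (forall i, \sum_j q i j = K%:R^-1) ->
  (i <= K)%N -> lex_points q (i * K) = grid R k i.
Proof.
move=> q_row; elim: i => [_|i IH iK]; first by rewrite mul0n /lex_points big_ord0 /grid mul0r.
rewrite mulSnr /lex_points big_split_ord/= -/(lex_points q (i * K)) IH; last exact: ltnW.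
rewrite /grid -[i.+1%:R]natr1 mulrDl mul1r; congr (_ + _).
rewrite -(q_row (inord i)); apply: eq_bigr => j _.
by rewrite divnMDl// modnMDl divn_small// modn_small// addn0 inord_val.
Qed.

End lex_points.

Section doubly_stochastic_exchange.
Context (R : realType) (k : nat) (p : 'I_k.+1 -> 'I_k.+1 -> R).
Local Notation K := k.+1.

(* Normalized to total mass one: [p i j] is the mass of the cell [(i, j)] under a
   coupling of two uniform laws. *)
Definition doubly_stochastic := [/\ (forall i j, 0 <= p i j),
  (forall i, \sum_j p i j = K%:R^-1) & (forall j, \sum_i p i j = K%:R^-1)].

(* The lexicographic rank of [(j, i)] in terms of that of [(i, j)]. *)
Definition swap_index (n : nat) : nat := ((n %% K) * K + n %/ K)%N.

Lemma swap_index_lt n : (n < K * K)%N -> (swap_index n < K * K)%N.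
Proof.
move=> nK; rewrite /swap_index; have h1 : (n %% K < K)%N by rewrite ltn_mod.
have h2 : (n %/ K < K)%N by rewrite ltn_divLR.
apply: (@leq_trans ((n %% K) * K + K)); first by rewrite ltn_add2l.
by rewrite -mulSnr leq_mul2r h1 orbT.
Qed.

Lemma swap_indexK n : (n < K * K)%N -> swap_index (swap_index n) = n.
Proof.
move=> nK; have h2 : (n %/ K < K)%N by rewrite ltn_divLR.
by rewrite /swap_index modnMDl divnMDl// (divn_small h2) addn0 (modn_small h2) -divn_eq.
Qed.

Let D := lex_points p.
Let D' := lex_points (fun j i => p i j).

Lemma swap_index_length n : (n < K * K)%N ->
  D' (swap_index n).+1 - D' (swap_index n) = D n.+1 - D n.
Proof.
move=> nK; have h2 : (n %/ K < K)%N by rewrite ltn_divLR.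
have e (a b : R) : a + b - a = b by rewrite addrAC subrr add0r.
rewrite /D /D' /lex_points !big_ord_recr/= !e /swap_index.
by rewrite divnMDl// modnMDl (divn_small h2) addn0 (modn_small h2).
Qed.

Hypothesis pDS : doubly_stochastic.

Lemma lex_partition : partition_points (K * K) D.
Proof.
case: pDS => p0 pr pc; split; first exact: lex_points_le.
  by rewrite /D /lex_points big_ord0.
by rewrite /D lex_points_row// /grid divff.
Qed.

Lemma lex_partition' : partition_points (K * K) D'.
Proof.
case: pDS => p0 pr pc; split; first by apply: lex_points_le => i j; exact: p0.
  by rewrite /D' /lex_points big_ord0.
by rewrite /D' lex_points_row// /grid divff.
Qed.

Let lex_cell (q : 'I_K -> 'I_K -> R) u n : (forall i j, 0 <= q i j) ->
  (forall i, \sum_j q i j = K%:R^-1) -> (n < K * K)%N ->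
  lex_points q n < u <= lex_points q n.+1 -> cell k u = inord (n %/ K).
Proof.
move=> q0 qr nK /andP[nu un]; have h2 : (n %/ K < K)%N by rewrite ltn_divLR.
apply: cellE; rewrite inordK//; apply/andP; split.
  apply: le_lt_trans nu; rewrite -(lex_points_row qr (ltnW h2)).
  by apply: lex_points_le => //; exact: leq_divM.
apply: le_trans un _; rewrite -(lex_points_row qr h2).
by apply: lex_points_le => //; rewrite mulSnr {1}(divn_eq n K) -addnS leq_add2l ltn_mod.
Qed.

(** Cell i is divided into pieces of lengths [p i j]; the j-th of them is translated onto the i-th
    piece of cell j. *)
Definition cell_exchange : R -> R := puncture (exchange (K * K) D D' swap_index).
Definition cell_exchange_inv : R -> R := puncture (exchange (K * K) D' D swap_index).

Let exch_itv u : 0 < u <= 1 -> 0 < exchange (K * K) D D' swap_index u <= 1.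
Proof.
apply: exchange_itv; [exact: lex_partition|exact: lex_partition'|exact: swap_index_lt|].
exact: swap_index_length.
Qed.

Let swap_length' n : (n < K * K)%N ->
  D (swap_index n).+1 - D (swap_index n) = D' n.+1 - D' n.
Proof.
move=> nK; rewrite -(swap_index_length (swap_index_lt nK)).
by rewrite swap_indexK.
Qed.

Let exch_itv' u : 0 < u <= 1 -> 0 < exchange (K * K) D' D swap_index u <= 1.
Proof.
apply: exchange_itv; [exact: lex_partition'|exact: lex_partition|exact: swap_index_lt|].
exact: swap_length'.
Qed.

Let exchK u : 0 < u <= 1 ->
  exchange (K * K) D' D swap_index (exchange (K * K) D D' swap_index u) = u.
Proof.
apply: exchangeK; [exact: lex_partition|exact: lex_partition'|exact: swap_index_lt| |].
  exact: swap_index_length.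
exact: swap_indexK.
Qed.

Let exchK' u : 0 < u <= 1 ->
  exchange (K * K) D D' swap_index (exchange (K * K) D' D swap_index u) = u.
Proof.
apply: exchangeK; [exact: lex_partition'|exact: lex_partition|exact: swap_index_lt| |].
  exact: swap_length'.
exact: swap_indexK.
Qed.

Lemma cell_exchange_itv u : 0 < u < 1 -> 0 < cell_exchange u < 1.
Proof. exact: puncture_itv exch_itv exchK. Qed.

Lemma cell_exchange_inv_itv u : 0 < u < 1 -> 0 < cell_exchange_inv u < 1.
Proof. exact: puncture_itv exch_itv' exchK'. Qed.

Lemma cell_exchangeK u : 0 < u < 1 -> cell_exchange_inv (cell_exchange u) = u.
Proof. exact: punctureK exch_itv exchK. Qed.

Lemma cell_exchange_invK u : 0 < u < 1 -> cell_exchange (cell_exchange_inv u) = u.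
Proof. exact: punctureK exch_itv' exchK'. Qed.

Lemma measurable_cell_exchange : measurable_fun setT cell_exchange.
Proof. by apply: measurable_puncture; exact: measurable_exchange. Qed.

Lemma measurable_cell_exchange_inv : measurable_fun setT cell_exchange_inv.
Proof. by apply: measurable_puncture; exact: measurable_exchange. Qed.

Context d (T : measurableType d) (P : probability T R) (E : set T) (G : T -> R).
Hypotheses (mE : measurable E) (mG : measurable_fun setT G).
Hypothesis G01 : forall z, 0 < G z < 1.
Hypothesis GU : uniform_on P E G.

Lemma uniform_on_cell_exchange : uniform_on P E (cell_exchange \o G).
Proof.
apply: (@uniform_on_puncture_exchange _ _ _ _ _ _ mE mG G01 GU _ _ _ _ swap_index
  lex_partition lex_partition') => //.
- exact: swap_index_lt.
- exact: swap_index_lt.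
- exact: swap_indexK.
- exact: swap_indexK.
- exact: swap_index_length.
Qed.

(** Quotient and remainder of the lexicographic index by [K] are the cells before and after the
    exchange. So the event is that [G] falls into one piece, of length [p i j], apart from the point
    whose image is 1. *)
Lemma pr_cell_exchange i j :
  pr P [set z | E z /\ (cell k (G z) = i /\ cell k (cell_exchange (G z)) = j)] =
  p i j * pr P E.
Proof.
pose n := (i * K + j)%N.
have nK : (n < K * K)%N.
  apply: (@leq_trans (i * K + K)); first by rewrite ltn_add2l.
  by rewrite -mulSnr leq_mul2r ltn_ord orbT.
have ni : (n %/ K = i)%N by rewrite /n divnMDl// divn_small// addn0.
have nj : (n %% K = j)%N by rewrite /n modnMDl modn_small.
have -> : p i j = D n.+1 - D n.
  by rewrite /D /lex_points big_ord_recr/= addrAC subrr add0r ni nj !inord_val.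
rewrite -(@pr_exchange_piece _ _ _ _ _ _ mE mG G01 GU _ _ lex_partition)//.
have G01' z : 0 < G z <= 1 by have /andP[-> /ltW ->] := G01 z.
case: pDS => p0 pr pc.
have pc' j' : \sum_i' p i' j' = K%:R^-1 by exact: pc.
have cellD u : 0 < u <= 1 -> cell k u = inord (itv_index D (K * K) u %/ K).
  move=> /andP[u0 u1]; have [nD D0 D1] := lex_partition; rewrite -D1 in u1.
  have [lt h] := itv_index_bounds nD D0 u0 u1.
  exact: (lex_cell p0 pr lt h).
have cellD' u : 0 < u <= 1 -> cell k u = inord (itv_index D' (K * K) u %/ K).
  move=> /andP[u0 u1]; have [nD D0 D1] := lex_partition'; rewrite -D1 in u1.
  have [lt h] := itv_index_bounds nD D0 u0 u1.
  by apply: (@lex_cell (fun j i => p i j)).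
have mcell i' : measurable [set z | cell k (G z) = i'].
  exact: (measurable_preim mG (measurable_cell i')).
have mcell' j' : measurable [set z | cell k (cell_exchange (G z)) = j'].
  apply: (measurable_preim (f := fun z => cell_exchange (G z)) _ (measurable_cell j')).
  by apply: measurableT_comp mG; exact: measurable_cell_exchange.
apply: (@pr_eq_null _ _ _ _ _ _ [set z | E z /\ G z = exchange (K * K) D' D swap_index 1]).
- by apply: measurable_and => //; exact: measurable_and.
- by apply: measurable_and => //; exact: (measurable_preim mG (measurable_itv_index D _ n)).
- by apply: measurable_and => //; apply: measurable_eqr => //; exact: measurable_cst.
- exact: (uniform_on_point mE mG G01 GU).
move=> z /= nz.
suff h : E z -> (cell k (G z) = i /\ cell k (cell_exchange (G z)) = j <->
    itv_index D (K * K) (G z) = n) by split=> -[Ez ?]; split => //; apply/(h Ez).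
move=> Ez.
have ne1 : exchange (K * K) D D' swap_index (G z) <> 1.
  by move=> e1; apply: nz; split => //; rewrite -e1 exchK.
rewrite /cell_exchange /puncture asboolF// cellD// cellD'; last exact: exch_itv.
rewrite (exchange_index lex_partition lex_partition' swap_index_lt swap_index_length)//.
have [nD D0 D1] := lex_partition.
have /andP[z0 z1] := G01' z; rewrite -D1 in z1.
have [lt _] := itv_index_bounds nD D0 z0 z1.
set m := itv_index D (K * K) (G z) in lt *.
have h2 : (m %/ K < K)%N by rewrite ltn_divLR.
have h1 : (m %% K < K)%N by rewrite ltn_mod.
have -> : (swap_index m %/ K = m %% K)%N.
  by rewrite /swap_index divnMDl// (divn_small h2) addn0.
split=> [[/(congr1 val) + /(congr1 val)]|->].
  by rewrite /= !inordK// => mi mj; rewrite (divn_eq m K) mi mj.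
by rewrite ni nj !inord_val.
Qed.

End doubly_stochastic_exchange.

Lemma measurable_dispatch d d' (T : measurableType d) (U : measurableType d')
    (I : countType) (h : T -> I) (F : I -> T -> U) :
  (forall c, measurable [set z | h z = c]) -> (forall c, measurable_fun setT (F c)) ->
  measurable_fun setT (fun z => F (h z) z).
Proof.
move=> mh mF; apply: measurable_funI => A mA.
rewrite (_ : mkset _ = [set z | exists c, h z = c /\ A (F c z)]).
  by apply: measurable_exists => c; apply: measurable_and => //; exact: measurable_preim (mF c) mA.
by apply/seteqP; split => z /=; [eexists|move=> [c [<-]]].
Qed.

Lemma pr_cell d (T : measurableType d) (R : realType) (P : probability T R)
    (E : set T) (G : T -> R) k (i : 'I_k.+1) :
  measurable E -> measurable_fun setT G -> (forall z, 0 < G z < 1) -> uniform_on P E G ->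
  pr P [set z | E z /\ cell k (G z) = i] = k.+1%:R^-1 * pr P E.
Proof.
move=> mE mG G01 GU.
have h : grid R k i.+1 - grid R k i = k.+1%:R^-1.
  by rewrite /grid -mulrBl -natr1 addrAC subrr add0r mul1r.
rewrite -h -(uniform_on_itv mE mG GU).
- congr pr; apply/seteqP; split => z /= [Ez]; last by move/cellE.
  by move=> <-; split => //; apply: cell_bounds; have /andP[-> /ltW ->] := G01 z.
- by rewrite /grid divr_ge0.
- exact: grid_le.
- by rewrite /grid ler_pdivrMr// mul1r ler_nat.
Qed.

Section monge_map.
Context (R : realType) (N : nat) (k : nat).
Local Notation E := (RN R N).
Local Notation coord := Defs.coord.
Local Notation K := k.+1.
Variables (mu nu : probability E R) (H H' G G' : 'I_N -> E * R -> R).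
Hypotheses (muH : uniformizes mu H H') (nuG : uniformizes nu G G').
Variable pi : probability (E * E)%type R.
Local Notation um t x := (H t (trunc t x, coord x t)).
Local Notation un t y := (G t (trunc t y, coord y t)).
Hypothesis pi_um : forall (t : 'I_N) A B, measurable A -> measurable B ->
  uniform_on pi [set z | A (trunc t z.1) /\ B (trunc t z.2)] (fun z => um t z.1).
Hypothesis pi_un : forall (t : 'I_N) A B, measurable A -> measurable B ->
  uniform_on pi [set z | A (trunc t z.1) /\ B (trunc t z.2)] (fun z => un t z.2).

Local Notation hist_type := {ffun 'I_N -> 'I_K * 'I_K}.

(** Entries from time t on are padded with (0, 0), so that histories of all lengths live in one
    finite type; hence the recurring condition that c is (0, 0) from t on. *)
Definition history (t : nat) (x y : E) : hist_type :=
  [ffun s : 'I_N => if (s < t)%N then (cell k (um s x), cell k (un s y)) else (ord0, ord0)].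

Let extend (c : hist_type) (t : 'I_N) (i j : 'I_K) : hist_type :=
  [ffun s : 'I_N => if s == t then (i, j) else c s].

Let mass t c := pr pi [set z | history t z.1 z.2 = c].

(* On histories of mass zero any doubly stochastic matrix would do. *)
Definition transition (t : 'I_N) (c : hist_type) (i j : 'I_K) : R :=
  if mass t c == 0 then K%:R^-1 * K%:R^-1 else mass t.+1 (extend c t i j) / mass t c.

Let mH t : measurable_fun setT (H t). Proof. by case: muH => -[]. Qed.
Let mH' t : measurable_fun setT (H' t). Proof. by case: muH => -[]. Qed.
Let mG t : measurable_fun setT (G t). Proof. by case: nuG => -[]. Qed.
Let mG' t : measurable_fun setT (G' t). Proof. by case: nuG => -[]. Qed.
Let H01 t z : 0 < H t z < 1. Proof. by case: muH. Qed.
Let G01 t z : 0 < G t z < 1. Proof. by case: nuG. Qed.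

Let mum (t : 'I_N) : measurable_fun setT (fun x => um t x).
Proof.
apply: (measurableT_comp (mH t)).
by apply: measurable_fun_pair; [exact: measurable_trunc|exact: measurable_coord].
Qed.

Let mun (t : 'I_N) : measurable_fun setT (fun x => un t x).
Proof.
apply: (measurableT_comp (mG t)).
by apply: measurable_fun_pair; [exact: measurable_trunc|exact: measurable_coord].
Qed.

Let um_trunc (s : 'I_N) t x : (s < t)%N -> um s (trunc t x) = um s x.
Proof. by move=> st; rewrite trunc_trunc ?(ltnW st)// coord_trunc st. Qed.

Let un_trunc (s : 'I_N) t x : (s < t)%N -> un s (trunc t x) = un s x.
Proof. by move=> st; rewrite trunc_trunc ?(ltnW st)// coord_trunc st. Qed.

Lemma history_trunc t x y : history t (trunc t x) (trunc t y) = history t x y.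
Proof.
apply/ffunP => s; rewrite !ffunE; case: ifP => // st.
by rewrite um_trunc// un_trunc.
Qed.

Let hl t (c : hist_type) : set E := [set x | forall s : 'I_N, (s < t)%N -> cell k (um s x) = (c s).1].
Let hr t (c : hist_type) : set E := [set y | (forall s : 'I_N, (s < t)%N -> cell k (un s y) = (c s).2)
  /\ forall s : 'I_N, (t <= s)%N -> c s = (ord0, ord0)].

Let history_eq t x y c : history t x y = c <-> hl t c x /\ hr t c y.
Proof.
split=> [<-|[hlc [hrc hc]]].
  split=> [s st|]; first by rewrite ffunE st.
  by split=> s st; rewrite ffunE ?st// ltnNge st.
apply/ffunP => s; rewrite ffunE; case: ltnP => st; last by rewrite hc.
by rewrite hlc// hrc//; case: (c s).
Qed.

(** A history event is an event of the past of x intersected with one of the past of y, the form in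
    which [pi_um] and [pi_un] apply. *)
Let history_setE t c : [set z : E * E | history t z.1 z.2 = c] =
  [set z | hl t c (trunc t z.1) /\ hr t c (trunc t z.2)].
Proof.
apply/seteqP; split => z /=; rewrite -history_trunc; last by move/history_eq.
by move/history_eq.
Qed.

Let mhl t c : measurable (hl t c).
Proof.
apply: measurable_forall => s; case: (ltnP s t) => st; last first.
  by rewrite (_ : mkset _ = setT)//; apply/seteqP; split.
rewrite (_ : mkset _ = [set x | cell k (um s x) = (c s).1]); last first.
  by apply/seteqP; split => x /=; [exact|].
exact: (measurable_preim (@mum s) (measurable_cell _)).
Qed.

Let mhr t c : measurable (hr t c).
Proof.
apply: measurable_and; last exact: measurable_const.
apply: measurable_forall => s; case: (ltnP s t) => st; last first.
  by rewrite (_ : mkset _ = setT)//; apply/seteqP; split.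
rewrite (_ : mkset _ = [set x | cell k (un s x) = (c s).2]); last first.
  by apply/seteqP; split => x /=; [exact|].
exact: (measurable_preim (@mun s) (measurable_cell _)).
Qed.

Lemma measurable_history t c : measurable [set z : E * E | history t z.1 z.2 = c].
Proof.
rewrite history_setE; apply: measurable_and.
  exact: (measurable_preim (measurableT_comp (@measurable_trunc _ _ t) measurable_fst) (mhl t c)).
exact: (measurable_preim (measurableT_comp (@measurable_trunc _ _ t) measurable_snd) (mhr t c)).
Qed.

Lemma history_extend (t : 'I_N) x y (c : hist_type) i j : (forall s : 'I_N, (t <= s)%N -> c s = (ord0, ord0)) ->
  history t.+1 x y = extend c t i j <->
  history t x y = c /\ (cell k (um t x) = i /\ cell k (un t y) = j).
Proof.
move=> hc; split=> [/ffunP h|[hxy [hi hj]]].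
  split; last by have := h t; rewrite !ffunE ltnSn eqxx => -[].
  apply/ffunP => s; rewrite ffunE; case: ltnP => st; last by rewrite hc.
  have := h s; rewrite !ffunE ltnS (ltnW st); case: eqP => // e.
  by rewrite e ltnn in st.
apply/ffunP => s; rewrite !ffunE ltnS.
case: eqP => [->|/eqP st]; first by rewrite leqnn hi hj.
rewrite leq_eqVlt (_ : (val s == t) = false) /=; last exact/negbTE.
by move/ffunP : hxy => /(_ s); rewrite ffunE.
Qed.

Let mass_support t c : mass t c != 0 -> forall s : 'I_N, (t <= s)%N -> c s = (ord0, ord0).
Proof.
move=> m0 s ts; have [z zc] : exists z : E * E, history t z.1 z.2 = c.
  apply: contrapT => nz; move/eqP : m0; apply; rewrite /mass (_ : mkset _ = set0) ?pr0//.
  by apply/seteqP; split => // z zc; apply: nz; exists z.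
by rewrite -zc ffunE ltnNge ts.
Qed.

Let mass_uniform (t : 'I_N) c : uniform_on pi [set z | history t z.1 z.2 = c] (fun z => um t z.1)
  /\ uniform_on pi [set z | history t z.1 z.2 = c] (fun z => un t z.2).
Proof. by rewrite history_setE; split; [exact: pi_um|exact: pi_un]. Qed.

(** Row sums express that the innovation of x is uniform given the joint history, column sums that
    the innovation of y is. *)
Lemma transition_ds t c : doubly_stochastic (transition t c).
Proof.
have K0 : (K%:R : R) != 0 by rewrite pnatr_eq0.
rewrite /transition; case: eqP => [_|/eqP m0].
  have e : \sum_(i < K) (K%:R^-1 * K%:R^-1 : R) = K%:R^-1.
    by rewrite sumr_const card_ord -[LHS]mulr_natr -mulrA mulVf// mulr1.
  by split => [i j|i|j] //; rewrite mulr_ge0.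
have hc := mass_support m0.
have mext i j : measurable [set z : E * E | history t.+1 z.1 z.2 = extend c t i j].
  exact: measurable_history.
split=> [i j|i|j]; first by rewrite divr_ge0// pr_ge0.
  rewrite -mulr_suml; apply: (mulIf m0); rewrite divfK//.
  rewrite -(pr_cell i (measurable_history t c) _ _ (mass_uniform t c).1).
  - rewrite -pr_sum//; last first.
      move=> j1 j2 z /= -> /ffunP/(_ t); rewrite !ffunE eqxx => -[].
      by [].
    congr pr; apply/seteqP; split => z /=.
      by move=> [j /(history_extend _ _ _ _ hc)[? []]].
    by move=> [? ?]; exists (cell k (un t z.2)); apply/(history_extend _ _ _ _ hc).
  - exact: (measurableT_comp (@mum t) measurable_fst).
  - by move=> z; exact: H01.
rewrite -mulr_suml; apply: (mulIf m0); rewrite divfK//.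
rewrite -(pr_cell j (measurable_history t c) _ _ (mass_uniform t c).2).
- rewrite -pr_sum//; last first.
    move=> j1 j2 z /= -> /ffunP/(_ t); rewrite !ffunE eqxx => -[].
    by [].
  congr pr; apply/seteqP; split => z /=.
    by move=> [i /(history_extend _ _ _ _ hc)[? []]].
  by move=> [? ?]; exists (cell k (um t z.1)); apply/(history_extend _ _ _ _ hc).
- exact: (measurableT_comp (@mun t) measurable_snd).
- by move=> z; exact: G01.
Qed.

(** If c has mass zero, so has every extension of c, and the formula survives the default value of
    [transition]. *)
Lemma transition_mass (t : 'I_N) (c : hist_type) i j : (forall s : 'I_N, (t <= s)%N -> c s = (ord0, ord0)) ->
  mass t.+1 (extend c t i j) = transition t c i j * mass t c.
Proof.
move=> hc; rewrite /transition; case: eqP => [m0|/eqP m0]; last by rewrite divfK.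
rewrite m0 mulr0; apply: (pr0_sub _ _ _ m0); [exact: measurable_history|exact: measurable_history|].
by move=> z /= /(history_extend _ _ _ _ hc)[].
Qed.

(** Take the innovation of x_t, apply the exchange prescribed by the joint history so far, and read
    the result as an innovation of [nu] on the fibre over the past of the image. *)
Let phi (t : 'I_N) (z : (E * E) * R) : R :=
  G' t (z.1.2, cell_exchange (transition t (history t z.1.1 z.1.2)) (H t (z.1.1, z.2))).

(** Here the first past is that of y, whence the interchanged arguments of [history]: inverting uses
    the same transition matrix. *)
Let psi (t : 'I_N) (z : (E * E) * R) : R :=
  H' t (z.1.2, cell_exchange_inv (transition t (history t z.1.2 z.1.1)) (G t (z.1.1, z.2))).

Let measurable_phi t : measurable_fun setT (phi t).
Proof.
apply: (@measurable_dispatch _ _ _ _ hist_type (fun z => history t z.1.1 z.1.2)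
  (fun c z => G' t (z.1.2, cell_exchange (transition t c) (H t (z.1.1, z.2))))) => c.
  exact: (measurable_preim measurable_fst (measurable_history t c)).
apply: (measurableT_comp (@mG' t)); apply: measurable_fun_pair.
  exact: (measurableT_comp measurable_snd measurable_fst).
apply: (measurableT_comp (@measurable_cell_exchange _ _ _)).
apply: (measurableT_comp (@mH t)); apply: measurable_fun_pair => //.
exact: (measurableT_comp measurable_fst measurable_fst).
Qed.

Let measurable_psi t : measurable_fun setT (psi t).
Proof.
apply: (@measurable_dispatch _ _ _ _ hist_type (fun z => history t z.1.2 z.1.1)
  (fun c z => H' t (z.1.2, cell_exchange_inv (transition t c) (G t (z.1.1, z.2))))) => c.
  have msw : measurable_fun setT (fun z : (E * E) * R => (z.1.2, z.1.1)).
    apply: measurable_fun_pair; first exact: (measurableT_comp measurable_snd measurable_fst).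
    exact: (measurableT_comp measurable_fst measurable_fst).
  exact: (measurable_preim msw (measurable_history t c)).
apply: (measurableT_comp (@mH' t)); apply: measurable_fun_pair.
  exact: (measurableT_comp measurable_snd measurable_fst).
apply: (measurableT_comp (@measurable_cell_exchange_inv _ _ _)).
apply: (measurableT_comp (@mG t)); apply: measurable_fun_pair => //.
exact: (measurableT_comp measurable_fst measurable_fst).
Qed.

Definition monge_map : E -> E := build phi.

Lemma biadapted_monge_map : biadapted monge_map.
Proof.
case: muH => _ _ HK HK' _; case: nuG => _ _ GK GK' _.
exists (build psi); split.
- exact: measurable_build.
- exact: measurable_build.
- move=> x; apply: build_cancel => i; rewrite /phi /psi /=.
  have ds := transition_ds i (history i (trunc i x) (trunc i (build phi x))).
  by rewrite GK' ?(cell_exchange_itv ds)// (cell_exchangeK ds)// HK.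
- move=> y; apply: build_cancel => i; rewrite /phi /psi /=.
  have ds := transition_ds i (history i (trunc i (build psi y)) (trunc i y)).
  by rewrite HK' ?(cell_exchange_inv_itv ds)// (cell_exchange_invK ds)// GK.
- by split; exact: adapted_build.
Qed.

Lemma un_monge_map (t : 'I_N) x : un t (monge_map x) =
  cell_exchange (transition t (history t x (monge_map x))) (um t x).
Proof.
case: nuG => _ _ _ GK' _; rewrite /monge_map coord_build /phi /= -/monge_map history_trunc.
by rewrite GK'//; apply: cell_exchange_itv => //; exact: transition_ds.
Qed.

Let trunc_monge t x : trunc t (monge_map (trunc t x)) = trunc t (monge_map x).
Proof.
by have /adaptedP := @adapted_build _ _ phi; apply; rewrite trunc_trunc.
Qed.

Lemma measurable_monge_map : measurable_fun setT monge_map.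
Proof. exact: measurable_build. Qed.

Let mgraph : measurable_fun setT (fun x => (x, monge_map x)).
Proof. by apply: measurable_fun_pair => //; exact: measurable_monge_map. Qed.

(** Since the map is adapted, the past of the image and the joint history are functions of x_{<t},
    from which the innovation of x_t is independent. *)
Let history_graph_uniform (t : 'I_N) c A : measurable A ->
  uniform_on mu [set x | A (trunc t (monge_map x)) /\ history t x (monge_map x) = c] (fun x => um t x).
Proof.
move=> mA; case: muH => _ _ _ _ muU.
pose B := [set x | A (trunc t (monge_map x)) /\ history t x (monge_map x) = c].
have mB : measurable B.
  apply: measurable_and.
    exact: (measurable_preim (measurableT_comp (@measurable_trunc _ _ t) measurable_monge_map) mA).
  exact: (measurable_preim mgraph (measurable_history t c)).
have -> : [set x | A (trunc t (monge_map x)) /\ history t x (monge_map x) = c] = [set x | B (trunc t x)].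
  have h x : history t (trunc t x) (monge_map (trunc t x)) = history t x (monge_map x).
    by rewrite -[LHS]history_trunc trunc_monge trunc_trunc// history_trunc.
  by apply/seteqP; split => x; rewrite /B /= trunc_monge h.
exact: muU.
Qed.

(** On each history one fixed exchange is applied to a uniform innovation, and exchanges preserve
    uniformity; summing over the finitely many histories concludes. *)
Lemma monge_map_uniform (t : 'I_N) A : measurable A ->
  uniform_on mu [set x | A (trunc t (monge_map x))] (fun x => un t (monge_map x)).
Proof.
move=> mA v v01.
have mA' : measurable [set x | A (trunc t (monge_map x))].
  exact: (measurable_preim (measurableT_comp (@measurable_trunc _ _ t) measurable_monge_map) mA).
have mh c : measurable [set x | history t x (monge_map x) = c].
  exact: (measurable_preim mgraph (measurable_history t c)).
have mle : measurable [set x | un t (monge_map x) <= v].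
  apply: measurable_ler; last exact: measurable_cst.
  exact: (measurableT_comp (@mun t) measurable_monge_map).
rewrite [in RHS](_ : [set x | _] = [set x | exists c,
  A (trunc t (monge_map x)) /\ history t x (monge_map x) = c]); last first.
  apply/seteqP; split => x /=; last by case=> ? [].
  by move=> Ax; exists (history t x (monge_map x)).
transitivity (pr mu [set x | exists c,
  (A (trunc t (monge_map x)) /\ history t x (monge_map x) = c) /\ un t (monge_map x) <= v]).
  congr pr; apply/seteqP; split => x /=; last by case=> ? [[]].
  by move=> [Ax ?]; exists (history t x (monge_map x)).
rewrite pr_sum; [rewrite pr_sum|..].
- rewrite mulr_sumr; apply: eq_bigr => c _.
  have := uniform_on_cell_exchange (transition_ds t c) _ (@mum t) _ (@history_graph_uniform t c A mA).
  move=> <-//; last by apply: measurable_and.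
  congr pr; apply/seteqP; split => x /= [[Ax hx]]; rewrite un_monge_map hx => ?; split => //.
- by move=> c; exact: measurable_and.
- by move=> i j x [_ <-] [_ <-].
- by move=> c; apply: measurable_and => //; exact: measurable_and.
- by move=> i j x [[_ <-] _] [[_ <-] _].
Qed.

Lemma pushes_monge_map : pushes monge_map mu nu.
Proof.
apply: (uniform_pushes nuG measurable_monge_map) => t A mA.
exact: monge_map_uniform.
Qed.

(** The cell pairs evolve with the same transition matrices under both laws: under [pi] by
    definition of [transition], along the graph by [pr_cell_exchange]. *)
Lemma history_monge_map t c : (t <= N)%N ->
  pr mu [set x | history t x (monge_map x) = c] = pr pi [set z | history t z.1 z.2 = c].
Proof.
have allT (U : Type) (Q : U -> Prop) : (forall u, Q u) -> [set u | Q u] = setT.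
  by move=> h; apply/seteqP; split => // u _; exact: h.
have all0 (U : Type) (Q : U -> Prop) : (forall u, ~ Q u) -> [set u | Q u] = set0.
  by move=> h; apply/seteqP; split => // u /h.
elim: t c => [c _|t IH c tN].
  have h0 x y : history 0 x y = [ffun=> (ord0, ord0)].
    by apply/ffunP => s; rewrite !ffunE.
  have [->|c0] := eqVneq c [ffun=> (ord0, ord0)]; first by rewrite !allT ?prT.
  by rewrite !all0 ?pr0// => z; rewrite h0 => h; rewrite h eqxx in c0.
pose t' := Ordinal tN.
(* A c without the right padding is never a history, and both sides vanish. *)
have [hc|nhc] := pselect (forall s : 'I_N, (t < s)%N -> c s = (ord0, ord0)); last first.
  rewrite !all0 ?pr0// => z h; apply: nhc => s ts;
  by rewrite -h ffunE ltnNge ts.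
pose c' : hist_type := [ffun s : 'I_N => if (s < t)%N then c s else (ord0, ord0)].
have hc' (s : 'I_N) : (t' <= s)%N -> c' s = (ord0, ord0) by move=> ts; rewrite ffunE ltnNge ts.
have -> : c = extend c' t' (c t').1 (c t').2.
  apply/ffunP => s; rewrite !ffunE; case: eqP => [->|/eqP st]; first by case: (c t').
  case: ltnP => // ts; apply: hc; rewrite ltn_neqAle ts andbT.
  by apply: contra st => /eqP e; apply/eqP/ord_inj.
rewrite [RHS](transition_mass _ _ hc') /mass -(IH c' (ltnW tN)).
have hU := @history_graph_uniform t' c' setT measurableT.
have e : [set x | setT (trunc t' (monge_map x)) /\ history t' x (monge_map x) = c'] =
    [set x | history t x (monge_map x) = c'] by apply/seteqP; split => x //= [].
rewrite e in hU.
rewrite -(pr_cell_exchange (transition_ds t' c') _ (@mum t') _ hU)//; last first.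
  exact: (measurable_preim mgraph (measurable_history t c')).
congr pr; apply/seteqP; split => x /=.
  by move=> /(history_extend _ _ _ _ hc')[hx]; rewrite un_monge_map hx.
by move=> [hx h]; apply/(history_extend _ _ _ _ hc'); rewrite un_monge_map hx.
Qed.

End monge_map.

Lemma integral_rimage d d' (T : measurableType d) (X : measurableType d') (R : realType)
    (P : probability T R) (f : T -> X) (D : set T)
    (mf : measurable_fun setT f) (mD : measurable D) (A : set X) (g : X -> \bar R) :
  measurable A -> measurable_fun setT g -> (forall y, 0 <= g y)%E ->
  (\int[rimage P mf mD]_(y in A) g y = \int[P]_(x in (f @^-1` A) `&` D) g (f x))%E.
Proof.
move=> mA mg g0.
have mfA : measurable (f @^-1` A) by exact: (measurable_preim mf mA).
have mgf : measurable_fun setT (g \o f) by exact: measurableT_comp.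
transitivity (\int[pushforward (mrestr P mD) f]_(y in A) g y)%E.
  exact: eq_measure_integral.
rewrite ge0_integral_pushforward//; last exact: measurable_funTS.
rewrite -{1}(setUIDK (f @^-1` A) D).
rewrite (ge0_integral_setU _ (measurableI _ _ mfA mD) (measurableD mfA mD)); [|exact: (measurable_funTS mgf)|by move=> x _; exact: g0|]; last first.
  by apply/disj_setPS => x [[_ Dx] [_ nDx]].
rewrite [X in (_ + X)%E]null_set_integral.
- rewrite adde0; apply: eq_measure_integral => B mB BfD.
  by rewrite /= /mrestr setIidl// => x /BfD[].
- exact: measurableD.
- exact: (measurable_funTS mgf).
- by rewrite /= /mrestr setDE -setIA setICl setI0 measure0.
Qed.

(** * Bicausality and innovations *)

Section causal_uniform.
Context (R : realType) (N : nat).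
Local Notation E := (RN R N).
Local Notation coord := Defs.coord.

(* Causality forces the innovation [H t] of the first marginal to be independent of
   the joint past of both marginals. *)
Lemma causal_uniform (mu : probability E R) (H H' : 'I_N -> E * R -> R)
    (m : set E -> set E -> \bar R) (t : 'I_N) (A B : set E) (v : R) :
  uniformizes mu H H' -> causal mu m -> measurable A -> measurable B -> 0 <= v <= 1 ->
  m [set x | A (trunc t x) /\ H t (trunc t x, coord x t) <= v] [set y | B (trunc t y)] =
  (v%:E * m [set x | A (trunc t x)] [set y | B (trunc t y)])%E.
Proof.
move=> [[mH _] _ _ _ HU] [k [mk causk]] mA mB v01.
have mtr := @measurable_trunc R N t.
set Bt := [set y | B (trunc t y)].
have mBt : measurable Bt by exact: (measurable_preim mtr mB).
have FBt : Fsig t Bt.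
  by apply/FsigP; split => // x; rewrite /Bt /= trunc_trunc.
have [g [Fg gk]] := causk t Bt FBt.
pose D := [set x | H t (trunc t x, coord x t) <= v].
have mD : measurable D.
  apply: measurable_ler; last exact: measurable_cst.
  by apply: (measurableT_comp (mH t)); apply: measurable_fun_pair => //; exact: measurable_coord.
have mAt : measurable [set x | A (trunc t x)] by exact: (measurable_preim mtr mA).
have mg : measurable_fun setT g.
  by apply: measurable_funI => S mS; have /FsigP[] := Fg S mS.
(* The level set of [g] through x belongs to the sigma-algebra of the first t coordinates, hence
   also contains the truncation of x. *)
have gtr x : g (trunc t x) = g x.
  have /FsigP[_ h] := Fg [set g x] (emeasurable_set1 _).
  by have [+ _] := h x; exact.
(* [g] agrees with the kernel only almost everywhere and may be negative elsewhere; the absolute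
   value repairs this and still depends on the past alone. *)
pose g' x := `|g x|%E.
have mg' : measurable_fun setT g' by exact: measurableT_comp.
have g'0 x : (0 <= g' x)%E by exact: abse_ge0.
have kg (S : set E) : measurable S ->
    (\int[mu]_(x in S) k x Bt = \int[mu]_(x in S) g' (trunc t x))%E.
  move=> mS; apply: ge0_ae_eq_integral => //.
  - by apply: measurable_funTS; exact: measurable_kernel.
  - by apply: measurable_funTS; apply: measurableT_comp.
  - apply: filterS gk => x /= gx _; rewrite /g' gtr gx gee0_abs//.
rewrite !mk//; last exact: measurable_and.
rewrite !kg//; last exact: measurable_and.
have v0 : 0 <= v by case/andP: v01.
(* The law of x_{<t} on the event that the innovation is at most [v] equals [v] times the law of
   x_{<t}, and the integrand is a function of x_{<t}. *)
transitivity (\int[rimage mu mtr mD]_(y in A) g' y)%E; first by rewrite integral_rimage.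
transitivity (\int[mscale (NngNum v0) (rimage mu mtr measurableT)]_(y in A) g' y)%E.
  apply: eq_measure_integral => C mC _; rewrite [LHS]pr_rimage//= /mscale/= pr_rimage// -EFinM; congr EFin.
  have := HU t C mC v v01; rewrite /= => ->; congr (_ * pr _ _).
  by apply/seteqP; split => x //= [].
rewrite ge0_integral_mscale//; last exact: measurable_funTS.
by rewrite integral_rimage// setIT.
Qed.

Variables (mu nu : probability E R) (H H' G G' : 'I_N -> E * R -> R).
Hypotheses (muH : uniformizes mu H H') (nuG : uniformizes nu G G').
Variable pi : probability (E * E)%type R.
Hypothesis pi_bc : bicausal mu nu pi.

Lemma bicausal_uniform1 (t : 'I_N) A B : measurable A -> measurable B ->
  uniform_on pi [set z | A (trunc t z.1) /\ B (trunc t z.2)]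
    (fun z => H t (trunc t z.1, coord z.1 t)).
Proof.
move=> mA mB v v01; case: pi_bc => _ c1 _.
have /= h := @causal_uniform mu H H' _ t A B v muH c1 mA mB v01.
rewrite /pr -[in RHS](_ : [set x | A (trunc t x)] `*` [set y | B (trunc t y)] = [set z | _])//.
have e : [set z : E * E | [set z | A (trunc t z.1) /\ B (trunc t z.2)] z /\
      H t (trunc t z.1, coord z.1 t) <= v] =
    [set x | A (trunc t x) /\ H t (trunc t x, coord x t) <= v] `*` [set y | B (trunc t y)].
  by apply/seteqP; split => z /=; tauto.
rewrite e h fineM// fin_num_measure//.
apply: measurableX; first exact: (measurable_preim (@measurable_trunc _ _ _) mA).
exact: (measurable_preim (@measurable_trunc _ _ _) mB).
Qed.

Lemma bicausal_uniform2 (t : 'I_N) A B : measurable A -> measurable B ->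
  uniform_on pi [set z | A (trunc t z.1) /\ B (trunc t z.2)]
    (fun z => G t (trunc t z.2, coord z.2 t)).
Proof.
move=> mA mB v v01; case: pi_bc => _ _ c2.
have /= h := @causal_uniform nu G G' _ t B A v nuG c2 mB mA v01.
rewrite /pr -[in RHS](_ : [set x | A (trunc t x)] `*` [set y | B (trunc t y)] = [set z | _])//.
have e : [set z : E * E | [set z | A (trunc t z.1) /\ B (trunc t z.2)] z /\
      G t (trunc t z.2, coord z.2 t) <= v] =
    [set x | A (trunc t x)] `*` [set y | B (trunc t y) /\ G t (trunc t y, coord y t) <= v].
  by apply/seteqP; split => z /=; tauto.
rewrite e h fineM// fin_num_measure//.
apply: measurableX; first exact: (measurable_preim (@measurable_trunc _ _ _) mA).
exact: (measurable_preim (@measurable_trunc _ _ _) mB).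
Qed.

End causal_uniform.

(** * Approximation on fine grids *)

(** The bound is a multiple of [c] so that n can count steps of length [c] when the box is
    subdivided. *)
Lemma coord_tail (R : realType) (N : nat) (mu : probability (RN R N) R) (c e : R) :
  0 < c -> 0 < e ->
  exists n : nat, pr mu [set x | exists i : 'I_N, n%:R * c <= `|Defs.coord x i|] <= e.
Proof.
move=> c0 e0.
pose F (n : nat) := [set x : RN R N | forall i, `|Defs.coord x i| < n%:R * c].
have mF n : measurable (F n).
  apply: measurable_forall => i; apply: measurable_ltr; last exact: measurable_cst.
  by apply: (measurableT_comp (@normr_measurable R setT)); exact: measurable_coord.
have [n Hn] : exists n, 1 - e <= pr mu (F n).
  apply: contrapT => /forallNP h.
  have : pr mu (\bigcup_n F n) <= 1 - e.
    apply: pr_bigcup_le => // n.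
    - by move=> x /= Fx i; apply: lt_le_trans (Fx i) _; rewrite ler_pM2r// ler_nat.
    - by have := h n; move/negP; rewrite -ltNge => /ltW.
  rewrite (_ : \bigcup_n F n = setT) ?prT; first lra.
  apply/seteqP; split => // x _.
  have [n1 h1] := coord_le_nat (\row_i (`|Defs.coord x i| / c) : 'rV[R]_N).
  exists n1.+1 => // i; have := h1 i; rewrite {1}/Defs.coord mxE ler_pdivrMr// => h2.
  by apply: le_lt_trans h2 _; rewrite ltr_pM2r// ltr_nat.
exists n; rewrite (_ : mkset _ = ~` F n); first by rewrite prC//; lra.
apply/seteqP; split => x /=; first by move=> [i hi] /(_ i); rewrite ltNge hi.
by move=> /existsNP[i /negP]; rewrite -leNgt; exists i.
Qed.

Section cell_approximation.
Context (R : realType) (N : nat).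
Local Notation E := (RN R N).
Local Notation coord := Defs.coord.
Variables (mu : probability E R) (H H' : 'I_N -> E * R -> R).
Hypothesis muH : uniformizes mu H H'.
Local Notation um t x := (H t (trunc t x, coord x t)).

Definition cells (k : nat) (x : E) : {ffun 'I_N -> 'I_k.+1} :=
  [ffun s : 'I_N => cell k (um s x)].

(** Demanding this for all k from some [k0] on lets finitely many sets be approximated on a common
    grid. *)
Definition cell_approximable (B : set E) := forall e : R, 0 < e ->
  exists k0, forall k, (k0 <= k)%N -> exists Q : set {ffun 'I_N -> 'I_k.+1},
    pr mu [set x | ~ (B x <-> Q (cells k x))] <= e.

Let mum (t : 'I_N) : measurable_fun setT (fun x => um t x).
Proof.
case: muH => -[mH _] _ _ _ _; apply: (measurableT_comp (mH t)).
by apply: measurable_fun_pair; [exact: measurable_trunc|exact: measurable_coord].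
Qed.

Lemma measurable_cells k (Q : set {ffun 'I_N -> 'I_k.+1}) :
  measurable [set x | Q (cells k x)].
Proof.
rewrite (_ : mkset _ = [set x | exists c, Q c /\ cells k x = c]).
  apply: measurable_exists => c; apply: measurable_and; first exact: measurable_const.
  rewrite (_ : mkset _ = [set x | forall s, cell k (um s x) = c s]).
    apply: measurable_forall => s.
    exact: (measurable_preim (@mum s) (measurable_cell _)).
  apply/seteqP; split => x /=; first by move=> <- s; rewrite ffunE.
  by move=> h; apply/ffunP => s; rewrite ffunE.
apply/seteqP; split => x /=; first by exists (cells k x).
by move=> [c [Qc ->]].
Qed.

Let measurable_iff (B : set E) (C : set E) : measurable B -> measurable C ->
  measurable [set x | ~ (B x <-> C x)].
Proof.
move=> mB mC; apply: measurable_not.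
rewrite (_ : mkset _ = [set x | (B x /\ C x) \/ (~ B x /\ ~ C x)]).
  by apply: measurable_or; apply: measurable_and => //; exact: measurable_not.
by apply/seteqP; split => x /=; have [?|?] := pselect (B x); tauto.
Qed.

Let merr (B : set E) k (Q : set {ffun 'I_N -> 'I_k.+1}) : measurable B ->
  measurable [set x | ~ (B x <-> Q (cells k x))].
Proof. by move=> mB; apply: measurable_iff => //; exact: measurable_cells. Qed.

Lemma cell_approximableC (B : set E) : cell_approximable B -> cell_approximable (~` B).
Proof.
move=> aB e e0; have [k0 Hk] := aB e e0; exists k0 => k kk0.
have [Q HQ] := Hk k kk0; exists (~` Q).
rewrite (_ : mkset _ = [set x | ~ (B x <-> Q (cells k x))])//.
by apply/seteqP; split => x /=; have [?|?] := pselect (B x); tauto.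
Qed.

Lemma cell_approximable_family (I : finType) (B : I -> set E) :
  (forall i, measurable (B i)) -> (forall i, cell_approximable (B i)) ->
  forall e : R, 0 < e -> exists k0, forall k, (k0 <= k)%N ->
    exists Q : I -> set {ffun 'I_N -> 'I_k.+1},
    pr mu [set x | exists i, ~ (B i x <-> Q i (cells k x))] <= e.
Proof.
move=> mB aB e e0.
have e'0 : 0 < e / #|I|.+1%:R by rewrite divr_gt0.
have /choice[K HK] i := aB i _ e'0.
exists (\max_i K i)%N => k kK.
have /choice[Q HQ] i : exists Q : set {ffun 'I_N -> 'I_k.+1},
    pr mu [set x | ~ (B i x <-> Q (cells k x))] <= e / #|I|.+1%:R.
  by apply: HK; apply: leq_trans kK; exact: leq_bigmax.
exists Q; apply: le_trans (pr_le_sum _ _) _ => [i|]; first exact: merr.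
apply: (@le_trans _ _ (\sum_(i : I) e / #|I|.+1%:R)); first by apply: ler_sum => i _; exact: HQ.
rewrite sumr_const -[leLHS]mulr_natr mulrAC ler_pdivrMr// ler_pM2l// ler_nat.
exact: leqnSn.
Qed.

Lemma cell_approximable_bigcup (B : nat -> set E) : (forall n, measurable (B n)) ->
  (forall n, cell_approximable (B n)) -> cell_approximable (\bigcup_n B n).
Proof.
move=> mB aB e e0; have e2 : 0 < e / 2 by lra.
have mU : measurable (\bigcup_n B n) by exact: bigcupT_measurable.
pose F n := [set x | exists i : 'I_n, B i x].
have mF n : measurable (F n) by apply: measurable_exists => i; exact: mB.
have [n Hn] : exists n, pr mu (\bigcup_n B n) - e / 2 <= pr mu (F n).
  apply: contrapT => /forallNP h.
  have : pr mu (\bigcup_n F n) <= pr mu (\bigcup_n B n) - e / 2.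
    apply: pr_bigcup_le => // n.
    - move=> x [i Bi]; by exists (widen_ord (leqnSn n) i).
    - by have := h n; move/negP; rewrite -ltNge => /ltW.
  rewrite (_ : \bigcup_n F n = \bigcup_n B n); first by move: e0; lra.
  apply/seteqP; split => x [m _]; first by move=> [i Bi]; exists i.
  by move=> Bm; exists m.+1 => //; exists ord_max.
have [k0 Hk] := @cell_approximable_family 'I_n (fun i => B i) (fun i => mB i) (fun i => aB i) _ e2.
exists k0 => k kk0; have [Q HQ] := Hk k kk0.
exists [set c | exists i, Q i c].
have mN : measurable [set x | exists i : 'I_n, ~ (B i x <-> Q i (cells k x))].
  by apply: measurable_exists => i; exact: merr.
apply: (@le_trans _ _ (pr mu (((\bigcup_n B n) `\` F n) `|`
    [set x | exists i : 'I_n, ~ (B i x <-> Q i (cells k x))]))).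
  apply: le_pr; first exact: merr.
    by apply: measurableU => //; exact: measurableD.
  move=> x /= nx; have [h|h] := pselect (exists i : 'I_n, ~ (B i x <-> Q i (cells k x))).
    by right.
  left; move/forallNP : h => h.
  have {}h (i : 'I_n) : B i x <-> Q i (cells k x) by apply: contrapT; exact: h.
  have [Ux|nUx] := pselect ((\bigcup_n B n) x).
    split => // -[i Bi]; apply: nx; split => // _; by exists i; apply/h.
  exfalso; apply: nx; split => // -[i /h Bi]; exfalso; apply: nUx; by exists i.
apply: le_trans (pr_leU _ _ mN) _; first exact: measurableD.
have := prID mu mU (mF n); rewrite (setIidr (B := F n)); first lra.
by move=> x [i Bi]; exists i.
Qed.

Let grid_small (e : R) : 0 < e -> exists k0, forall k, (k0 <= k)%N -> k.+1%:R^-1 <= e.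
Proof.
move=> e0; exists (Num.truncn e^-1) => k kk.
rewrite invf_ple ?posrE//; apply: ltW; apply: lt_le_trans (truncnS_gt _) _.
by rewrite ler_nat.
Qed.

(** Only the cell containing the threshold can be misclassified, and an innovation falls into it
    with probability 1/(k+1). *)
Lemma cell_approximable_le (t : 'I_N) (a : R) : cell_approximable [set x | um t x <= a].
Proof.
move=> e e0; have [k0 Hk] := grid_small e0; exists k0 => k kk0.
exists [set c : {ffun 'I_N -> 'I_k.+1} | grid R k (c t).+1 <= a].
case: muH => _ H01 _ _ HU.
have H01' x : 0 < um t x <= 1 by have /andP[-> /ltW ->] := H01 t (trunc t x, coord x t).
pose A x := cell k (um t x) = cell k a.
have mA : measurable [set x | A x] by exact: (measurable_preim (@mum t) (measurable_cell _)).
have HU' : uniform_on mu setT (fun x => um t x).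
  by have := HU t setT measurableT; rewrite (_ : [set x | _] = setT)//.
apply: le_trans (Hk k kk0); rewrite -[leRHS]mulr1 -[X in _ * X](prT mu).
rewrite -(pr_cell (cell k a) measurableT (@mum t) (fun x => H01 t _) HU').
apply: le_pr.
- apply: merr; apply: measurable_ler => //; exact: measurable_cst.
- by apply: measurable_and => //; exact: measurableT.
move=> x /= nx; split => //; have /andP[c1 c2] := cell_bounds k (H01' x).
have {}nx : grid R k (cell k (um t x)).+1 > a /\ um t x <= a.
  rewrite ffunE in nx.
  have [h|h] := leP (um t x) a; have [h'|h'] := leP (grid R k (cell k (um t x)).+1) a.
  - by exfalso; apply: nx; split.
  - by split.
  - by have := le_trans c2 h'; rewrite leNgt h.
  - by exfalso; apply: nx; split; rewrite leNgt ?h ?h'.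
apply/esym/cellE; have [h1 h2] := nx.
by rewrite (lt_le_trans c1 h2) ltW.
Qed.

(** Through the left inverse [V] every Borel set of paths is a Borel set of innovations. The sets of
    innovations that can be approximated form a sigma-algebra containing the orthants. *)
Lemma borel_cell_approximable (B : set E) : measurable B -> cell_approximable B.
Proof.
case: muH => -[mH mH'] _ HK _ _ mB.
pose U := build (fun t z => H t (z.1.1, z.2)).
pose V := build (fun t z => H' t (z.1.2, z.2)).
have mU : measurable_fun setT U.
  apply: measurable_build => i; apply: (measurableT_comp (mH i)).
  apply: measurable_fun_pair => //.
  by apply: (measurableT_comp measurable_fst); exact: measurable_fst.
have mV : measurable_fun setT V.
  apply: measurable_build => i; apply: (measurableT_comp (mH' i)).
  apply: measurable_fun_pair => //.
  by apply: (measurableT_comp measurable_snd); exact: measurable_fst.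
have VU x : V (U x) = x by apply: build_cancel => i /=; rewrite HK.
have -> : B = [set x | [set u | B (V u)] (U x)] by apply/seteqP; split => x /=; rewrite VU.
have : measurable [set u | B (V u)] by exact: (measurable_preim mV mB).
move: [set u | B (V u)] => C mC.
pose S := [set A : set E | measurable A /\ cell_approximable [set x | A (U x)]].
suff : S C by case.
move: mC; rewrite measurable_orthantE; apply: smallest_sub => [|_ [a ->]].
- split.
  + split => // e e0; exists 0%N => k _; exists set0.
    by rewrite (_ : mkset _ = set0) ?pr0 ?ltW//; apply/seteqP; split => x //=; tauto.
  + move=> A [mA aA]; rewrite setTD; split; first exact: measurableC.
    exact: cell_approximableC.
  + move=> A HA; split; first by apply: bigcupT_measurable => n; have [] := HA n.
    rewrite (_ : mkset _ = \bigcup_n [set x | A n (U x)])//.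
    apply: cell_approximable_bigcup => n; last by have [] := HA n.
    by have [mA _] := HA n; exact: (measurable_preim mU mA).
- split; first exact: measurable_orthant.
  (* The finite intersection over coordinates is written with the complements and countable unions
     already treated; indices from [N] on contribute the empty set. *)
  rewrite (_ : mkset _ = ~` \bigcup_n (if (insub n : option 'I_N) is Some t then
      ~` [set x | um t x <= a t] else set0)).
    apply: cell_approximableC; apply: cell_approximable_bigcup => n.
      case: insub => [t|]; last exact: measurable0.
      apply: measurableC; apply: measurable_ler; first exact: mum.
      exact: measurable_cst.
    case: insub => [t|]; first by apply: cell_approximableC; exact: cell_approximable_le.
    move=> e e0; exists 0%N => k _; exists set0.
    by rewrite (_ : mkset _ = set0) ?pr0 ?ltW//; apply/seteqP; split => x //=; tauto.
  apply/seteqP; split => x /=.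
    move=> h [n _]; case: insub => // t /=; apply.
    by have := h t; rewrite /U coord_build.
  move=> h t; rewrite /U coord_build /=; apply: contrapT => nt; apply: h.
  by exists t => //; rewrite valK.
Qed.

(** Rounding the coordinates to multiples of [e] inside a large box involves finitely many
    half-space events; replacing each by a union of cells gives a function of the cells, wrong only
    with small probability. *)
Lemma cell_step_approximation (e : R) : 0 < e -> exists k0, forall k, (k0 <= k)%N ->
  exists xi : {ffun 'I_N -> 'I_k.+1} -> E,
    pr mu [set x | exists i, e < `|coord x i - coord (xi (cells k x)) i|] <= e.
Proof.
move=> e0; have e2 : 0 < e / 2 by lra.
have [n Hn] := coord_tail mu e0 e2.
set tail := [set x | _] in Hn.
have mtail : measurable tail.
  apply: measurable_exists => i; apply: measurable_ler; first exact: measurable_cst.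
  by apply: (measurableT_comp (@normr_measurable R setT)); exact: measurable_coord.
(* Steps of length [e] needed to cover [-ne, ne], shifted to start at 0. *)
pose J := (n + n)%N.
pose D j : R := j%:R * e.
have nD : {homo D : i j / (i <= j)%N >-> i <= j}.
  by move=> i j ij; rewrite /D ler_pM2r// ler_nat.
pose B (ij : 'I_N * 'I_J) := [set x : E | D ij.2.+1 < coord x ij.1 + n%:R * e].
have mB ij : measurable (B ij).
  apply: measurable_ltr; first exact: measurable_cst.
  by apply: measurable_funD; [exact: measurable_coord|exact: measurable_cst].
have [k0 Hk] := cell_approximable_family mB (fun ij => borel_cell_approximable (mB ij)) e2.
exists k0 => k kk0; have [Q HQ] := Hk k kk0.
(* Where every [Q] agrees with its event, this count is [itv_index] of the shifted coordinate, so
   the value is the coordinate rounded down to the grid. *)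
exists (fun c => \row_i ((\sum_(j < J) `[< Q (i, j) c >])%N%:R * e - n%:R * e)).
pose N1 := [set x | exists ij, ~ (B ij x <-> Q ij (cells k x))].
have mN1 : measurable N1 by apply: measurable_exists => ij; exact: merr.
apply: (@le_trans _ _ (pr mu (tail `|` N1))).
  apply: le_pr.
  - apply: measurable_exists => i; apply: measurable_ltr; first exact: measurable_cst.
    apply: (measurableT_comp (@normr_measurable R setT)).
    apply: measurable_funB; first exact: measurable_coord.
    apply: (@measurable_dispatch _ _ _ _ {ffun 'I_N -> 'I_k.+1} (cells k)
      (fun c _ => coord (\row_i ((\sum_(j < J) `[< Q (i, j) c >])%N%:R * e - n%:R * e) : 'rV[R]_N) i)) => c.
      exact: (@measurable_cells k [set c' | c' = c]).
    exact: measurable_cst.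
  - exact: measurableU.
  - move=> x /= [i hi]; apply: contrapT => /not_orP[/forallNP tx /forallNP N1x].
    move: hi; apply/negP; rewrite -leNgt.
    have {}N1x ij : B ij x <-> Q ij (cells k x) by apply: contrapT; exact: N1x.
    rewrite [coord (\row_j _) i]mxE.
    have -> : (\sum_(j < J) `[< Q (i, j) (cells k x) >])%N = itv_index D J (coord x i + n%:R * e).
      apply: eq_bigr => j _; congr nat_of_bool; apply/asboolP/idP.
        by move/N1x.
      by move=> h; apply/N1x.
    have /negP := tx i; rewrite -ltNge ltr_norml => /andP[f1 f2].
    have [|||_ /andP[]] := @itv_index_bounds R D J (coord x i + n%:R * e) nD.
    + by rewrite /D mul0r.
    + by lra.
    + by rewrite /D natrD; lra.
    + set m := itv_index _ _ _; rewrite /D -[m.+1%:R]natr1 => h1 h2.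
      by rewrite ler_norml; apply/andP; split; lra.
apply: le_trans (pr_leU _ mtail mN1) _.
by move: HQ; rewrite -/N1; lra.
Qed.

End cell_approximation.

(** Only the first point is confined to the box: the step approximation of a point of the box may
    lie outside. A near-covering of the compact box yields one radius for all its points. *)
Lemma box_uniform_continuity (R : realType) (N : nat)
    (f : 'rV[R]_N * 'rV[R]_N -> R) (M e : R) : continuous f -> 0 < e ->
  exists2 d : R, 0 < d & forall x y x' y' : 'rV[R]_N,
    (forall i, `|x ord0 i| <= M) -> (forall i, `|y ord0 i| <= M) ->
    (forall i, `|x ord0 i - x' ord0 i| <= d) -> (forall i, `|y ord0 i - y' ord0 i| <= d) ->
    `|f (x, y) - f (x', y')| <= e.
Proof.
move=> cf e0.
pose K := [set v : 'rV[R]_N | forall i, `[- M, M]%classic (v ord0 i)].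
have cK : compact K by apply: (@rV_compact R N (fun=> `[- M, M]%classic)) => i; exact: segment_compact.
have /compact_near_coveringP cov : compact (K `*` K) by exact: compact_setX.
pose P (d : R) (z : 'rV[R]_N * 'rV[R]_N) := forall z' : 'rV[R]_N * 'rV[R]_N,
  ball z d z' -> `|f z - f z'| <= e.
have loc z : (K `*` K) z -> \forall z' \near z & d \near 0^'+, P d z'.
  move=> _; have e2 : 0 < e / 2 by lra.
  have /cvgrPdist_lt/(_ _ e2) /nbhs_ballP[r /= r0 hr] := cf z.
  have r2 : 0 < r / 2 by lra.
  exists (ball z (r / 2), [set d | d < r / 2]).
    by split => /=; [exact: nbhsx_ballx|exact: nbhs_right_lt].
  move=> [z' d] [/= zz' dr] z'' z'z''.
  have h1 : `|f z - f z'| < e / 2 by apply: hr; apply: le_ball zz'; lra.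
  have h2 : `|f z - f z''| < e / 2.
    apply: hr; rewrite (_ : r = r / 2 + r / 2); last by lra.
    by apply: (ball_triangle zz'); apply: le_ball z'z''; exact: ltW.
  rewrite -(subrKA (f z)); apply: le_trans (ler_normD _ _) _.
  by rewrite distrC; move: h1 h2; lra.
have := cov _ _ _ _ loc => /(_ _) near_d.
have [d [d0 hd]] : exists d : R, 0 < d /\ (K `*` K) `<=` P d.
  near (0 : R)^'+ => d; exists d; split; first by near: d; exact: nbhs_right_gt.
  by near: d; exact: near_d.
exists (d / 2); first lra.
move=> x y x' y' xM yM xx' yy'; apply: hd.
  by split => i /=; rewrite in_itv/= -ler_norml.
have cl (a b : 'rV[R]_N) : (forall i, `|a ord0 i - b ord0 i| <= d / 2) -> ball a d b.
  move=> ab; split => // i j; rewrite (ord1 i) /ball/= /ball_/=.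
  by apply: le_lt_trans (ab j) _; lra.
by split; exact: cl.
Unshelve. all: by end_near. Qed.

(** * Integrals of bounded continuous functions under couplings with equal cell masses *)

Section integral_bounds.
Context d (T : measurableType d) (R : realType) (P : probability T R).

Lemma integral_finite_valued (I : finType) (h : T -> I) (F : I -> R) :
  (forall c, measurable [set z | h z = c]) ->
  (\int[P]_z (F (h z))%:E = (\sum_c F c * pr P [set z | h z = c])%:E)%E.
Proof.
move=> mh; rewrite -sumEFin.
have hT : setT = \big[setU/set0]_(c <- enum I) [set z | h z = c].
  apply/seteqP; split => // z _; rewrite -bigcup_seq; exists (h z) => //.
  by rewrite /= mem_enum.
have mF : measurable_fun setT (fun z => F (h z)).
  by apply: (@measurable_dispatch _ _ _ _ I h (fun c _ => F c)) => // c; exact: measurable_cst.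
rewrite [in LHS]hT integral_bigsetU_EFin.
- rewrite big_enum/=; apply: eq_bigr => c _.
  transitivity (\int[P]_(z in [set z | h z = c]) (F c)%:E)%E.
    by apply: eq_integral => z; rewrite inE /= => ->.
  by rewrite integral_cst// EFinM; congr (_ * _)%E; exact: prE (mh c).
- exact: mh.
- exact: enum_uniq.
- by move=> i j _ _ [z [/= <- <-]].
- by rewrite -hT; exact/measurable_EFinP.
Qed.

Lemma bounded_integrable (f : T -> R) (M : R) : measurable_fun setT f ->
  (forall z, `|f z| <= M) -> P.-integrable setT (EFin \o f).
Proof.
move=> mf fM; apply: measurable_bounded_integrable => //.
  by rewrite (le_lt_trans (probability_le1 P measurableT)) ?ltry.
exists M; split; first exact: num_real.
by move=> r Mr z _; exact: le_trans (fM z) (ltW Mr).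
Qed.

Lemma integral_close (f g : T -> R) (B : set T) (M e : R) :
  measurable_fun setT f -> measurable_fun setT g -> measurable B ->
  (forall z, `|f z| <= M) -> (forall z, `|g z| <= M) ->
  0 <= e -> (forall z, ~ B z -> `|f z - g z| <= e) ->
  `|fine (\int[P]_z (f z)%:E) - fine (\int[P]_z (g z)%:E)| <= e + 2 * M * pr P B.
Proof.
move=> mf mg mB fM gM e0 fg.
have intf := bounded_integrable mf fM; have intg := bounded_integrable mg gM.
have mfg : measurable_fun setT (fun z => f z - g z) by exact: measurable_funB.
have M20 : `|2 * M| = 2 * M by rewrite ger0_norm// mulr_ge0//; exact: le_trans (normr_ge0 _) (fM point).
have M0 : 0 <= M := le_trans (normr_ge0 _) (fM point).
have fgM z : `|f z - g z| <= 2 * M.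
  by apply: le_trans (ler_normB _ _) _; have := fM z; have := gM z; lra.
have intfg := bounded_integrable mfg fgM.
rewrite -[fine (\int[P]_z (f z)%:E)]/(Rintegral P setT f).
rewrite -[fine (\int[P]_z (g z)%:E)]/(Rintegral P setT g).
rewrite -RintegralB//; apply: le_trans (le_normr_Rintegral measurableT intfg) _.
have mabs : measurable_fun setT (fun z => `|f z - g z|).
  by apply: (measurableT_comp (@normr_measurable R setT)).
have m1 : measurable_fun setT (\1_B : T -> R) by exact: measurable_indic.
have i1 : P.-integrable setT (EFin \o (\1_B : T -> R)).
  by apply: (@bounded_integrable _ 1) => // z; rewrite indicE; case: (_ \in _); rewrite ?normr1 ?normr0.
have i2 : P.-integrable setT (EFin \o (fun z => 2 * M * \1_B z)).
  apply: (@bounded_integrable _ (2 * M)); first exact: measurable_funM.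
  by move=> z; rewrite indicE; case: (_ \in _); rewrite ?mulr1 ?mulr0 ?normr0 ?M20 ?mulr_ge0.
have i3 : P.-integrable setT (EFin \o (fun=> e)).
  by apply: (@bounded_integrable _ `|e|) => //.
apply: (@le_trans _ _ (Rintegral P setT (fun z => e + 2 * M * \1_B z))).
  apply: le_Rintegral => //.
  - by apply: (@bounded_integrable _ (2 * M)) => // z; rewrite normr_id.
  - apply: (@bounded_integrable _ (`|e| + 2 * M)).
      by apply: measurable_funD => //; exact: measurable_funM.
    move=> z; apply: le_trans (ler_normD _ _) _; rewrite lerD2l.
    by rewrite indicE; case: (_ \in _); rewrite ?mulr1 ?mulr0 ?normr0 ?M20 ?mulr_ge0.
  - move=> z _; rewrite indicE; have [zB|zB] := boolP (z \in B).
      by rewrite mulr1; apply: le_trans (fgM z) _; rewrite lerDr.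
    by rewrite mulr0 addr0; apply: fg => /mem_set; apply/negP.
rewrite RintegralD// RintegralZl// Rintegral_cst// /Rintegral integral_indic// setIT.
by rewrite -/(pr P setT) prT mulr1.
Qed.

End integral_bounds.

Section integral_approximation.
Context (R : realType) (N : nat).
Local Notation E := (RN R N).
Local Notation coord := Defs.coord.

Definition couples (mu nu : probability E R) (P : probability (E * E)%type R) :=
  (forall A, measurable A -> pr P [set z | A z.1] = pr mu A) /\
  (forall B, measurable B -> pr P [set z | B z.2] = pr nu B).

(** The size M of the box comes before the precision d, since d is the modulus of continuity of a
    function on that box. *)
Lemma bad_cell_points (mu : probability E R) (H H' : 'I_N -> E * R -> R) (eta : R) :
  uniformizes mu H H' -> 0 < eta ->
  exists2 M : R, 0 <= M & forall d : R, 0 < d -> exists k0, forall k, (k0 <= k)%N ->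
  exists (xi : {ffun 'I_N -> 'I_k.+1} -> E) (C : set E),
    [/\ measurable C, pr mu C <= eta & forall x, ~ C x -> forall i,
      `|coord x i| <= M /\ `|coord x i - coord (xi (cells H k x)) i| <= d].
Proof.
move=> muH eta0; have eta2 : 0 < eta / 2 by lra.
have [n Hn] := coord_tail mu (@ltr01 R) eta2; exists n%:R => // d d0.
(* In [cell_step_approximation] one number bounds both the error and the probability, hence the
   minimum. *)
have dd0 : 0 < Num.min d (eta / 2) by rewrite lt_min d0.
have [k0 Hk] := cell_step_approximation muH dd0; exists k0 => k kk0.
have [xi Hxi] := Hk k kk0; exists xi.
set C1 := [set x | _] in Hn; set C2 := [set x | _] in Hxi.
have mC1 : measurable C1.
  apply: measurable_exists => i; apply: measurable_ler; first exact: measurable_cst.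
  by apply: (measurableT_comp (@normr_measurable R setT)); exact: measurable_coord.
have mC2 : measurable C2.
  apply: measurable_exists => i; apply: measurable_ltr; first exact: measurable_cst.
  apply: (measurableT_comp (@normr_measurable R setT)).
  apply: measurable_funB; first exact: measurable_coord.
  apply: (@measurable_dispatch _ _ _ _ {ffun 'I_N -> 'I_k.+1} (cells H k)
    (fun c _ => coord (xi c) i)) => c; last exact: measurable_cst.
  exact: (measurable_cells muH [set c' | c' = c]).
exists (C1 `|` C2); split; first exact: measurableU.
  apply: le_trans (pr_leU _ mC1 mC2) _.
  have : Num.min d (eta / 2) <= eta / 2 by rewrite ge_min lexx orbT.
  by move: Hn Hxi; lra.
move=> x /not_orP[/forallNP h1 /forallNP h2] i; split.
  by have /negP := h1 i; rewrite -ltNge mulr1 => /ltW.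
have /negP := h2 i; rewrite -leNgt => h; apply: le_trans h _.
by rewrite ge_min lexx.
Qed.

Variables (mu nu : probability E R) (H H' G G' : 'I_N -> E * R -> R).
Hypotheses (muH : uniformizes mu H H') (nuG : uniformizes nu G G').

(** [f] is compared with a step function of the cells, whose integral depends only on the cell
    masses. The exceptional set is a union of one event of x and one of y, so its probability is
    controlled by the marginals, uniformly over all couplings. *)
Lemma integral_history_close (f : E * E -> R) (eps : R) : cont_bounded f -> 0 < eps ->
  exists k0, forall k, (k0 <= k)%N -> forall P1 P2 : probability (E * E)%type R,
  couples mu nu P1 -> couples mu nu P2 ->
  (forall c, pr P1 [set z | history k H G N z.1 z.2 = c] =
             pr P2 [set z | history k H G N z.1 z.2 = c]) ->
  `|fine (\int[P1]_z (f z)%:E) - fine (\int[P2]_z (f z)%:E)| < eps.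
Proof.
move=> [cf [B fB]] eps0.
have B0 : 0 <= B := le_trans (normr_ge0 _) (fB point).
(* Each measure costs [e] off the exceptional set and at most [e] on it, 4e in all. There the
   integrands differ by at most 2B on mass at most 2 [eta], which explains [eta]; B + 1 avoids
   dividing by 0. *)
pose e := eps / 5; have e0 : 0 < e by rewrite /e; lra.
pose eta := e / (4 * (B + 1)).
have eta0 : 0 < eta by rewrite divr_gt0//; lra.
have [M1 M10 H1] := bad_cell_points muH eta0.
have [M2 M20 H2] := bad_cell_points nuG eta0.
have [d d0 Hd] := box_uniform_continuity (M1 + M2) cf e0.
have [k1 {}H1] := H1 d d0; have [k2 {}H2] := H2 d d0.
exists (maxn k1 k2) => k; rewrite geq_max => /andP[/H1[xi [C1 [mC1 C1e hC1]]] /H2[ze [C2 [mC2 C2e hC2]]]].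
move=> P1 P2 cP1 cP2 P12.
pose F (c : {ffun 'I_N -> 'I_k.+1 * 'I_k.+1}) : R := f (xi [ffun s => (c s).1], ze [ffun s => (c s).2]).
pose h (z : E * E) := history k H G N z.1 z.2.
have mh c : measurable [set z | h z = c] by exact: (measurable_history muH nuG N c).
have mF : measurable_fun setT (fun z => F (h z)).
  by apply: (@measurable_dispatch _ _ _ _ {ffun 'I_N -> 'I_k.+1 * 'I_k.+1} h (fun c _ => F c)).
have mf : measurable_fun setT f by exact: measurable_continuous_pair.
have hE z : F (h z) = f (xi (cells H k z.1), ze (cells G k z.2)).
  by congr (f (xi _, ze _)); apply/ffunP => s; rewrite !ffunE ltn_ord.
pose C := [set z : E * E | C1 z.1 \/ C2 z.2].
have m1 : measurable [set z : E * E | C1 z.1] by exact: (measurable_preim measurable_fst mC1).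
have m2 : measurable [set z : E * E | C2 z.2] by exact: (measurable_preim measurable_snd mC2).
have mC : measurable C by exact: measurable_or.
have close P : couples mu nu P ->
    `|fine (\int[P]_z (f z)%:E) - fine (\int[P]_z (F (h z))%:E)| <= 2 * e.
  move=> [P_1 P_2]; apply: le_trans (integral_close P mf mF mC fB _ (ltW e0) _) _.
  - by move=> z; exact: fB.
  - move=> [x y] /= /not_orP[/= nx ny]; rewrite hE /=; apply: Hd => i.
    + by apply: le_trans (hC1 _ nx i).1 _; rewrite lerDl.
    + by apply: le_trans (hC2 _ ny i).1 _; rewrite lerDr.
    + exact: (hC1 _ nx i).2.
    + exact: (hC2 _ ny i).2.
  have PC : pr P C <= 2 * eta.
    apply: le_trans (pr_leU _ m1 m2) _; rewrite P_1// P_2//.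
    by move: C1e C2e; lra.
  have : 2 * B * pr P C <= 2 * B * (2 * eta) by rewrite ler_wpM2l// mulr_ge0.
  have : 4 * (B + 1) * eta = e by rewrite /eta mulrC divfK//; apply/eqP; lra.
  by move: eta0; nra.
have FE : fine (\int[P1]_z (F (h z))%:E) = fine (\int[P2]_z (F (h z))%:E).
  rewrite !integral_finite_valued//; congr fine; congr EFin.
  by apply: eq_bigr => c _; rewrite /h P12.
have := close P1 cP1; have := close P2 cP2; rewrite FE distrC => h2 h1.
rewrite -(subrKA (fine (\int[P2]_z (F (h z))%:E))).
apply: le_lt_trans (ler_normD _ _) _; move: h1 h2; rewrite /e; lra.
Qed.

Lemma integrals_history_close (fs : seq (E * E -> R)) (eps : R) :
  (forall f, f \in fs -> cont_bounded f) -> 0 < eps ->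
  exists k, forall P1 P2 : probability (E * E)%type R,
  couples mu nu P1 -> couples mu nu P2 ->
  (forall c, pr P1 [set z | history k H G N z.1 z.2 = c] =
             pr P2 [set z | history k H G N z.1 z.2 = c]) ->
  forall f, f \in fs ->
  `|fine (\int[P1]_z (f z)%:E) - fine (\int[P2]_z (f z)%:E)| < eps.
Proof.
move=> cfs eps0.
suff [k0 /(_ k0 (leqnn k0)) h] : exists k0, forall k, (k0 <= k)%N ->
    forall P1 P2 : probability (E * E)%type R,
    couples mu nu P1 -> couples mu nu P2 ->
    (forall c, pr P1 [set z | history k H G N z.1 z.2 = c] =
               pr P2 [set z | history k H G N z.1 z.2 = c]) ->
    forall f, f \in fs ->
    `|fine (\int[P1]_z (f z)%:E) - fine (\int[P2]_z (f z)%:E)| < eps by exists k0.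
elim: fs cfs => [|f fs IH] cfs; first by exists 0%N.
have [|k1 h1] := IH; first by move=> g gs; apply: cfs; rewrite inE gs orbT.
have [|k2 h2] := @integral_history_close f eps _ eps0; first by apply: cfs; rewrite mem_head.
exists (maxn k1 k2) => k; rewrite geq_max => /andP[kk1 kk2] P1 P2 c1 c2 P12 g.
rewrite inE => /predU1P[->|gs]; first exact: (h2 k).
exact: (h1 k).
Qed.

End integral_approximation.

(** * Biadapted Monge couplings *)

Section graph_couplings.
Context (R : realType) (N : nat).
Local Notation E := (RN R N).
Local Notation coord := Defs.coord.

(** The disintegration is the Dirac kernel at [T x], and for adapted [T] the past of x decides
    whether [T x] lies in an event of the first t coordinates. *)
Lemma causal_graph (mu : probability E R) (T : E -> E) (m : set E -> set E -> \bar R) :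
  measurable_fun setT T -> adapted T ->
  (forall A B, measurable A -> measurable B -> m A B = mu (A `&` T @^-1` B)) ->
  causal mu m.
Proof.
move=> mT /adaptedP aT mE; exists (kdirac mT); split=> [A B mA mB|t B /FsigP[mB hB]].
  have mTB : measurable (T @^-1` B) by exact: (measurable_preim mT mB).
  rewrite mE// setIC -(integral_indic mu mA mTB).
  by apply: eq_integral => x _; rewrite /kdirac/= diracE indicE.
exists (fun x => kdirac mT x B); split; last exact: aeW.
move=> D mD; apply/FsigP; split.
  exact: (measurable_preim (measurable_kernel (kdirac mT) B mB) mD).
move=> x; suff e : \d_(T (trunc t x)) B = \d_(T x) B :> \bar R by rewrite /preimage/= /kdirac/= e.
rewrite !diracE; congr (_ %:R)%:E; congr nat_of_bool; apply/idP/idP; rewrite !inE => /hB h; apply/hB.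
  by rewrite (aT t x (trunc t x))// trunc_trunc.
by rewrite (aT t (trunc t x) x)// trunc_trunc.
Qed.

Lemma measurable_graph (T : E -> E) : measurable_fun setT T ->
  measurable_fun setT (fun x => (x, T x)).
Proof. by move=> mT; exact: measurable_fun_pair. Qed.

(** Exchanging the two factors turns the graph of [T] under [mu] into the graph of its inverse under
    [nu], which is adapted as well. *)
Lemma bicausal_graph (mu nu : probability E R) (T : E -> E) (mT : measurable_fun setT T) :
  biadapted T -> pushes T mu nu -> bicausal mu nu (image_prob mu (measurable_graph mT)).
Proof.
move=> [T' [_ mT' TK TK' [aT aT']]] Tmu; split.
- move=> A B mA mB; split; first by rewrite [LHS]image_probE; congr (mu _); apply/seteqP; split => x //= [].
  by rewrite [LHS]image_probE -Tmu//; congr (mu _); apply/seteqP; split => x //= [].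
- apply: (causal_graph mT aT) => A B mA mB; exact: image_probE.
- apply: (causal_graph mT' aT') => A B mA mB; rewrite [LHS]image_probE -Tmu; last first.
    by apply: measurableI => //; exact: (measurable_preim mT' mB).
  by congr (mu _); apply/seteqP; split => x /= [h1 h2]; split => //; rewrite ?TK// -(TK x).
Qed.

Lemma integral_graph (mu : probability E R) (T : E -> E) (mT : measurable_fun setT T)
    (c : E * E -> R) : cont_bounded c ->
  (\int[image_prob mu (measurable_graph mT)]_z (c z)%:E = \int[mu]_x (c (x, T x))%:E)%E.
Proof.
move=> [cc [M cM]]; have mc := measurable_continuous_pair cc.
transitivity (\int[pushforward mu (fun x => (x, T x))]_z (c z)%:E)%E.
  apply: eq_measure_integral; first exact: measurable_graph.
  by move=> mg A mA _; rewrite [LHS]image_probE.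
rewrite integral_pushforward//.
- exact: measurable_graph.
- exact/measurable_EFinP.
- rewrite preimage_setT; apply: (@bounded_integrable _ _ _ _ _ M).
    exact: (measurableT_comp mc (measurable_graph mT)).
  by move=> x; exact: cM.
Qed.

Lemma couples_coupling (mu nu : probability E R) (pi : probability (E * E)%type R) :
  coupling mu nu pi -> couples mu nu pi.
Proof.
move=> h; split=> [A mA|B mB]; rewrite /pr; congr fine.
  have [<- _] := h A setT mA measurableT; congr (pi _).
  by apply/seteqP; split => z //= [].
have [_ <-] := h setT B measurableT mB; congr (pi _).
by apply/seteqP; split => z //= [].
Qed.

Lemma monge_approximation (mu nu : probability E R) (pi : probability (E * E)%type R)
    (fs : seq (E * E -> R)) (eps : R) :
  abs_cont_leb mu -> abs_cont_leb nu -> bicausal mu nu pi ->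
  (forall f, f \in fs -> cont_bounded f) -> 0 < eps ->
  exists (T : E -> E) (mT : measurable_fun setT T), [/\ biadapted T, pushes T mu nu &
    forall f, f \in fs ->
    `|fine (\int[image_prob mu (measurable_graph mT)]_z (f z)%:E) -
      fine (\int[pi]_z (f z)%:E)| < eps].
Proof.
move=> /uniformizers_exist[H [H' muH]] /uniformizers_exist[G [G' nuG]] bc cfs eps0.
have [k Hk] := integrals_history_close muH nuG cfs eps0.
have pi_um := bicausal_uniform1 muH bc; have pi_un := bicausal_uniform2 nuG bc.
have bT := biadapted_monge_map k muH nuG pi_um pi_un.
have pT := @pushes_monge_map _ _ k _ _ _ _ _ _ muH nuG _ pi_um pi_un.
have hT c := history_monge_map muH nuG pi_um pi_un c (leqnn N).
exists (monge_map k H G G' pi), (measurable_monge_map k muH nuG pi); split => //.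
apply: Hk.
- by apply: couples_coupling; have [] := bicausal_graph (measurable_monge_map k muH nuG pi) bT pT.
- by apply: couples_coupling; case: bc.
- by move=> c; rewrite pr_image_prob hT.
Qed.

End graph_couplings.

Theorem theorem1p4 (R : realType) (N : nat) (mu nu : probability (RN R N) R) :
  abs_cont_leb mu -> abs_cont_leb nu ->
  (* density of biadapted Monge couplings in Cpl_bc(mu, nu) for the weak topology:
     every basic weak neighbourhood of every bicausal coupling contains some
     (id, T)_* mu with T biadapted and T_* mu = nu *)
  (forall pi : probability (RN R N * RN R N)%type R, bicausal mu nu pi ->
   forall (fs : seq (RN R N * RN R N -> R)),
     (forall f, f \in fs -> cont_bounded f) ->
   forall eps : R, 0 < eps ->
   exists (T : RN R N -> RN R N) (rho : probability (RN R N * RN R N)%type R),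
     [/\ biadapted T, pushes T mu nu,
         (forall A, measurable A -> rho A = mu ((fun x => (x, T x)) @^-1` A)) &
         forall f, f \in fs ->
           `| fine (\int[rho]_z (f z)%:E) - fine (\int[pi]_z (f z)%:E) | < eps])
  /\
  (forall c : RN R N * RN R N -> R, cont_bounded c ->
     ereal_inf [set (\int[pi]_z (c z)%:E)%E
                 | pi in [set pi : probability (RN R N * RN R N)%type R
                            | bicausal mu nu pi]] =
     ereal_inf [set (\int[mu]_x (c (x, T x))%:E)%E
                 | T in [set T : RN R N -> RN R N | biadapted T /\ pushes T mu nu]]).
Proof.
move=> ac_mu ac_nu; split=> [pi bc fs cfs eps eps0|c cc].
  have [T [mT [bT pT h]]] := monge_approximation ac_mu ac_nu bc cfs eps0.
  exists T, (image_prob mu (measurable_graph mT)); split => // A _; exact: image_probE.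
apply/eqP; rewrite eq_le; apply/andP; split.
  apply: ereal_inf_le_tmp => _ [T [bT pT] <-].
  have mT : measurable_fun setT T by case: bT => ? [].
  exists (image_prob mu (measurable_graph mT)); first exact: bicausal_graph.
  exact: integral_graph.
apply: le_ereal_inf_tmp => _ [pi bc <-]; apply/lee_addgt0Pr => e e0.
have [|T [mT [bT pT /(_ c (mem_head _ _)) h]]] := @monge_approximation R N mu nu pi [:: c] e ac_mu ac_nu bc _ e0.
  by move=> f; rewrite inE => /eqP ->.
apply: ge_ereal_inf; exists (\int[mu]_x (c (x, T x))%:E)%E; first by exists T.
(* Bounded integrands have finite integrals, so the estimate between [fine] values transfers to the
   extended reals. *)
have fin (P : probability (RN R N * RN R N)%type R) :
    (\int[P]_z (c z)%:E)%E = (fine (\int[P]_z (c z)%:E)%E)%:E.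
  case: cc => cc [M cM]; rewrite fineK//; apply: integrable_fin_num => //.
  exact: bounded_integrable (measurable_continuous_pair cc) cM.
rewrite -(integral_graph mu mT cc).
have : fine (\int[image_prob mu (measurable_graph mT)]_z (c z)%:E) <=
    fine (\int[pi]_z (c z)%:E) + e by move: h; rewrite ltr_norml => /andP[_]; lra.
by rewrite -lee_fin EFinD -!fin.
Qed.
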